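(* Let $N,M\ge1$ be integers and let $\mathcal{H}$, $\mathcal{H}_j$, $\mathcal{F}_j$ ($j=0,\dots,N$) be as defined in the context. Then $$\mathcal{H}=\sum_{j=0}^N\mathcal{H}_j,\qquad \mathrm{Inv}(\mathcal{H})=\prod_{j=0}^N\mathcal{F}_j,$$ where the order of the factors in the product is not important. Moreover, for any $\mathcal{A}\in\mathcal{H}$, any $\mathcal{B}\in\mathrm{Inv}(\mathcal{H})$ and any permutation $(j_0,\dots,j_N)$ of $(0,\dots,N)$ there exist unique representations $$\mathcal{A}=\sum_{j=0}^N\mathcal{A}_j,\quad \mathcal{A}_j\in\mathcal{H}_j,\qquad\qquad \mathcal{B}=\mathcal{B}_{j_0}\circ\dots\circ\mathcal{B}_{j_N},\quad \mathcal{B}_{j_i}\in\mathcal{F}_{j_i}\ (i=0,\dots,N).$$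
   Context: For $1\le j\le N$, $\langle\cdot\rangle_j:=\int_{[0,1]^j}\cdot\;dk_1\cdots dk_j$ (applied entrywise to scalar-, vector- or matrix-valued functions of $\mathbf{k}=(k_1,\dots,k_N)\in[0,1]^N$); the result depends only on $(k_{j+1},\dots,k_N)$ and is regarded also as a function on $[0,1]^N$ that is constant in $k_1,\dots,k_j$. $\mathcal{H}$ is the smallest (not necessarily closed) subalgebra of the algebra of bounded linear operators on $L^2([0,1]^N,\mathbb{C}^M)$ containing all operators $\mathbf{A}\cdot$ of multiplication by continuous $M\times M$ matrix-valued functions $\mathbf{A}$ on $[0,1]^N$ and all operators $\langle\cdot\rangle_1,\dots,\langle\cdot\rangle_N$. $\mathbf{A}\langle\mathbf{B}\cdot\rangle_j$ denotes the operator $\mathbf{u}\mapsto\mathbf{A}\langle\mathbf{B}\mathbf{u}\rangle_j$. Let $\mathcal{H}_0=\{\mathbf{A}\cdot\}$, with $\mathbf{A}$ ranging over continuous $M\times M$ matrix-valued functions on $[0,1]^N$, and for $j=1,\dots,N$ let $\mathcal{H}_j=\{\mathbf{A}\langle\mathbf{B}\cdot\rangle_j\}$, with $\mathbf{A}$, $\mathbf{B}$ ranging over continuous matrix-valued functions on $[0,1]^N$ of sizes $M\times M'$ and $M'\times M$, $M'$ any positive integer. $\mathrm{Inv}(S)$ denotes the set of elements of $S$ that are invertible as bounded operators on $L^2([0,1]^N,\mathbb{C}^M)$. Define $\mathcal{F}_0=\mathrm{Inv}(\mathcal{H}_0)$ and $\mathcal{F}_j=\mathrm{Inv}(\{\mathcal{I}+\mathcal{A}:\mathcal{A}\in\mathcal{H}_j\})$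 for $j=1,\dots,N$, where $\mathcal{I}$ is the identity operator. $\sum$ and $\prod$ of sets mean the set of all sums, respectively all compositions (in the given order), of elements taken one from each set. *)

(* Defs.v *)
From HB Require Import structures.
From mathcomp Require Import all_boot all_order all_algebra.
From mathcomp Require Import generic_quotient ring_quotient perm complex.
From mathcomp Require Import all_classical all_reals all_analysis.
From mathcomp Require Import ring lra.
Set Implicit Arguments.
Unset Strict Implicit.
Unset Printing Implicit Defensive.
Import Order.TTheory GRing.Theory Num.Theory.
Import numFieldNormedType.Exports.
Local Open Scope classical_set_scope.
Local Open Scope ring_scope.

(* A point (k_1, ..., k_n) is a tuple over measurableTypeR R, the copy of R
   that carries the Borel sigma-algebra and lebesgue_measure; k_i is
   tnth k (i - 1). *)
Notation point R n := (n.-tuple (measurableTypeR R)).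

Section CubeMeasure.
Variable R : realType.

Definition lebesgue01 :=
  mrestr (@lebesgue_measure R) (@measurable_itv R `[0, 1]).

HB.instance Definition _ := Measure.on lebesgue01.

Lemma lebesgue01_setT : lebesgue01 setT = 1%E.
Proof.
rewrite /lebesgue01 /mrestr setTI lebesgue_measure_itv /= lte_fin ltr01.
by rewrite oppr0 adde0.
Qed.

HB.instance Definition _ :=
  Measure_isProbability.Build _ _ _ lebesgue01 lebesgue01_setT.

Definition cons_pair n (p : measurableTypeR R * point R n) : point R n.+1 :=
  [the point R n.+1 of p.1 :: p.2].

Lemma measurable_cons_pair n : measurable_fun setT (@cons_pair n).
Proof. exact: measurable_cons. Qed.

HB.instance Definition _ n :=
  isMeasurableFun.Build _ _ _ _ (@cons_pair n) (@measurable_cons_pair n).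

(* Lebesgue measure on R^n restricted to [0,1]^n, as an iterated product. *)
Fixpoint cube_measure n : probability (point R n) R :=
  if n is n'.+1
  then distribution (lebesgue01 \x cube_measure n')%E (@cons_pair n')
  else dirac [tuple].

Definition cube n : set (point R n) :=
  [set k | forall i, 0 <= (tnth k i : R) <= 1].

End CubeMeasure.

Section Averages.
Variables (R : realType) (N : nat).

Definition point_of_row (v : 'rV[R]_N) : point R N := [tuple v ord0 i | i < N].

(* Tuples carry no topology in the library, so continuity is read on row
   vectors; R[i]^o is R[i] with the topology of its modulus.  The values of A
   outside the cube are irrelevant. *)
Definition continuous_on_cube m n (A : point R N -> 'M[R[i]]_(m, n)) :=
  {within point_of_row @^-1` @cube R N,
    continuous (A \o point_of_row : 'rV[R]_N -> 'M[R[i]^o]_(m, n))}.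

(* (x_1, ..., x_j, k_(j+1), ..., k_N): nth falls back on its default value
   k_i as soon as i exceeds the length j of x. *)
Definition replace_first j (x : point R j) (k : point R N) : point R N :=
  [tuple nth (tnth k i) x i | i < N].

(* <u>_j, integrated entrywise over the first j variables. *)
Definition average j m (u : point R N -> 'cV[R[i]]_m) (k : point R N) :
    'cV[R[i]]_m :=
  \col_i Complex
    (\int[cube_measure R j]_(x in @cube R j)
       complex.Re (u (replace_first x k) i ord0))
    (\int[cube_measure R j]_(x in @cube R j)
       complex.Im (u (replace_first x k) i ord0)).

End Averages.

Section SquareIntegrable.
Variables (R : realType) (N M : nat).
Local Notation mu := (cube_measure R N).
Implicit Types u v : point R N -> 'cV[R[i]]_M.

Definition re_part u (i : 'I_M) : point R N -> R := fun k => complex.Re (u k i ord0).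
Definition im_part u (i : 'I_M) : point R N -> R := fun k => complex.Im (u k i ord0).

(* L^2([0,1]^N, C^M) before the quotient: the real and imaginary parts of all
   components are in the library's L^2. *)
Definition sqint : {pred point R N -> 'cV[R[i]]_M} := fun u =>
  [forall i, (re_part u i \in Lfun mu 2%:E) && (im_part u i \in Lfun mu 2%:E)].

Lemma sqint_submod_closed : submod_closed sqint.
Proof.
have [L0 LZ] := Lfun_submod_closed mu (lee1n 2).
have LD (a b : R) (f g : point R N -> R) : f \in Lfun mu 2%:E -> g \in Lfun mu 2%:E ->
    (fun k => a * f k + b * g k) \in Lfun mu 2%:E.
  move=> fL gL; have gL' := LZ b _ _ gL L0; have := LZ a _ _ fL gL'.
  by rewrite addr0.
have LDD (f g : point R N -> R) : f \in Lfun mu 2%:E -> g \in Lfun mu 2%:E ->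
    (fun k => f k + g k) \in Lfun mu 2%:E.
  move=> fL gL; have := LD 1 1 _ _ fL gL.
  by under eq_fun do rewrite !mul1r.
split.
  apply/forallP => i; apply/andP; split; rewrite /re_part /im_part;
  by rewrite [X in X \in _](_ : _ = 0)//; apply/funext => k; rewrite mxE.
move=> a u v /forallP uL /forallP vL; apply/forallP => i.
have /andP[ur ui] := uL i; have /andP[vr vi] := vL i.
apply/andP; split.
- have := LDD _ _ (LD (complex.Re a) (- complex.Im a) _ _ ur ui) vr.
  rewrite [X in X \in _ -> _](_ : _ = re_part (a *: u + v) i)//; apply/funext => k; rewrite /re_part /im_part !mxE.
  by case: a (u k i ord0) (v k i ord0) => [a b] [c d] [e f] /=; rewrite mulNr.
- have := LDD _ _ (LD (complex.Re a) (complex.Im a) _ _ ui ur) vi.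
  rewrite [X in X \in _ -> _](_ : _ = im_part (a *: u + v) i)//; apply/funext => k; rewrite /re_part /im_part !mxE.
  by case: a (u k i ord0) (v k i ord0) => [a b] [c d] [e f] /=.
Qed.

HB.instance Definition _ := GRing.isSubmodClosed.Build _ _ sqint sqint_submod_closed.

Record sqfun := Sqfun { sqfun_val :> point R N -> 'cV[R[i]]_M; _ : sqfun_val \in sqint }.
HB.instance Definition _ := [isSub for sqfun_val].
HB.instance Definition _ := [Choice of sqfun by <:].
HB.instance Definition _ := [SubChoice_isSubLmodule of sqfun by <:].

Definition ae_zero : {pred sqfun} := fun u : sqfun => `[< {ae mu, forall k, u k = 0} >].

Lemma ae_zero_submod_closed : submod_closed ae_zero.
Proof.
split; first by apply/asboolP; apply: aeW => k.
move=> a u v /asboolP u0 /asboolP v0; apply/asboolP.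
apply: filterS2 u0 v0 => k /= uk vk.
by rewrite -[LHS]/(a *: u k + v k) uk vk scaler0 addr0.
Qed.

HB.instance Definition _ :=
  GRing.isSubmodClosed.Build _ _ ae_zero ae_zero_submod_closed.

(* L^2([0,1]^N, C^M): square-integrable functions modulo equality a.e.; an
   element coerces to one of its representatives. *)
Definition L2 : Type := Quotient.quot ae_zero.
HB.instance Definition _ := GRing.Zmodule.on L2.
HB.instance Definition _ := EqQuotient.on L2.
Definition L2_fun (x : L2) : sqfun := repr x.
Coercion L2_fun : L2 >-> sqfun.


Lemma L2_piP (u v : sqfun) :
  \pi_L2%qT u = \pi_L2%qT v :> L2 <-> {ae mu, forall k, u k = v k}.
Proof.
have subE k : (u - v) k = u k - v k by [].
split=> [/eqP|uv].
  rewrite -Quotient.idealrBE => /asboolP; apply: filterS => k.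
  by rewrite subE => /eqP; rewrite subr_eq0 => /eqP.
apply/eqP; rewrite -Quotient.idealrBE; apply/asboolP; apply: filterS uv => k uv.
by rewrite subE uv subrr.
Qed.

Lemma L2_eqP (x y : L2) : x = y <-> {ae mu, forall k, x k = y k}.
Proof. by rewrite -L2_piP !reprK. Qed.

Lemma L2_pi_ae (u : sqfun) : {ae mu, forall k, (\pi_L2%qT u : L2) k = u k}.
Proof. by rewrite -L2_piP reprK. Qed.

Lemma L2_repr (x : L2) : exists u : sqfun, x = \pi_L2%qT u.
Proof. by exists (repr x); rewrite reprK. Qed.

Lemma L2_piD (u v : sqfun) : \pi_L2%qT u + \pi_L2%qT v = \pi_L2%qT (u + v) :> L2.
Proof. exact/esym/(@Quotient.pi_add _ ae_zero u v). Qed.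

Definition L2_scale (a : R[i]) (x : L2) : L2 := \pi_L2%qT (a *: (x : sqfun)).

Lemma L2_scale_pi a (u : sqfun) : L2_scale a (\pi_L2%qT u) = \pi_L2%qT (a *: u).
Proof.
apply/L2_piP; apply: filterS (L2_pi_ae u) => k uk.
by rewrite -[LHS]/(a *: (\pi_L2%qT u : L2) k) uk.
Qed.

Lemma L2_scaleA a b x : L2_scale a (L2_scale b x) = L2_scale (a * b) x.
Proof. by have [u ->] := L2_repr x; rewrite !L2_scale_pi scalerA. Qed.

Lemma L2_scale1 : left_id 1 L2_scale.
Proof. by move=> x; have [u ->] := L2_repr x; rewrite L2_scale_pi scale1r. Qed.

Lemma L2_scaleDr : right_distributive L2_scale +%R.
Proof.
move=> a x y; have [u ->] := L2_repr x; have [v ->] := L2_repr y.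
by rewrite L2_piD !L2_scale_pi L2_piD scalerDr.
Qed.

Lemma L2_scaleDl x : {morph L2_scale^~ x : a b / a + b}.
Proof. by move=> a b; have [u ->] := L2_repr x; rewrite !L2_scale_pi L2_piD scalerDl. Qed.

HB.instance Definition _ := GRing.Zmodule_isLmodule.Build R[i] L2
  L2_scaleA L2_scale1 L2_scaleDr L2_scaleDl.

Lemma L2_linear_pi a (u v : sqfun) :
  a *: (\pi_L2%qT u : L2) + \pi_L2%qT v = \pi_L2%qT (a *: u + v).
Proof. by rewrite -[_ *: _]/(L2_scale _ _) L2_scale_pi L2_piD. Qed.

Definition norm2 (u : point R N -> 'cV[R[i]]_M) : R :=
  Num.sqrt (\int[mu]_k \sum_(i < M) Normc.normc (u k i ord0) ^+ 2).

Lemma normc_sqr (z : R[i]) :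
  Normc.normc z ^+ 2 = complex.Re z ^+ 2 + complex.Im z ^+ 2.
Proof. by case: z => a b /=; rewrite sqr_sqrtr// addr_ge0 ?sqr_ge0. Qed.

Lemma integrable_sqnorm (u : sqfun) :
  mu.-integrable setT (fun k => (\sum_(i < M) Normc.normc (u k i ord0) ^+ 2)%:E).
Proof.
under eq_fun do rewrite -sumEFin.
apply: integrable_sum => //= i _.
under eq_fun do rewrite normc_sqr EFinD.
have /forallP/(_ i)/andP[ur ui] := valP u.
by apply: integrableD => //; exact: Lfun2_integrable_sqr.
Qed.

Lemma norm2_ge0 u : 0 <= norm2 u. Proof. exact: sqrtr_ge0. Qed.

Lemma sqr_norm2 u : norm2 u ^+ 2 = \int[mu]_k \sum_(i < M) Normc.normc (u k i ord0) ^+ 2.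
Proof.
rewrite sqr_sqrtr//; apply: Rintegral_ge0 => k _.
by apply: sumr_ge0 => i _; exact: sqr_ge0.
Qed.

Lemma norm2_ae (u v : sqfun) : {ae mu, forall k, u k = v k} -> norm2 u = norm2 v.
Proof.
move=> uv; congr Num.sqrt; congr fine; apply: ae_eq_integral => //.
- by have /integrableP[] := integrable_sqnorm u.
- by have /integrableP[] := integrable_sqnorm v.
- by apply: filterS uv => k -> _.
Qed.

Lemma norm2D (u v : sqfun) :
  norm2 ((u + v)%R : sqfun) <= 2 * norm2 u + 2 * norm2 v.
Proof.
have I2 (w : sqfun) : mu.-integrable setT
    (EFin \o (fun k => 2 * \sum_(i < M) Normc.normc (w k i ord0) ^+ 2)).
  have := integrableZl measurableT 2 (integrable_sqnorm w).
  by apply: eq_integrable => // k _; rewrite /= EFinM.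
have uv2 : norm2 ((u + v)%R : sqfun) ^+ 2 <= 2 * norm2 u ^+ 2 + 2 * norm2 v ^+ 2.
  rewrite !sqr_norm2 -!RintegralZl//; try exact: integrable_sqnorm.
  rewrite -RintegralD//.
  apply: le_Rintegral => //; first exact: integrable_sqnorm.
  rewrite (_ : _ \o _ = (EFin \o (fun k => 2 * \sum_(i < M) Normc.normc (u k i ord0) ^+ 2)%R)
    \+ (EFin \o (fun k => 2 * \sum_(i < M) Normc.normc (v k i ord0) ^+ 2)%R))%E//.
  exact: integrableD.
  move=> k _; rewrite !mulr_sumr -big_split; apply: ler_sum => i _ /=.
  rewrite mxE !normc_sqr; case: (u k i ord0) (v k i ord0) => [a b] [c d] /=.
  rewrite -subr_ge0 (_ : _ - _ = (a - c) ^+ 2 + (b - d) ^+ 2); last by ring.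
  by rewrite addr_ge0 ?sqr_ge0.
have nu := norm2_ge0 u; have nv := norm2_ge0 v.
rewrite -ler_sqr ?nnegrE ?norm2_ge0 ?addr_ge0 ?mulr_ge0//; apply: le_trans uv2 _.
nra.
Qed.

Lemma norm2Z a (u : sqfun) : norm2 ((a *: u)%R : sqfun) = Normc.normc a * norm2 u.
Proof.
have a0 : 0 <= Normc.normc a by case: a => a b; exact: sqrtr_ge0.
apply/eqP; rewrite -(@eqrXn2 _ 2) ?mulr_ge0 ?norm2_ge0//; apply/eqP.
rewrite exprMn !sqr_norm2 -RintegralZl//; last exact: integrable_sqnorm.
apply: eq_Rintegral => k _; rewrite mulr_sumr; apply: eq_bigr => i _.
by rewrite mxE Normc.normcM exprMn.
Qed.

Lemma L2_norm2_linear a (x y : L2) :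
  norm2 (a *: x + y : L2) <= 2 * Normc.normc a * norm2 x + 2 * norm2 y.
Proof.
rewrite -[x in leLHS]reprK -[y in leLHS]reprK L2_linear_pi (norm2_ae (L2_pi_ae _)).
by apply: le_trans (norm2D _ _) _; rewrite norm2Z mulrA.
Qed.

Definition bounded_operator : {pred L2 -> L2} := fun F =>
  `[< linear F /\ exists K : R, forall x, norm2 (F x) <= K * norm2 x >].


Lemma norm2_0 : norm2 (0 : L2) = 0.
Proof.
have : \pi_L2%qT 0 + \pi_L2%qT 0 = \pi_L2%qT 0 + 0 :> L2.
  by rewrite L2_piD !addr0.
move=> /addrI <-.
by rewrite (norm2_ae (L2_pi_ae _)) -(scale0r (0 : sqfun)) norm2Z Normc.normc0 mul0r.
Qed.

Lemma bounded_operator_submod_closed : submod_closed bounded_operator.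
Proof.
split.
  apply/asboolP; split=> [a x y|]; first by rewrite scaler0 addr0.
  by exists 0 => x; rewrite mul0r norm2_0.
move=> a F G /asboolP[Fl [K FK]] /asboolP[Gl [L GL]].
have E x : (a *: F + G) x = a *: F x + G x by [].
apply/asboolP; split.
  move=> b x y; rewrite !E Fl Gl !scalerDr !scalerA [b * a]mulrC.
  by rewrite addrACA.
exists (2 * Normc.normc a * K + 2 * L) => x; rewrite E.
apply: le_trans (L2_norm2_linear _ _ _) _; rewrite [leRHS]mulrDl -!mulrA.
have a0 : 0 <= Normc.normc a by case: (a) => ? ?; exact: sqrtr_ge0.
by rewrite lerD// !ler_wpM2l.
Qed.

HB.instance Definition _ := GRing.isSubmodClosed.Build _ _ bounded_operator
  bounded_operator_submod_closed.

(* The algebra of bounded linear operators; the product is composition. *)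
Record boundedOp := BoundedOp {
  boundedOp_val :> L2 -> L2; _ : boundedOp_val \in bounded_operator }.
HB.instance Definition _ := [isSub for boundedOp_val].
HB.instance Definition _ := [Choice of boundedOp by <:].
HB.instance Definition _ := [SubChoice_isSubLmodule of boundedOp by <:].
Implicit Types F G H : boundedOp.

Lemma boundedOpP F : linear F /\ exists K : R, forall x, norm2 (F x) <= K * norm2 x.
Proof. exact/asboolP/(valP F). Qed.

Lemma boundedOp_eqP F G : F =1 G -> F = G.
Proof. by move=> FG; apply/val_inj/funext. Qed.

Lemma id_bounded : (id : L2 -> L2) \in bounded_operator.
Proof. by apply/asboolP; split=> //; exists 1 => x; rewrite mul1r. Qed.

Lemma comp_bounded F G : F \o G \in bounded_operator.
Proof.
have [Fl [K FK]] := boundedOpP F; have [Gl [L GL]] := boundedOpP G.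
apply/asboolP; split=> [a x y /=|]; first by rewrite Gl Fl.
exists (`|K| * L) => x; rewrite -mulrA /=; apply: le_trans (FK _) _.
apply: le_trans (ler_wpM2r (norm2_ge0 _) (ler_norm K)) _.
exact: ler_wpM2l.
Qed.

Definition op_one : boundedOp := BoundedOp id_bounded.
Definition op_comp F G : boundedOp := BoundedOp (comp_bounded F G).

Lemma op_compA : associative op_comp.
Proof. by move=> F G H; exact: boundedOp_eqP. Qed.
Lemma op_comp1l : left_id op_one op_comp.
Proof. by move=> F; exact: boundedOp_eqP. Qed.
Lemma op_comp1r : right_id op_one op_comp.
Proof. by move=> F; exact: boundedOp_eqP. Qed.
Lemma op_compDl : left_distributive op_comp +%R.
Proof. by move=> F G H; exact: boundedOp_eqP. Qed.
Lemma op_compDr : right_distributive op_comp +%R.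
Proof.
move=> F G H; apply: boundedOp_eqP => x.
have [Fl _] := boundedOpP F.
by have := Fl 1 (G x) (H x); rewrite !scale1r.
Qed.

HB.instance Definition _ := GRing.Zmodule_isPzRing.Build boundedOp
  op_compA op_comp1l op_comp1r op_compDl op_compDr.

End SquareIntegrable.

Section Operators.
Variables (R : realType) (N M : nat).
Local Notation mu := (cube_measure R N).
Local Notation op := (boundedOp R N M).
Local Notation vfun := (point R N -> 'cV[R[i]]_M).
Implicit Types (S : set op) (F G : op).

(* F is the operator u |-> T u; a.e. equality determines F. *)
Definition acts_as F (T : vfun -> vfun) :=
  forall x : L2 R N M, {ae mu, forall k, F x k = T x k}.

Definition mul_op (A : point R N -> 'M[R[i]]_M) (u : vfun) : vfun :=
  fun k => A k *m u k.

Definition mul_avg_op j m (A : point R N -> 'M[R[i]]_(M, m))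
    (B : point R N -> 'M[R[i]]_(m, M)) (u : vfun) : vfun :=
  fun k => A k *m average j (fun k' => B k' *m u k') k.

Definition subalgebra S :=
  [/\ S 0, forall (a : R[i]) F G, S F -> S G -> S (a *: F + G)
    & forall F G, S F -> S G -> S (F * G)].

Definition generators : set op :=
  [set F | exists2 A, continuous_on_cube A & acts_as F (mul_op A)] `|`
  [set F | exists2 j, (1 <= j <= N)%N & acts_as F (@average R N j M)].

Definition calH : set op := smallest subalgebra generators.

Definition calHj (j : nat) : set op :=
  if j is 0%N then
    [set F | exists2 A, continuous_on_cube A & acts_as F (mul_op A)]
  else
    [set F | exists m (A : point R N -> 'M[R[i]]_(M, m))
                      (B : point R N -> 'M[R[i]]_(m, M)),
       [/\ (0 < m)%N, continuous_on_cube A, continuous_on_cube B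
         & acts_as F (mul_avg_op j A B)]].

Definition invertibles S : set op :=
  [set F | S F /\ exists G, F * G = 1 /\ G * F = 1].

Definition calF (j : nat) : set op :=
  if j is 0%N then invertibles (calHj 0)
  else invertibles [set 1 + F | F in calHj j].

Definition sum_repr n (S : 'I_n -> set op) F (A : 'I_n -> op) :=
  (forall i, S i (A i)) /\ F = \sum_(i < n) A i.

Definition prod_repr n (S : 'I_n -> set op) F (B : 'I_n -> op) :=
  (forall i, S i (B i)) /\ F = \prod_(i < n) B i.

Definition sum_sets n (S : 'I_n -> set op) : set op :=
  [set F | exists A, sum_repr S F A].

Definition prod_sets n (S : 'I_n -> set op) : set op :=
  [set F | exists B, prod_repr S F B].

End Operators.

Arguments calH R N M : clear implicits.
Arguments calHj R N M j : clear implicits.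
Arguments calF R N M j : clear implicits.

(* Main.v *)
(** Write H_j for the operators A<B.>_j; for j = 0 the average is the identity,
   so that H_0 fits the same pattern.  Fubini gives H_i H_j in H_max(i,j), hence
   H is the sum of the H_j.

   Let P be the multiplication by the indicator of a slab of width 1/n in the
   variable k_(j+1).  P commutes with H_0, ..., H_j, while the norm of T P is
   O(n^(-1/2)) for T in H_i, i > j.  Summing over the slabs of a partition, the
   partial sum S of S + T inherits from S + T both its vanishing and its
   boundedness from below.  The first gives the uniqueness of the sums, and the
   second shows that all partial sums of an invertible element of H are bounded
   below.

   If 1 + A<B.>_j is bounded below, then D = 1 + <BA>_j is invertible at every
   point: otherwise D v = 0 at some point, and the functions A v, localized in
   (k_(j+1), ..., k_N) near that point, are almost annihilated.  Then
   1 - A D^-1 <B.>_j is an inverse.  The factorizations follow by induction on j: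
   if L R is the factorization of S, then S + T = L (1 + L^-1 T R^-1) R, so the
   new factor can be inserted at any place. *)
From mathcomp Require Import all_boot all_order all_algebra perm complex.
From mathcomp Require Import all_classical all_reals all_analysis.
From mathcomp Require Import ring lra measurable_realfun.
(* Last, because its notation [point] collides with the one of pointed types. *)
Require Import Defs.
Set Implicit Arguments.
Unset Strict Implicit.
Unset Printing Implicit Defensive.
Import Order.TTheory GRing.Theory Num.Theory.
Import numFieldNormedType.Exports.
Local Open Scope classical_set_scope.
Local Open Scope ring_scope.

(** * Lebesgue measure on the cube *)

(** The number of slabs does no harm: their indicators act as orthogonal projections that commute
    with S, so the squared norms of x and of S x are both sums over the slabs, and an inequality on
    every slab passes to x. The smallness of T P is Cauchy-Schwarz, since the indicator of a slab
    has average at most its width.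

    Only a lower bound passes to the partial sums in this way, not an inverse. Invertibility is
    therefore used as boundedness from below, and the inverse is rebuilt from D; this also shows
    that inverses stay in H.

    Two mismatches shape the preparations. Coefficients are arbitrary outside the cube, so they are
    extended by zero, which makes them bounded and measurable and does not change the operator.
    Elements of L2 are known only almost everywhere, while D must be invertible at every point; the
    bridge is that averages of continuous functions are continuous, and that a continuous function
    which is nonnegative almost everywhere is so on the whole cube.

    The constants 4 and c / 4 of the slab arguments come from the inequality |x + y| <= 2 |x| + 2
    |y| for [norm2]. *)

Section CubeMeasure.
Variable R : realType.
Local Notation leb := (@lebesgue01 R).
Local Notation mu := (cube_measure R).

Lemma cube_integralS n (f : point R n.+1 -> \bar R) :
  measurable_fun setT f -> (forall k, 0 <= f k)%E ->
  (\int[mu n.+1]_k f k = \int[leb]_a \int[mu n]_k f (cons_pair (a, k)))%E.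
Proof.
move=> mf f0; rewrite ge0_integral_distribution//.
rewrite (fubini_tonelli1 (f \o @cons_pair R n))//.
  by apply: (measurableT_comp mf); exact: measurable_cons_pair.
by move=> ?; exact: f0.
Qed.

Lemma measurable_box n (E : 'I_n -> set (measurableTypeR R)) :
  (forall i, measurable (E i)) -> measurable [set k : point R n | forall i, E i (tnth k i)].
Proof.
move=> mE; rewrite (_ : mkset _ = \bigcap_(i in [set: 'I_n]) ((@tnth n _)^~ i @^-1` E i)).
  apply: fin_bigcap_measurable => // i _; rewrite -[X in measurable X]setTI.
  exact: measurable_tnth.
by apply/seteqP; split => k /= kE i => [_|]; exact: kE.
Qed.

Lemma cube_box n (E : 'I_n -> set (measurableTypeR R)) :
  (forall i, measurable (E i)) ->
  mu n [set k | forall i, E i (tnth k i)] = (\prod_(i < n) leb (E i))%E.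
Proof.
elim: n E => [|n IH] E mE.
  by rewrite big_ord0 /= diracE mem_set// => -[].
rewrite big_ord_recl -IH; last by move=> i; exact: mE.
rewrite [LHS]/= /pushforward.
rewrite (_ : _ @^-1` _ = E ord0 `*` [set k | forall i, E (lift ord0 i) (tnth k i)]).
  have mB := @measurable_box n (fun i => E (lift ord0 i)) (fun i => mE _).
  by rewrite product_measure1E.
apply/seteqP; split=> [[a k] /= akE|[a k] [/= aE kE] i].
  by split; [exact: (akE ord0)|move=> i; have := akE (lift ord0 i); rewrite tnthS].
by case: (unliftP ord0 i) => [j ->|->//]; rewrite tnthS.
Qed.

Lemma measurable_cube n : measurable (@cube R n).
Proof.
rewrite (_ : @cube R n = [set k | forall i, `[0, 1]%classic (tnth k i : R)]).
  by apply: (@measurable_box n (fun=> `[0, 1]%classic)) => i; exact: measurable_itv.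
by apply/seteqP; split=> k kE i; have := kE i; rewrite /= in_itv.
Qed.

Lemma cube_measure_cube n : mu n (@cube R n) = 1%E.
Proof.
rewrite (_ : @cube R n = [set k | forall i, `[0, 1]%classic (tnth k i : R)]).
  rewrite (@cube_box n (fun=> `[0, 1]%classic)) => [|i]; last exact: measurable_itv.
  rewrite big1// => i _; rewrite -[RHS](@lebesgue01_setT R).
  by rewrite /lebesgue01 /mrestr setIid setTI.
by apply/seteqP; split=> k kE i; have := kE i; rewrite /= in_itv.
Qed.

Lemma ae_cube n : {ae mu n, forall k, cube k}.
Proof.
exists (~` @cube R n); split => //; first exact: measurableC (@measurable_cube n).
have := probability_setC (mu n) (@measurable_cube n).
rewrite cube_measure_cube => ->.
by rewrite subee.
Qed.

Lemma integral_cube n (f : point R n -> \bar R) : measurable_fun setT f ->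
  (\int[mu n]_(x in @cube R n) f x = \int[mu n]_x f x)%E.
Proof.
move=> mf; rewrite integral_mkcond; apply: ae_eq_integral => //.
  apply/(measurable_restrictT f (@measurable_cube n)).
  exact: measurable_funTS.
apply: filterS (@ae_cube n) => k kc _.
by rewrite patchE mem_set.
Qed.

Lemma cube_measure_setT n : mu n setT = 1%E.
Proof. exact: probability_setT. Qed.

Lemma integral_cst_cube n (c : \bar R) : (\int[mu n]__ c = c)%E.
Proof.
rewrite integral_cst//; by rewrite [X in (_ * X)%E](cube_measure_setT n) mule1.
Qed.

Section Replace.
Variable N : nat.
Implicit Types (k : point R N).

Lemma tnth_replace j (x : point R j) k (i : 'I_N) :
  tnth (replace_first x k) i = nth (tnth k i) x i.
Proof. by rewrite tnth_mktuple. Qed.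

Lemma tnth_replace_lt j (x : point R j) k (i : 'I_N) (ij : (i < j)%N) :
  tnth (replace_first x k) i = tnth x (Ordinal ij).
Proof. by rewrite tnth_replace [RHS](tnth_nth (tnth k i)). Qed.

Lemma tnth_replace_ge j (x : point R j) k (i : 'I_N) : (j <= i)%N ->
  tnth (replace_first x k) i = tnth k i.
Proof. by move=> ji; rewrite tnth_replace nth_default// size_tuple. Qed.

Lemma replace_first0 (x : point R 0) k : replace_first x k = k.
Proof. by apply: eq_from_tnth => i; rewrite tnth_replace_ge. Qed.

Lemma measurable_replace d (T : measurableType d) j (x : T -> point R j) (k : T -> point R N) :
  measurable_fun setT x -> measurable_fun setT k ->
  measurable_fun setT (fun t => replace_first (x t) (k t)).
Proof.
move=> mx mk; apply/measurable_fun_tnthP => i; have [ij|ji] := ltnP i j.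
  rewrite (_ : _ \o _ = (fun z => tnth z (Ordinal ij)) \o x).
    by apply: measurableT_comp mx; exact: measurable_tnth.
  by apply/funext => t /=; exact: tnth_replace_lt.
rewrite (_ : _ \o _ = (fun z => tnth z i) \o k).
  by apply: measurableT_comp mk; exact: measurable_tnth.
by apply/funext => t /=; exact: tnth_replace_ge.
Qed.

Lemma cube_replace j (x : point R j) k : cube x -> cube k -> cube (replace_first x k).
Proof.
move=> xc kc i; have [ij|ji] := ltnP i j.
  by rewrite tnth_replace_lt; exact: xc.
by rewrite tnth_replace_ge//; exact: kc.
Qed.
End Replace.

Lemma replace_first_comp N i j (x : point R j) (y : point R i) (k : point R N) :
  (j <= i)%N ->
  replace_first x (replace_first y k) = replace_first (replace_first x y) k.
Proof.
move=> ji; apply: eq_from_tnth => l; have [lj|jl] := ltnP l j.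
  have li := leq_trans lj ji.
  by rewrite (tnth_replace_lt _ _ lj) (tnth_replace_lt _ _ li) tnth_replace_lt.
rewrite tnth_replace_ge//; have [li|il] := ltnP l i.
  by rewrite !(tnth_replace_lt _ _ li) tnth_replace_ge.
by rewrite !tnth_replace_ge.
Qed.

Lemma replace_first_absorb N i j (x : point R j) (y : point R i) (k : point R N) :
  (j <= i)%N ->
  replace_first y (replace_first x k) = replace_first y k.
Proof.
move=> ji; apply: eq_from_tnth => l; have [li|il] := ltnP l i.
  by rewrite !(tnth_replace_lt _ _ li).
by rewrite !tnth_replace_ge// (leq_trans ji).
Qed.

Lemma replace_first_cons n j (a b : R) (x : point R j) (k : point R n) :
  replace_first (cons_pair (a, x)) (cons_pair (b, k)) =
  cons_pair (a, replace_first x k).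
Proof.
apply: eq_from_tnth => i; rewrite tnth_mktuple.
case: (unliftP ord0 i) => [l ->|-> //].
by rewrite !tnthS tnth_mktuple.
Qed.

(* The map (x, k) |-> (x_1, ..., x_j, k_(j+1), ..., k_n) is measure preserving. *)
Lemma integral_replace n j (f : point R n -> \bar R) : (j <= n)%N ->
  measurable_fun setT f -> (forall k, 0 <= f k)%E ->
  (\int[mu n]_k \int[mu j]_x f (replace_first x k) = \int[mu n]_k f k)%E.
Proof.
have [->|] := posnP j.
  move=> _ mf f0; apply: eq_integral => k _.
  under eq_integral => x _ do rewrite replace_first0.
  by rewrite integral_cst_cube.
elim: n j f => [|n IH] [|j] f //= _ jn mf f0.
have mfr : measurable_fun setT (fun p : point R j.+1 * point R n.+1 => f (replace_first p.1 p.2)).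
  by apply: (measurableT_comp mf); exact: measurable_replace.
rewrite cube_integralS; first last.
- by move=> k; exact: integral_ge0.
- exact: (@measurable_fun_fubini_tonelli_G _ _ _ _ _ (mu j.+1)
    (fun p => f (replace_first p.1 p.2))).
pose g (q : (measurableTypeR R * point R j) * point R n) :=
  f (cons_pair (q.1.1, replace_first q.1.2 q.2)).
have mg : measurable_fun setT g.
  apply: measurableT_comp => //; apply: measurableT_comp => //.
  apply: measurable_fun_pair => /=; first by do 2 apply: measurableT_comp => //.
  by apply: measurable_replace => //; apply: measurableT_comp.
(* The first coordinates b of k and a of x are split off. The replacement overwrites b by a, so that
   the integrand no longer depends on b. *)
transitivity (\int[leb]_b \int[mu n]_k \int[leb]_a \int[mu j]_x
    f (cons_pair (a, replace_first x k)))%E.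
  apply: eq_integral => b _; apply: eq_integral => k _.
  rewrite cube_integralS//; last first.
    by apply: (measurableT_comp mf); exact: measurable_replace.
  apply: eq_integral => a _; apply: eq_integral => x _.
  by rewrite replace_first_cons.
transitivity (\int[leb]_b \int[leb]_a \int[mu n]_k \int[mu j]_x
    f (cons_pair (a, replace_first x k)))%E.
  apply: eq_integral => b _.
  rewrite (fubini_tonelli 
    (fun p : point R n * measurableTypeR R =>
      \int[mu j]_x f (cons_pair (p.2, replace_first x p.1))))%E//.
    apply: (@measurable_fun_fubini_tonelli_G _ _ _ _ _ (mu j)
      (fun p => g ((p.2.2, p.1), p.2.1))) => //.
    by apply: measurableT_comp => //; repeat apply: measurable_fun_pair => //=; do ?apply: measurableT_comp.
    by move=> p; exact: f0.
  by move=> p; apply: integral_ge0 => x _; exact: f0.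
(* The integral over b is that of a constant against a measure of mass 1. For fixed a the induction
   hypothesis applies. *)
rewrite integral_cst//= lebesgue01_setT mule1.
rewrite [RHS]cube_integralS//; apply: eq_integral => a _.
have mfa : measurable_fun setT (fun k => f (cons_pair (a, k))).
  apply: (measurableT_comp mf); apply: (measurableT_comp (@measurable_cons_pair R n)).
  exact: measurable_pair1.
have [->|j0] := posnP j; last exact: IH.
apply: eq_integral => k _.
under eq_integral => x _ do rewrite replace_first0.
by rewrite integral_cst_cube.
Qed.
End CubeMeasure.

(** * Averages of real functions *)

Section RealIntegrable.
Context d (T : measurableType d) (R : realType) (m : {measure set T -> \bar R}).
Implicit Types f g : T -> R.

Lemma integrable_addr f g : m.-integrable setT (EFin \o f) ->
  m.-integrable setT (EFin \o g) -> m.-integrable setT (EFin \o (fun x => f x + g x)).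
Proof. by move=> fi gi; exact: (integrableD measurableT fi gi). Qed.

Lemma integrable_subr f g : m.-integrable setT (EFin \o f) ->
  m.-integrable setT (EFin \o g) -> m.-integrable setT (EFin \o (fun x => f x - g x)).
Proof. by move=> fi gi; exact: (integrableB measurableT fi gi). Qed.

Lemma integrable_mulr c f : m.-integrable setT (EFin \o f) ->
  m.-integrable setT (EFin \o (fun x => c * f x)).
Proof. by move=> fi; exact: (integrableZl measurableT c fi). Qed.

Lemma integrable_sumr (I : Type) (s : seq I) (P : pred I) (F : I -> T -> R) :
  (forall i, P i -> m.-integrable setT (EFin \o F i)) ->
  m.-integrable setT (EFin \o (fun x => \sum_(i <- s | P i) F i x)).
Proof.
move=> Fi; rewrite (_ : EFin \o _ = fun x => (\sum_(i <- s | P i) (F i x)%:E)%E).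
  by apply: integrable_sum.
by apply/funext => x /=; rewrite sumEFin.
Qed.

Lemma Rintegral_sumr (I : Type) (s : seq I) (P : pred I) (F : I -> T -> R) :
  (forall i, P i -> m.-integrable setT (EFin \o F i)) ->
  \int[m]_x (\sum_(i <- s | P i) F i x) = \sum_(i <- s | P i) \int[m]_x F i x.
Proof.
move=> Fi; elim: s => [|i s IH].
  by rewrite big_nil; under eq_Rintegral do rewrite big_nil; rewrite Rintegral_cst// mul0r.
rewrite big_cons; under eq_Rintegral do rewrite big_cons.
case: ifP => // Pi; rewrite RintegralD// ?IH//; first exact: Fi.
exact: integrable_sumr.
Qed.

Lemma Lfun2P f : measurable_fun setT f ->
  m.-integrable setT (EFin \o (fun x => f x ^+ 2)) -> f \in Lfun m 2%:E.
Proof.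
move=> mf fi; rewrite inE; apply/andP; split; rewrite inE//=.
rewrite /finite_norm unlock /Lnorm; apply: poweR_lty.
have /integrableP[_] := fi; apply: le_lt_trans.
by under eq_integral => x _ do rewrite poweR_EFin powR_mulrn// -normrX.
Qed.

(** Cauchy-Schwarz: the integral of (g - t f)^2 is a polynomial in t without negative values. *)
Lemma Rintegral_sqr_le f g : f \in Lfun m 2%:E -> g \in Lfun m 2%:E ->
  (\int[m]_x (f x * g x)) ^+ 2 <= (\int[m]_x (f x ^+ 2)) * (\int[m]_x (g x ^+ 2)).
Proof.
move=> f2 g2; set B := \int[m]_x (f x * g x); set H := \int[m]_x (f x ^+ 2).
set G := \int[m]_x (g x ^+ 2).
have fi := Lfun2_integrable_sqr f2; have gi := Lfun2_integrable_sqr g2.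
have /Lfun1_integrable fgi := Lfun2_mul_Lfun1 f2 g2.
have q t : 0 <= G - 2 * t * B + t ^+ 2 * H.
  rewrite -RintegralZl// -RintegralZl// -RintegralB//; last exact: integrable_mulr.
  rewrite -RintegralD//; [|by apply: integrable_subr => //; exact: integrable_mulr
    |exact: integrable_mulr].
  apply: Rintegral_ge0 => x _.
  by rewrite (_ : _ + _ = (g x - t * f x) ^+ 2) ?sqr_ge0//; ring.
have H0 : 0 <= H by apply: Rintegral_ge0 => x _; exact: sqr_ge0.
have G0 : 0 <= G by apply: Rintegral_ge0 => x _; exact: sqr_ge0.
have [H1|] := ltP 0 H.
  (* The minimum of the polynomial is at t = B / H. *)
  have := q (B / H); rewrite (_ : _ + _ = G - B ^+ 2 / H); last by field; rewrite gt_eqF.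
  by rewrite subr_ge0 ler_pdivrMr// mulrC.
move=> H1; have {H1} H1 : H = 0 by apply/eqP; rewrite eq_le H1.
have [->|B0] := eqVneq B 0; first by rewrite expr0n /= mulr_ge0.
(* For H = 0 the polynomial is affine, and this t would give it the value -1. *)
have := q ((G + 1) / (2 * B)); rewrite H1 mulr0 addr0.
by rewrite (_ : _ - _ = -1) ?oppr_ge0 ?ler10//; field.
Qed.
End RealIntegrable.

Section RealAverage.
Variables (R : realType) (N : nat).
Local Notation mu := (cube_measure R).
Implicit Types (f g h : point R N -> R).

(** The real and imaginary parts of the entries of [average] have exactly this form; for measurable
    f, [ravgE] removes the restriction to the cube. *)
Definition ravg j f (k : point R N) : R :=
  \int[mu j]_(x in @cube R j) f (replace_first x k).

Lemma measurable_section j f (k : point R N) : measurable_fun setT f ->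
  measurable_fun setT (fun x : point R j => f (replace_first x k)).
Proof.
move=> mf; apply: (measurableT_comp mf).
exact: measurable_replace.
Qed.

Lemma measurable_replace_swap j f : measurable_fun setT f ->
  measurable_fun setT (fun p : point R N * point R j => f (replace_first p.2 p.1)).
Proof.
move=> mf; apply: (measurableT_comp mf).
exact: measurable_replace.
Qed.
Arguments measurable_replace_swap j {f}.

Lemma ravgE j f k : measurable_fun setT f ->
  ravg j f k = \int[mu j]_x f (replace_first x k).
Proof.
move=> mf; rewrite /ravg /Rintegral integral_cube//.
by apply/measurable_EFinP; exact: measurable_section.
Qed.

Lemma integrable_replace j f : (j <= N)%N ->
  (mu N).-integrable setT (EFin \o f) ->
  (mu N \x mu j)%E.-integrable setT
    (fun p : point R N * point R j => (f (replace_first p.2 p.1))%:E).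
Proof.
move=> jN /integrableP[mf fi].
have mf' : measurable_fun setT f by exact/measurable_EFinP.
have mfr := measurable_replace_swap j mf'.
apply/integrableP; split; first exact/measurable_EFinP.
rewrite (fubini_tonelli1 (fun p => `|(f (replace_first p.2 p.1))%:E|%E))//; last first.
  by apply: measurableT_comp => //; exact/measurable_EFinP.
apply: le_lt_trans fi; rewrite -[X in (_ <= X)%E](integral_replace jN)//.
exact: measurableT_comp.
Qed.

Lemma ae_integrable_section j f : (j <= N)%N ->
  (mu N).-integrable setT (EFin \o f) ->
  {ae mu N, forall k, (mu j).-integrable setT (fun x => (f (replace_first x k))%:E)}.
Proof.
move=> jN fi; apply: filterS (ae_integrable1 (integrable_replace jN fi)) => k /=.
exact.
Qed.

Lemma integral_replace_integrable j f : (j <= N)%N ->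
  (mu N).-integrable setT (EFin \o f) ->
  (\int[mu N]_k \int[mu j]_x (f (replace_first x k))%:E = \int[mu N]_k (f k)%:E)%E.
Proof.
move=> jN fi; have /integrableP[mf _] := fi.
have mf' : measurable_fun setT f by exact/measurable_EFinP.
have fri := integrable_replace jN fi.
(* The nonnegative case on the product space, to be applied to the positive and the negative part of
   f. *)
have pos (g : point R N -> \bar R) : measurable_fun setT g -> (forall k, 0 <= g k)%E ->
    (\int[mu N \x mu j]_p g (replace_first p.2 p.1) = \int[mu N]_k g k)%E.
  move=> mg g0; rewrite -(integral_replace jN)// fubini_tonelli1//.
  by apply: (measurableT_comp mg); exact: measurable_replace.
rewrite (integral12_prod_meas1 fri) [LHS]integralE [RHS]integralE.
have mfr : measurable_fun setT
    (fun p : point R N * point R j => (f (replace_first p.2 p.1))%:E).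
  by apply/measurable_EFinP; exact: measurable_replace_swap.
congr (_ - _)%E.
  rewrite -[RHS]pos; [|exact: measurable_funepos|by move=> k; exact: funepos_ge0].
  by apply: eq_integral => p _; rewrite !funeposE.
rewrite -[RHS]pos; [|exact: measurable_funeneg|by move=> k; exact: funeneg_ge0].
by apply: eq_integral => p _; rewrite !funenegE.
Qed.

Lemma integrable_ravg j f : (j <= N)%N ->
  (mu N).-integrable setT (EFin \o f) -> (mu N).-integrable setT (EFin \o ravg j f).
Proof.
move=> jN fi; have /integrableP[mf _] := fi.
have mf' : measurable_fun setT f by exact/measurable_EFinP.
have Fi := integrable_fubini_F (integrable_replace jN fi).
have /integrableP[mF _] := Fi.
have -> : EFin \o ravg j f = (fun k => (fine (fubini_F (mu j)
   (fun p : point R N * point R j => (f (replace_first p.2 p.1))%:E) k))%:E).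
  by apply/funext => k /=; rewrite ravgE.
apply: le_integrable Fi => //.
  by apply/measurable_EFinP; apply: measurableT_comp.
(* Where the inner integral is infinite, [fine] returns 0, so the modulus can only drop. *)
by move=> k _; case: (fubini_F _ _ k) => [r| |] //=; rewrite normr0 leey.
Qed.

Lemma Rintegral_ravg j f : (j <= N)%N ->
  (mu N).-integrable setT (EFin \o f) ->
  \int[mu N]_k ravg j f k = \int[mu N]_k f k.
Proof.
move=> jN fi; have /integrableP[mf _] := fi.
have mf' : measurable_fun setT f by exact/measurable_EFinP.
rewrite /Rintegral -(integral_replace_integrable jN fi); congr fine.
apply: ae_eq_integral => //.
- by have /integrableP[] := integrable_ravg jN fi.
- by have /integrableP[] := integrable_fubini_F (integrable_replace jN fi).
apply: filterS (ae_integrable_section jN fi) => k ki _.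
by rewrite ravgE// fineK//; exact: integrable_fin_num.
Qed.

Lemma Rintegral_eq0_ae f : (mu N).-integrable setT (EFin \o f) ->
  (forall k, 0 <= f k) -> \int[mu N]_k f k = 0 -> {ae mu N, forall k, f k = 0}.
Proof.
move=> fi f0 If; have /integrableP[mf _] := fi.
have /(ae_eq_integral_abs _ measurableT mf) : (\int[mu N]_k `|(f k)%:E| = 0)%E.
  under eq_integral => k _ do rewrite gee0_abs ?lee_fin//.
  by rewrite -[LHS]fineK ?integrable_fin_num//; congr EFin.
by apply: filterS => k /(_ I)/= [].
Qed.

(** Individual sections of a null set need not be null. However, the average of |f - g| has integral
    0 by [Rintegral_ravg], so it vanishes almost everywhere. *)
Lemma ravg_ae j f g : (j <= N)%N ->
  (mu N).-integrable setT (EFin \o f) -> (mu N).-integrable setT (EFin \o g) ->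
  {ae mu N, forall k, f k = g k} -> {ae mu N, forall k, ravg j f k = ravg j g k}.
Proof.
move=> jN fi gi fg.
have /integrableP[/measurable_EFinP mf _] := fi.
have /integrableP[/measurable_EFinP mg _] := gi.
pose d k : R := `|f k - g k|.
have di : (mu N).-integrable setT (EFin \o d).
  by apply: (integrable_norm (f := fun k => f k - g k)); exact: integrable_subr.
have md : measurable_fun setT d by have /integrableP[/measurable_EFinP] := di.
have Id : \int[mu N]_k ravg j d k = 0.
  rewrite Rintegral_ravg//; rewrite /Rintegral.
  rewrite (ae_eq_integral (fun=> 0%E))//; first by rewrite integral0.
    exact/measurable_EFinP.
  by apply: filterS fg => k fgk _; rewrite /d fgk subrr normr0.
have d0 := Rintegral_eq0_ae (integrable_ravg jN di) _ Id.
have {}d0 : {ae mu N, forall k, ravg j d k = 0}.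
  by apply: d0 => k; apply: Rintegral_ge0 => x _; exact: normr_ge0.
apply: filterS3 d0 (ae_integrable_section jN fi) (ae_integrable_section jN gi) => k dk fk gk.
apply/eqP; rewrite -subr_eq0 -normr_le0 -dk !ravgE//.
rewrite -RintegralB//; apply: le_normr_Rintegral => //.
exact: integrable_subr.
Qed.

Lemma ravg_invariant i j f (x : point R j) k : (j <= i)%N ->
  ravg i f (replace_first x k) = ravg i f k.
Proof.
by move=> ji; apply: eq_Rintegral => y _; rewrite replace_first_absorb.
Qed.

Lemma ravg_cst j f k c : (forall x : point R j, cube x -> f (replace_first x k) = c) ->
  ravg j f k = c.
Proof.
move=> fc; rewrite /ravg (@eq_Rintegral _ _ _ _ _ (fun=> c)); last first.
  by move=> x; rewrite inE; exact: fc.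
rewrite Rintegral_cst; last exact: measurable_cube.
by rewrite [X in fine X]cube_measure_cube mulr1.
Qed.

Lemma ravg_scale j f g k c : measurable_fun setT f ->
  (mu j).-integrable setT (fun x => (f (replace_first x k))%:E) ->
  (forall x : point R j, cube x -> g (replace_first x k) = c * f (replace_first x k)) ->
  ravg j g k = c * ravg j f k.
Proof.
move=> mf fi gc; rewrite [in RHS]ravgE// /ravg.
rewrite (@eq_Rintegral _ _ _ _ _ (fun x => c * f (replace_first x k))); last first.
  by move=> x; rewrite inE; exact: gc.
rewrite RintegralZl//; last 2 first.
  exact: measurable_cube.
  by apply: (integrableS measurableT) fi => //; exact: measurable_cube.
by rewrite -ravgE.
Qed.

End RealAverage.

(** * Iterated averages and their bounds in L2 *)

Section Tower.
Variables (R : realType) (N : nat).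
Local Notation mu := (cube_measure R).
Implicit Types f h : point R N -> R.

(** On an integrable section in the first i variables this is [Rintegral_ravg] in dimension i
    instead of N, because replacements compose. *)
Lemma ravg_ravg i j f : (j <= i)%N -> (i <= N)%N ->
  (mu N).-integrable setT (EFin \o f) ->
  {ae mu N, forall k, ravg i (ravg j f) k = ravg i f k}.
Proof.
move=> ji iN fi; have /integrableP[/measurable_EFinP mf _] := fi.
have jN := leq_trans ji iN.
have /integrableP[/measurable_EFinP mfj _] := integrable_ravg jN fi.
apply: filterS (ae_integrable_section iN fi) => k fk.
rewrite !ravgE//; rewrite -(Rintegral_ravg ji fk).
apply: eq_Rintegral => y _; apply: eq_Rintegral => x _.
by rewrite replace_first_comp.
Qed.

Lemma ae_Lfun2_section j f : (j <= N)%N -> f \in Lfun (mu N) 2%:E ->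
  {ae mu N, forall k, (fun x : point R j => f (replace_first x k)) \in Lfun (mu j) 2%:E}.
Proof.
move=> jN f2; have /andP[/[!inE]/= mf _] : f \in Lfun (mu N) 2%:E by [].
apply: filterS (ae_integrable_section jN (Lfun2_integrable_sqr f2)) => k fk.
by apply: Lfun2P => //; exact: measurable_section.
Qed.

Lemma ravg_sqr_le j f h : (j <= N)%N ->
  f \in Lfun (mu N) 2%:E -> h \in Lfun (mu N) 2%:E ->
  {ae mu N, forall k, ravg j (fun k => h k * f k) k ^+ 2 <=
     ravg j (fun k => h k ^+ 2) k * ravg j (fun k => f k ^+ 2) k}.
Proof.
move=> jN f2 h2.
have /andP[/[!inE]/= mf _] : f \in Lfun (mu N) 2%:E by [].
have /andP[/[!inE]/= mh _] : h \in Lfun (mu N) 2%:E by [].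
apply: filterS2 (ae_Lfun2_section jN f2) (ae_Lfun2_section jN h2) => k fk hk.
rewrite !ravgE; [|exact: measurable_funX|exact: measurable_funX|exact: measurable_funM].
exact: Rintegral_sqr_le.
Qed.

Lemma Lfun2_measurable f : f \in Lfun (mu N) 2%:E -> measurable_fun setT f.
Proof. by rewrite inE => /andP[/[!inE]]. Qed.

Lemma Lfun2_integrable f : f \in Lfun (mu N) 2%:E -> (mu N).-integrable setT (EFin \o f).
Proof.
move=> f2; apply/Lfun1_integrable; apply: Lfun_subset12 f2.
exact: fin_num_measure.
Qed.

(** Cauchy-Schwarz against the constant 1 bounds the square of the average by the average of the
    square, and averaging preserves integrals. *)
Lemma Lfun2_ravg j f : (j <= N)%N -> f \in Lfun (mu N) 2%:E ->
  ravg j f \in Lfun (mu N) 2%:E /\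
  \int[mu N]_k ravg j f k ^+ 2 <= \int[mu N]_k f k ^+ 2.
Proof.
move=> jN f2; have f2i := Lfun2_integrable_sqr f2.
have mf := Lfun2_measurable f2.
have /integrableP[/measurable_EFinP mr _] := integrable_ravg jN (Lfun2_integrable f2).
have c1 : (fun=> 1) \in Lfun (mu N) 2%:E by exact: Lfun_cst.
have le : {ae mu N, forall k, ravg j f k ^+ 2 <= ravg j (fun k => f k ^+ 2) k}.
  apply: filterS (ravg_sqr_le jN f2 c1) => k.
  rewrite (_ : (fun k => 1 * f k) = f); last by apply/funext => l; rewrite mul1r.
  by rewrite [X in _ <= X * _](@ravg_cst _ _ _ _ _ 1) ?mul1r// => x _; rewrite expr1n.
have i2 := integrable_ravg jN f2i.
have /integrableP[/measurable_EFinP mr2 _] := i2.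
have ri : (mu N).-integrable setT (EFin \o (fun k => ravg j f k ^+ 2)).
  apply/integrableP; split; first by apply/measurable_EFinP; exact: measurable_funX.
  have /integrableP[_] := i2; apply: le_lt_trans.
  apply: ae_ge0_le_integral => //.
  - by apply: measurableT_comp => //; apply/measurable_EFinP; exact: measurable_funX.
  - by apply: measurableT_comp => //; exact/measurable_EFinP.
  apply: filterS le => k lek _ /=.
  by rewrite lee_fin ger0_norm ?sqr_ge0// (le_trans lek)// ler_norm.
split; first exact: Lfun2P.
rewrite -[leRHS](Rintegral_ravg jN)//.
rewrite /Rintegral fine_le//; try exact: integrable_fin_num.
apply: ae_ge0_le_integral => //.
- by move=> k _; rewrite lee_fin sqr_ge0.
- by apply/measurable_EFinP; exact: measurable_funX.
- by move=> k _; rewrite lee_fin; apply: Rintegral_ge0 => x _; exact: sqr_ge0.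
- exact/measurable_EFinP.
- by apply: filterS le => k lek _; rewrite lee_fin.
Qed.
End Tower.

(** * Continuity on the cube *)

Section ContinuityOnCube.
Variables (R : realType) (N : nat).
Local Notation mu := (cube_measure R).
Local Notation rows := (@point_of_row R N @^-1` @cube R N).
Implicit Types (k : point R N) (v w : 'rV[R]_N).

Definition row_of_point k : 'rV[R]_N := \row_i tnth k i.

Lemma row_of_pointK k : point_of_row (row_of_point k) = k.
Proof. by apply: eq_from_tnth => i; rewrite tnth_mktuple mxE. Qed.

(** Continuity of the entries behind [continuous_on_cube], written as convergence within the cube so
    that the limit theorems for sums, products and inverses apply directly. *)
Definition continuous_cube (T : topologicalType) (f : point R N -> T) :=
  forall v, rows v -> f (point_of_row w) @[w --> within rows (nbhs v)] --> f (point_of_row v).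

Lemma compact_rows : compact rows.
Proof.
rewrite (_ : rows = [set v | forall i, `[0, 1]%classic (v ord0 i)]).
  exact: (@rV_compact R N (fun=> `[0, 1]%classic) (fun=> @segment_compact R 0 1)).
by apply/seteqP; split=> v vc i; have := vc i; rewrite /= tnth_mktuple in_itv.
Qed.

Lemma cvg_mxP (X : Type) (F : set_system X) {FF : Filter F} (T : topologicalType) m n
    (f : X -> 'M[T]_(m, n)) (l : 'M[T]_(m, n)) :
  f x @[x --> F] --> l <-> forall i j, f x i j @[x --> F] --> l i j.
Proof.
split=> [fl i j B Bl|fl B [P Pl PB]].
  apply: (fl [set M : 'M[T]_(m, n) | B (M i j)]).
  exists (fun i' j' => if (i' == i) && (j' == j) then B else setT).
    by move=> i' j'; case: ifP => [/andP[/eqP -> /eqP ->]|_] //; exact: filterT.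
  by move=> M /(_ i j) /=; rewrite !eqxx.
have : \forall x \near F, forall i j, P i j (f x i j).
  apply: filter_forall => i; apply: filter_forall => j.
  exact: (fl i j _ (Pl i j)).
by apply: filterS => x Px; apply: PB => i j; exact: Px.
Qed.

Lemma continuous_on_cubeP m n (A : point R N -> 'M[R[i]]_(m, n)) :
  continuous_on_cube A <-> forall i j, continuous_cube (fun k => A k i j : R[i]^o).
Proof.
rewrite /continuous_on_cube; split.
  move=> /subspace_continuousP Ac i j v vc.
  have /cvg_mxP := Ac v vc; exact.
move=> Ac; apply/subspace_continuousP => v vc; apply/cvg_mxP => i j.
exact: Ac.
Qed.

Lemma normc_ge_Re (z : R[i]) : `|complex.Re z| <= Normc.normc z.
Proof.
by case: z => a b /=; rewrite -sqrtr_sqr ler_wsqrtr// lerDl sqr_ge0.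
Qed.

Lemma normc_ge_Im (z : R[i]) : `|complex.Im z| <= Normc.normc z.
Proof.
by case: z => a b /=; rewrite -sqrtr_sqr ler_wsqrtr// lerDr sqr_ge0.
Qed.

Lemma normc_le_ReIm (z : R[i]) :
  Normc.normc z <= `|complex.Re z| + `|complex.Im z|.
Proof.
case: z => a b /=; rewrite -[leRHS]ger0_norm ?addr_ge0// -sqrtr_sqr ler_wsqrtr//.
rewrite sqrrD !real_normK ?num_real// addrAC lerDl.
by rewrite mulrn_wge0// mulr_ge0.
Qed.

Lemma norm_complexE (z : R[i]) : `|z| = ((Normc.normc z)%:C)%C.
Proof. by case: z. Qed.

Lemma cvg_complexP (X : Type) (F : set_system X) {FF : Filter F}
    (f : X -> R[i]) (l : R[i]) :
  (f x : R[i]^o) @[x --> F] --> (l : R[i]^o) <->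
  complex.Re (f x) @[x --> F] --> complex.Re l /\
  complex.Im (f x) @[x --> F] --> complex.Im l.
Proof.
split=> [/cvgrPdist_lt fl|[/cvgrPdist_lt fr /cvgrPdist_lt fi]].
  split; apply/cvgrPdist_lt => e e0.
    have e0' : 0 < (e%:C)%C :> R[i] by rewrite ltcR.
    apply: filterS (fl _ e0') => x; rewrite norm_complexE ltcR; apply: le_lt_trans.
    have := normc_ge_Re (l - f x); rewrite raddfB; exact.
  have e0' : 0 < (e%:C)%C :> R[i] by rewrite ltcR.
  apply: filterS (fl _ e0') => x; rewrite norm_complexE ltcR; apply: le_lt_trans.
  by have := normc_ge_Im (l - f x); rewrite raddfB; exact.
(* A positive element of R[i] is real, since the order compares only numbers with equal imaginary
   parts. *)
apply/cvgrPdist_lt => -[e e'] /=; rewrite ltcE /= => /andP[/eqP-> e0].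
have e2 : 0 < e / 2 by rewrite divr_gt0.
apply: filterS2 (fr _ e2) (fi _ e2) => x xr xi.
rewrite ltcE /= eqxx /=; apply: (le_lt_trans (normc_le_ReIm (l - f x))).
by rewrite !raddfB [ltRHS]splitr ltrD.
Qed.

Lemma continuous_cube_complexP (f : point R N -> R[i]) :
  continuous_cube (f : _ -> R[i]^o) <->
  continuous_cube (fun k => complex.Re (f k)) /\ continuous_cube (fun k => complex.Im (f k)).
Proof.
split=> [fc|[fr fi] v vc]; last by apply/cvg_complexP; split; [exact: fr|exact: fi].
by split=> v vc; have /cvg_complexP[] := fc v vc.
Qed.

Section Closure.
Variable K : numFieldType.
Implicit Types f g : point R N -> K^o.

Lemma continuous_cube_cst (c : K) : continuous_cube ((fun=> c) : _ -> K^o).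
Proof. by move=> v _; exact: cvg_cst. Qed.

Lemma continuous_cubeD f g : continuous_cube f -> continuous_cube g ->
  continuous_cube (fun k => f k + g k : K^o).
Proof. by move=> fc gc v vc; apply: cvgD; [exact: fc|exact: gc]. Qed.

Lemma continuous_cubeM f g : continuous_cube f -> continuous_cube g ->
  continuous_cube (fun k => (f k : K) * g k : K^o).
Proof. by move=> fc gc v vc; apply: cvgM; [exact: fc|exact: gc]. Qed.

Lemma continuous_cubeN f : continuous_cube f -> continuous_cube (fun k => - f k : K^o).
Proof. by move=> fc v vc; apply: cvgN; exact: fc. Qed.

Lemma continuous_cubeV f : continuous_cube f -> (forall k, cube k -> f k != 0) ->
  continuous_cube (fun k => (f k : K)^-1 : K^o).
Proof. by move=> fc f0 v vc; apply: cvgV; [exact: f0|exact: fc]. Qed.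

Lemma continuous_cube_sum (I : Type) (s : seq I) (P : pred I) (F : I -> point R N -> K^o) :
  (forall i, P i -> continuous_cube (F i)) ->
  continuous_cube (fun k => \sum_(i <- s | P i) F i k : K^o).
Proof.
move=> Fc; elim: s => [|i s IH].
  by move=> v vc; under eq_cvg do rewrite big_nil; rewrite big_nil; exact: cvg_cst.
move=> v vc; under eq_cvg do rewrite big_cons; rewrite big_cons.
case: ifP => Pi; last exact: IH.
by apply: cvgD; [exact: Fc|exact: IH].
Qed.

Lemma continuous_cube_prod (I : Type) (s : seq I) (P : pred I) (F : I -> point R N -> K^o) :
  (forall i, P i -> continuous_cube (F i)) ->
  continuous_cube (fun k => \prod_(i <- s | P i) (F i k : K) : K^o).
Proof.
move=> Fc; elim: s => [|i s IH].
  by move=> v vc; under eq_cvg do rewrite big_nil; rewrite big_nil; exact: cvg_cst.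
move=> v vc; under eq_cvg do rewrite big_cons; rewrite big_cons.
case: ifP => Pi; last exact: IH.
by apply: cvgM; [exact: Fc|exact: IH].
Qed.
End Closure.

Lemma continuous_cube_eq (T : topologicalType) (f g : point R N -> T) :
  (forall k, cube k -> f k = g k) -> continuous_cube f -> continuous_cube g.
Proof.
move=> fg fc v vc; rewrite -fg//; apply: cvg_trans (fc v vc).
apply: near_eq_cvg; near=> w; rewrite fg//.
near: w; exact: withinT.
Unshelve. all: by end_near. Qed.

Implicit Types f : point R N -> R.

Lemma continuous_cube_bounded f : continuous_cube f ->
  exists2 K, 0 <= K & forall k, cube k -> `|f k| <= K.
Proof.
move=> /subspace_continuousP fc.
have /compact_bounded[M [_ MP]] := continuous_compact fc compact_rows.
exists (`|M| + 1); first by rewrite addr_ge0.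
move=> k kc; apply: (MP (`|M| + 1)); first by rewrite ltr_pwDr// ler_norm.
by exists (row_of_point k); rewrite /= row_of_pointK.
Qed.

(** Heine-Cantor, from compactness in its near-covering form. Distances are taken coordinate by
    coordinate, as points carry no norm. *)
Lemma continuous_cube_uniform f : continuous_cube f -> forall e, 0 < e ->
  exists2 d, 0 < d & forall k l, cube k -> cube l ->
    (forall i, `|tnth k i - tnth l i : R| < d) -> `|f k - f l| < e.
Proof.
move=> fc e e0.
have /compact_near_coveringP cov := compact_rows.
pose P (d : R) v := rows v -> forall w, rows w -> (forall i, `|v ord0 i - w ord0 i| < d) ->
  `|f (point_of_row v) - f (point_of_row w)| < e.
have := cov _ (0^'+ : set_system R) P _.
have nearP v : rows v -> \forall v' \near v & d \near 0^'+, P d v'.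
  move=> vc; have e2 : 0 < e / 2 by rewrite divr_gt0.
  have /cvgrPdist_lt/(_ _ e2) := fc v vc.
  rewrite near_withinE => /nbhs_ballP[r /= r0 rP].
  (* With half the radius, every w close to a v' near v still lies in the ball of radius r around
     v. *)
  have r2 : 0 < r / 2 by rewrite divr_gt0.
  exists (ball v (r / 2), [set d | d < r / 2]) => /=.
    by split; [exact: nbhsx_ballx|exact: nbhs_right_lt].
  move=> [v' d] /= [[_ vv'] dr] v'c w wc v'w.
  have v'r : ball v r v'.
    split=> // i j; rewrite /ball /=; have := vv' i j; rewrite /ball /= => vv'ij.
    by apply: lt_trans vv'ij _; lra.
  have wr : ball v r w.
    split=> // i j; rewrite ord1 /ball /=.
    have := vv' ord0 j; rewrite /ball /= => vv'j; have := v'w j => v'wj.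
    rewrite -(subrKA (v' ord0 j)); apply: (le_lt_trans (ler_normD _ _)).
    by lra.
  have h1 := rP _ v'r v'c; have h2 := rP _ wr wc.
  rewrite -(subrKA (f (point_of_row v))); apply: (le_lt_trans (ler_normD _ _)).
  by rewrite distrC [ltRHS]splitr ltrD.
move=> /(_ _ nearP) => -[d /= d0 dP].
exists (d / 2); first by rewrite divr_gt0.
move=> k l kc lc kl; rewrite -(row_of_pointK k) -(row_of_pointK l).
apply: (dP (d / 2)) => //=.
- by rewrite /ball /= sub0r normrN gtr0_norm ?divr_gt0//; lra.
- by rewrite divr_gt0.
- by rewrite /= row_of_pointK.
- by rewrite /= row_of_pointK.
- by rewrite /= row_of_pointK.
- by move=> i; rewrite !mxE; exact: kl.
Qed.

Lemma uniform_continuous_cube f : (forall e, 0 < e ->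
  exists2 d, 0 < d & forall k l, cube k -> cube l ->
    (forall i, `|tnth k i - tnth l i : R| < d) -> `|f k - f l| <= e) -> continuous_cube f.
Proof.
move=> fu v vc; apply/cvgrPdist_le => e e0; have [d d0 dP] := fu e e0.
rewrite near_withinE; apply/nbhs_ballP; exists d => //= w [_ vw] wc.
by apply: dP => // i; rewrite !tnth_mktuple; have := vw ord0 i.
Qed.
End ContinuityOnCube.

(** * Bounded measurable functions as multipliers of L2 *)

Section BoundedMeasurable.
Variables (R : realType) (N : nat).
Local Notation mu := (cube_measure R).
Implicit Types f g h : point R N -> R.

(** The class of coefficients used for integration: it is stable under products and averages, it
    multiplies L2 into itself, and it contains the extensions by zero of functions continuous on the
    cube. *)
Definition bounded_measurable f :=
  measurable_fun setT f /\ exists2 K, 0 <= K & forall k, `|f k| <= K.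

Lemma bounded_measurable_cst c : bounded_measurable (fun=> c).
Proof. by split=> //; exists `|c|. Qed.

Lemma bounded_measurableD f g : bounded_measurable f -> bounded_measurable g ->
  bounded_measurable (fun k => f k + g k).
Proof.
move=> [mf [K K0 fK]] [mg [L L0 gL]]; split; first exact: measurable_funD.
exists (K + L); first exact: addr_ge0.
by move=> k; rewrite (le_trans (ler_normD _ _))// lerD.
Qed.

Lemma bounded_measurableM f g : bounded_measurable f -> bounded_measurable g ->
  bounded_measurable (fun k => f k * g k).
Proof.
move=> [mf [K K0 fK]] [mg [L L0 gL]]; split; first exact: measurable_funM.
exists (K * L); first exact: mulr_ge0.
by move=> k; rewrite normrM ler_pM.
Qed.

Lemma bounded_measurableN f : bounded_measurable f -> bounded_measurable (fun k => - f k).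
Proof.
move=> [mf [K K0 fK]]; split; first exact: measurableT_comp.
by exists K => // k; rewrite normrN.
Qed.

Lemma bounded_measurable_indic A : measurable A ->
  bounded_measurable (\1_A : point R N -> R).
Proof.
move=> mA; split; first exact: measurable_indic.
by exists 1 => // k; rewrite indicE; case: (_ \in _); rewrite ?normr0 ?normr1.
Qed.

Lemma bounded_measurable_integrable f : bounded_measurable f ->
  (mu N).-integrable setT (EFin \o f).
Proof.
move=> [mf [K K0 fK]]; apply: (@le_integrable _ _ _ (mu N) _ _ _ (EFin \o (fun=> K))) => //.
- exact/measurable_EFinP.
- by move=> k _ /=; rewrite lee_fin (le_trans (fK k))// ler_norm.
- by apply/Lfun1_integrable; exact: Lfun_cst.
Qed.

Lemma bounded_measurable_Lfun2 f : bounded_measurable f -> f \in Lfun (mu N) 2%:E.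
Proof.
move=> fb; have [mf _] := fb; apply: Lfun2P => //.
exact: (bounded_measurable_integrable (bounded_measurableM fb fb)).
Qed.

Lemma Lfun2D f g : f \in Lfun (mu N) 2%:E -> g \in Lfun (mu N) 2%:E ->
  (fun k => f k + g k) \in Lfun (mu N) 2%:E.
Proof.
move=> f2 g2; have mf := Lfun2_measurable f2; have mg := Lfun2_measurable g2.
apply: Lfun2P; first exact: measurable_funD.
have := integrable_addr (integrable_mulr 2 (Lfun2_integrable_sqr f2))
  (integrable_mulr 2 (Lfun2_integrable_sqr g2)).
apply: le_integrable => //.
  by apply/measurable_EFinP; apply: measurable_funX; exact: measurable_funD.
move=> k _ /=; rewrite lee_fin ger0_norm ?sqr_ge0//; apply: le_trans (ler_norm _).
by rewrite -subr_ge0 (_ : _ - _ = (f k - g k) ^+ 2) ?sqr_ge0//; ring.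
Qed.

Lemma Lfun2M f g : bounded_measurable f -> g \in Lfun (mu N) 2%:E ->
  (fun k => f k * g k) \in Lfun (mu N) 2%:E.
Proof.
move=> [mf [K K0 fK]] g2; have mg := Lfun2_measurable g2.
apply: Lfun2P; first exact: measurable_funM.
apply: le_integrable (integrable_mulr (K ^+ 2) (Lfun2_integrable_sqr g2)) => //.
  by apply/measurable_EFinP; apply: measurable_funX; exact: measurable_funM.
move=> k _ /=; rewrite lee_fin exprMn [leLHS]normrM [leRHS]normrM ler_wpM2r//.
by rewrite !normrX lerXn2r// ?nnegrE// (le_trans (fK k))// ler_norm.
Qed.

Lemma Lfun2N f : f \in Lfun (mu N) 2%:E -> (fun k => - f k) \in Lfun (mu N) 2%:E.
Proof.
move=> f2; have := Lfun2M (bounded_measurable_cst (-1)) f2.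
by rewrite (_ : (fun k => -1 * f k) = (fun k => - f k))//; apply/funext => k; rewrite mulN1r.
Qed.

Lemma Lfun2_sum (I : Type) (s : seq I) (F : I -> point R N -> R) :
  (forall i, F i \in Lfun (mu N) 2%:E) -> (fun k => \sum_(i <- s) F i k) \in Lfun (mu N) 2%:E.
Proof.
move=> F2; elim: s => [|i s IH].
  rewrite (_ : (fun k => _) = fun=> 0); first exact: Lfun_cst.
  by apply/funext => k; rewrite big_nil.
rewrite (_ : (fun k => _) = fun k => F i k + \sum_(j <- s) F j k); first exact: Lfun2D.
by apply/funext => k; rewrite big_cons.
Qed.
End BoundedMeasurable.

(** * Intervals of width 1/(n+1) *)

Section Slab.
Variable R : realType.
Implicit Type r : R.

(** The half-open form makes the slabs disjoint, and n.+1 avoids a division by zero. *)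
Definition slab (n l : nat) : set (measurableTypeR R) :=
  [set` `[l%:R / n.+1%:R : R, l.+1%:R / n.+1%:R[].

Lemma measurable_slab n l : measurable (slab n l).
Proof. exact: measurable_itv. Qed.

Lemma slab_truncn n l r : 0 <= r -> slab n l r <-> Num.truncn (r * n.+1%:R) = l.
Proof.
move=> r0; rewrite /slab /= in_itv /= ler_pdivrMr ?ltr0n// ltr_pdivlMr ?ltr0n//.
split=> [|<-]; first exact: truncn_def.
by apply: truncn_itv; rewrite mulr_ge0.
Qed.

(** The bound is n.+2 because of r = 1, the only point of [0, 1] in the slab of index n.+1.
    Partitions of the cube therefore have n.+2 slabs. *)
Lemma truncn_lt n r : 0 <= r <= 1 -> (Num.truncn (r * n.+1%:R) < n.+2)%N.
Proof.
move=> /andP[r0 r1]; have rn : 0 <= r * n.+1%:R by rewrite mulr_ge0.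
have /andP[h _] := truncn_itv rn.
rewrite -(ltr_nat R); apply: (le_lt_trans h); apply: (@le_lt_trans _ _ n.+1%:R).
  by rewrite ler_piMl.
by rewrite ltr_nat.
Qed.

Lemma lebesgue01_slab n l : (lebesgue01 (slab n l) <= (n.+1%:R^-1 : R)%:E)%E.
Proof.
rewrite /lebesgue01 /mrestr.
apply: (@le_trans _ _ (lebesgue_measure (slab n l))).
  apply: le_measure; rewrite ?inE.
  - by apply: measurableI; exact: measurable_itv.
  - exact: measurable_itv.
  - exact: subIsetl.
rewrite /slab lebesgue_measure_itv /=; case: ifP => _; last by rewrite lee_fin invr_ge0.
by rewrite -EFinB lee_fin -mulrBl -natrB// subSnn mul1r.
Qed.

Lemma lebesgue01_gt0 (a d : R) : 0 <= a <= 1 -> 0 < d ->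
  (0 < lebesgue01 ([set` `](a - d)%R, (a + d)%R[] : set (measurableTypeR R)))%E.
Proof.
move=> /andP[a0 a1] d0; rewrite /lebesgue01 /mrestr.
(* [x, y] lies in [0, 1] and in ]a - d, a + d[, and has positive length even if a is an endpoint. *)
pose x : R := Num.max 0 (a - d / 2); pose y : R := Num.min 1 (a + d / 2).
have xy : x < y by rewrite /x /y lt_min !gt_max; apply/andP; split; apply/andP; split; lra.
apply: (@lt_le_trans _ _ (lebesgue_measure ([set` `[x, y]] : set (measurableTypeR R)))).
  by rewrite lebesgue_measure_itv /= lte_fin xy -EFinB lte_fin subr_gt0.
apply: le_measure; rewrite ?inE.
- exact: measurable_itv.
- by apply: measurableI; exact: measurable_itv.
- move=> z; rewrite /= !in_itv /= /x /y ge_max le_min => /andP[/andP[z0 za] /andP[z1 za']].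
  by split; apply/andP; split => //; lra.
Qed.
End Slab.

(** * Measurability, averages and sign of continuous functions *)

Section MeasurableContinuous.
Variables (R : realType) (N : nat).
Local Notation mu := (cube_measure R).
Implicit Types (f : point R N -> R) (k : point R N).

(** Measurability refers to the product sigma-algebra on tuples, continuity to the topology of row
    vectors. The two are linked by the simple functions h n, which take on each cell B n c of a grid
    the value of f at the lower corner g n c; they converge to f by uniform continuity. *)
Lemma continuous_cube_measurable f : continuous_cube f -> measurable_fun (@cube R N) f.
Proof.
move=> fc.
pose g n (c : {ffun 'I_N -> 'I_n.+2}) : point R N := [tuple (c i)%:R / n.+1%:R | i < N].
pose B n (c : {ffun 'I_N -> 'I_n.+2}) : set (point R N) :=
  [set k | forall i, @slab R n (c i) (tnth k i)].
pose h n k := \sum_(c : {ffun 'I_N -> 'I_n.+2}) f (g n c) * \1_(B n c) k.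
apply: (@measurable_fun_cvg _ _ _ _ h) => [n|k kc].
  apply: measurable_sum => c; apply: measurable_funM => //; apply: measurable_indic.
  by apply: (@measurable_box _ _ (fun i => @slab R n (c i))) => i; exact: measurable_slab.
apply/cvgrPdist_lt => e e0; have [d d0 dP] := continuous_cube_uniform fc e0.
near=> n.
have nd : n.+1%:R^-1 < d.
  near: n; exact: (near_infty_natSinv_lt (PosNum d0)).
(* The index of the cell that contains k; all other terms of h n vanish at k. *)
pose c : {ffun 'I_N -> 'I_n.+2} := [ffun i => Ordinal (truncn_lt n (kc i))].
have cE i : (c i : nat) = Num.truncn ((tnth k i : R) * n.+1%:R) by rewrite ffunE.
have -> : h n k = f (g n c).
  rewrite /h (bigD1 c)//= indicE mem_set ?mulr1; last first.
    by move=> i; apply/slab_truncn; [case/andP: (kc i)|rewrite cE].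
  rewrite big1 ?addr0// => c' c'c; rewrite indicE memNset ?mulr0// => kc'.
  move/eqP: c'c; apply; apply/ffunP => i; apply: val_inj => /=; rewrite cE.
  by have /slab_truncn -> := kc' i; case/andP: (kc i).
have ki0 i : 0 <= (tnth k i : R) * n.+1%:R by rewrite mulr_ge0//; case/andP: (kc i).
apply: dP => // i; rewrite tnth_mktuple cE; have /andP[t1 t2] := truncn_itv (ki0 i);
  have /andP[k0 k1] := kc i.
  rewrite divr_ge0//= ler_pdivrMr ?ltr0n// mul1r (le_trans t1)// ler_piMl//.
have n0 : n.+1%:R != 0 :> R by rewrite pnatr_eq0.
apply: le_lt_trans nd; rewrite -[X in `|X - _|](mulfK n0).
rewrite -mulrBl normrM [X in _ * X]ger0_norm ?invr_ge0// ler_piMl ?invr_ge0//.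
rewrite ger0_norm ?subr_ge0// lerBlDr.
by rewrite [leRHS]addrC natr1 ltW.
Unshelve. all: by end_near. Qed.

Lemma continuous_cube_restrict f : continuous_cube f -> bounded_measurable (f \_ (@cube R N)).
Proof.
move=> fc; split.
  by apply/(measurable_restrictT f (@measurable_cube R N)); exact: continuous_cube_measurable.
have [K K0 fK] := continuous_cube_bounded fc; exists K => // k.
by rewrite patchE; case: ifPn => [|_]; rewrite ?normr0// inE; exact: fK.
Qed.

Lemma ravg_restrict j f k : cube k -> ravg j (f \_ (@cube R N)) k = ravg j f k.
Proof.
move=> kc; apply: eq_Rintegral => x; rewrite inE => xc.
by rewrite patchE mem_set//; exact: cube_replace.
Qed.

Lemma bounded_measurable_section j f k : bounded_measurable f ->
  bounded_measurable (fun x : point R j => f (replace_first x k)).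
Proof.
move=> [mf [K K0 fK]]; split; first exact: measurable_section.
by exists K.
Qed.

(** The sections through k and l differ only in the coordinates that are not averaged, so a modulus
    of uniform continuity of f serves for its average. *)
Lemma continuous_cube_ravg j f : continuous_cube f -> continuous_cube (ravg j f).
Proof.
move=> fc; apply: (@continuous_cube_eq _ _ _ (ravg j (f \_ (@cube R N)))).
  by move=> k; exact: ravg_restrict.
have fb := continuous_cube_restrict fc; have [mf _] := fb.
apply: uniform_continuous_cube => e e0; have [d d0 dP] := continuous_cube_uniform fc e0.
exists d => // k l kc lc kl.
have ki := bounded_measurable_integrable (bounded_measurable_section j k fb).
have li := bounded_measurable_integrable (bounded_measurable_section j l fb).
have kli := integrable_subr ki li.
rewrite !ravgE// -RintegralB//; apply: (le_trans (le_normr_Rintegral _ kli)) => //.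
rewrite /Rintegral -integral_cube; last first.
  by have /integrableP[] := integrable_norm kli.
rewrite -/(Rintegral _ _ _).
rewrite -[leRHS](_ : \int[mu j]_(x in @cube R j) e = e); last first.
  by rewrite Rintegral_cst ?[X in fine X]cube_measure_cube ?mulr1//; exact: measurable_cube.
apply: le_Rintegral.
- exact: measurable_cube.
- by apply: (integrableS measurableT) (integrable_norm kli) => //; exact: measurable_cube.
- have ei : (mu j).-integrable setT (EFin \o (fun=> e)) by apply/Lfun1_integrable; exact: Lfun_cst.
  by apply: (integrableS measurableT) ei => //; exact: measurable_cube.
move=> x xc; have kx := cube_replace xc kc; have lx := cube_replace xc lc.
rewrite !patchE !mem_set//; apply/ltW/dP => // i.
have [ij|ji] := ltnP i j.
  by rewrite !(tnth_replace_lt _ _ ij) subrr normr0.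
by rewrite !tnth_replace_ge.
Qed.

(** If f k < 0, then f is negative on the part in the cube of a small box around k. This part has
    positive measure, also when k is on the boundary. *)
Lemma continuous_cube_ae_ge0 f : continuous_cube f -> {ae mu N, forall k, 0 <= f k} ->
  forall k, cube k -> 0 <= f k.
Proof.
move=> fc [A [mA A0 fA]] k kc; rewrite leNgt; apply/negP => fk.
have fk0 : 0 < - f k by rewrite oppr_gt0.
have [d d0 dP] := continuous_cube_uniform fc fk0.
pose E i : set (measurableTypeR R) := [set` `](tnth k i : R) - d, (tnth k i : R) + d[].
have mE i : measurable (E i `&` [set` `[0, 1]]) by apply: measurableI; exact: measurable_itv.
have : (mu N [set l | forall i, (E i `&` [set` `[0%R, 1%R]]) (tnth l i)] <= mu N A)%E.
  apply: le_measure; rewrite ?inE//; first exact: (@measurable_box _ _ (fun i => E i `&` [set` `[0, 1]])).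
  move=> l lE; apply: fA => /=; apply/negP; rewrite -ltNge.
  have lc : cube l by move=> i; have [_] := lE i; rewrite /= in_itv.
  have := dP _ _ lc kc; rewrite ltr_norml => /(_ _)/andP[|_ h].
    by move=> i; have [] := lE i; rewrite /E /= in_itv /= ltr_distl => /andP[-> ->].
  by move: h; rewrite ltrBlDr addrC subrr.
rewrite A0 (@cube_box _ _ (fun i => E i `&` [set` `[0, 1]]))// leNgt => /negP; apply.
apply: (@big_ind _ (fun x : \bar R => 0 < x)%E) => //; first by move=> x y x0 y0; exact: mule_gt0.
move=> i _; have := lebesgue01_gt0 (kc i) d0.
by rewrite /lebesgue01 /mrestr -setIA setIid.
Qed.
End MeasurableContinuous.

(** * Complex and vector valued functions *)

Section ComplexFunctions.
Variables (R : realType) (N : nat).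
Local Notation mu := (cube_measure R).
Implicit Types (f g : point R N -> R[i]) (k : point R N).

Definition bounded_measurableC f :=
  bounded_measurable (fun k => complex.Re (f k)) /\ bounded_measurable (fun k => complex.Im (f k)).

Definition sqintC f :=
  (fun k => complex.Re (f k)) \in Lfun (mu N) 2%:E /\
  (fun k => complex.Im (f k)) \in Lfun (mu N) 2%:E.

Lemma ReM (a b : R[i]) :
  complex.Re (a * b) = complex.Re a * complex.Re b - complex.Im a * complex.Im b.
Proof. by case: a b => [a b] [c d]. Qed.

Lemma ImM (a b : R[i]) :
  complex.Im (a * b) = complex.Re a * complex.Im b + complex.Im a * complex.Re b.
Proof. by case: a b => [a b] [c d]. Qed.

Lemma Re_sum (I : Type) (s : seq I) (z : I -> R[i]) :
  complex.Re (\sum_(i <- s) z i) = \sum_(i <- s) complex.Re (z i).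
Proof. exact: raddf_sum. Qed.

Lemma Im_sum (I : Type) (s : seq I) (z : I -> R[i]) :
  complex.Im (\sum_(i <- s) z i) = \sum_(i <- s) complex.Im (z i).
Proof. exact: raddf_sum. Qed.

Lemma bounded_measurableC_cst c : bounded_measurableC (fun=> c).
Proof. by split; exact: bounded_measurable_cst. Qed.

Lemma bounded_measurableCM f g : bounded_measurableC f -> bounded_measurableC g ->
  bounded_measurableC (fun k => f k * g k).
Proof.
move=> [fr fi] [gr gi]; split.
  under eq_fun do rewrite ReM.
  by apply: bounded_measurableD; [|apply: bounded_measurableN]; exact: bounded_measurableM.
under eq_fun do rewrite ImM.
by apply: bounded_measurableD; exact: bounded_measurableM.
Qed.

Lemma bounded_measurableC_sum (I : Type) (s : seq I) (F : I -> point R N -> R[i]) :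
  (forall i, bounded_measurableC (F i)) ->
  bounded_measurableC (fun k => \sum_(i <- s) F i k).
Proof.
move=> Fb; elim: s => [|i s [IHr IHi]].
  by under eq_fun do rewrite big_nil; exact: bounded_measurableC_cst.
have [Fr Fi] := Fb i; under eq_fun do rewrite big_cons.
by split; under eq_fun do rewrite raddfD; exact: bounded_measurableD.
Qed.

Lemma bounded_measurableC_sqint f : bounded_measurableC f -> sqintC f.
Proof. by move=> [fr fi]; split; exact: bounded_measurable_Lfun2. Qed.

Lemma sqintCM f g : bounded_measurableC f -> sqintC g -> sqintC (fun k => f k * g k).
Proof.
move=> [fr fi] [gr gi]; split.
  under eq_fun do rewrite ReM.
  by apply: Lfun2D; [|apply: Lfun2N]; exact: Lfun2M.
under eq_fun do rewrite ImM.
by apply: Lfun2D; exact: Lfun2M.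
Qed.

Lemma sqintC_sum (I : Type) (s : seq I) (F : I -> point R N -> R[i]) :
  (forall i, sqintC (F i)) -> sqintC (fun k => \sum_(i <- s) F i k).
Proof.
move=> F2; split.
  under eq_fun do rewrite Re_sum.
  by apply: Lfun2_sum => i; have [] := F2 i.
under eq_fun do rewrite Im_sum.
by apply: Lfun2_sum => i; have [] := F2 i.
Qed.

Definition cavg j f k : R[i] :=
  Complex (ravg j (fun k => complex.Re (f k)) k) (ravg j (fun k => complex.Im (f k)) k).

Definition section_integrable j f k :=
  (mu j).-integrable setT (fun x => (complex.Re (f (replace_first x k)))%:E) /\
  (mu j).-integrable setT (fun x => (complex.Im (f (replace_first x k)))%:E).

Lemma ae_section_integrable j f : (j <= N)%N -> sqintC f ->
  {ae mu N, forall k, section_integrable j f k}.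
Proof.
move=> jN [fr fi].
by apply: filterS2 (ae_integrable_section jN (Lfun2_integrable fr))
  (ae_integrable_section jN (Lfun2_integrable fi)) => k.
Qed.

Lemma bounded_section_integrable j f k : bounded_measurableC f -> section_integrable j f k.
Proof.
move=> [fr fi]; split; apply: bounded_measurable_integrable.
  exact: (bounded_measurable_section j k fr).
exact: (bounded_measurable_section j k fi).
Qed.

(** Complex linearity of the average at one point k. The relation for g is required only on the
    section through k, so the coefficients may be values at k of functions that are constant along
    it. Complex products mix real and imaginary parts, hence the two real integrands Gr and Gi. *)
Lemma cavg_sum j (I : Type) (s : seq I) (a : I -> R[i]) (F : I -> point R N -> R[i]) g k :
  (forall c, sqintC (F c)) -> (forall c, section_integrable j (F c) k) ->
  (forall x : point R j, cube x -> g (replace_first x k) = \sum_(c <- s) a c * F c (replace_first x k)) ->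
  cavg j g k = \sum_(c <- s) a c * cavg j (F c) k.
Proof.
move=> F2 Fi gE.
have mF c : measurable_fun setT (fun k => complex.Re (F c k)) /\
    measurable_fun setT (fun k => complex.Im (F c k)).
  by have [h1 h2] := F2 c; split; exact: Lfun2_measurable.
have rE c : ravg j (fun k => complex.Re (F c k)) k =
    \int[mu j]_x complex.Re (F c (replace_first x k)) by rewrite ravgE; have [] := mF c.
have iE c : ravg j (fun k => complex.Im (F c k)) k =
    \int[mu j]_x complex.Im (F c (replace_first x k)) by rewrite ravgE; have [] := mF c.
have ci (f1 f2 : point R j -> R) (b1 b2 : R) :
    (mu j).-integrable setT (EFin \o f1) -> (mu j).-integrable setT (EFin \o f2) ->
    (mu j).-integrable setT (EFin \o (fun x => b1 * f1 x + b2 * f2 x)) /\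
    \int[mu j]_x (b1 * f1 x + b2 * f2 x) = b1 * \int[mu j]_x f1 x + b2 * \int[mu j]_x f2 x.
  move=> h1 h2; have h1' := integrable_mulr b1 h1; have h2' := integrable_mulr b2 h2.
  by split; [exact: integrable_addr|rewrite RintegralD// !RintegralZl].
pose Gr (x : point R j) := \sum_(c <- s) (complex.Re (a c) * complex.Re (F c (replace_first x k)) +
    (- complex.Im (a c)) * complex.Im (F c (replace_first x k))).
pose Gi (x : point R j) := \sum_(c <- s) (complex.Re (a c) * complex.Im (F c (replace_first x k)) +
    complex.Im (a c) * complex.Re (F c (replace_first x k))).
have toT (h : point R j -> R) : (mu j).-integrable setT (EFin \o h) ->
    \int[mu j]_(x in @cube R j) h x = \int[mu j]_x h x.
  by move=> /integrableP[mh _]; rewrite /Rintegral integral_cube.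
rewrite /cavg [X in Complex X _](_ : _ = \int[mu j]_x Gr x); last first.
  rewrite -toT; last first.
    by apply: integrable_sumr => c _; have [h1 h2] := Fi c; have [] := ci _ _ (complex.Re (a c)) (- complex.Im (a c)) h1 h2.
  apply: eq_Rintegral => x; rewrite inE => xc; rewrite gE// Re_sum.
  by apply: eq_bigr => c _; rewrite ReM mulNr.
rewrite [X in Complex _ X](_ : _ = \int[mu j]_x Gi x); last first.
  rewrite -toT; last first.
    by apply: integrable_sumr => c _; have [h1 h2] := Fi c; have [] := ci _ _ (complex.Re (a c)) (complex.Im (a c)) h2 h1.
  apply: eq_Rintegral => x; rewrite inE => xc; rewrite gE// Im_sum.
  by apply: eq_bigr => c _; rewrite ImM.
rewrite !Rintegral_sumr; first last.
- by move=> c _; have [h1 h2] := Fi c; have [] := ci _ _ (complex.Re (a c)) (- complex.Im (a c)) h1 h2.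
- by move=> c _; have [h1 h2] := Fi c; have [] := ci _ _ (complex.Re (a c)) (complex.Im (a c)) h2 h1.
rewrite (_ : Complex _ _ = \sum_(c <- s) Complex
  (complex.Re (a c) * ravg j (fun k => complex.Re (F c k)) k - complex.Im (a c) * ravg j (fun k => complex.Im (F c k)) k)
  (complex.Re (a c) * ravg j (fun k => complex.Im (F c k)) k + complex.Im (a c) * ravg j (fun k => complex.Re (F c k)) k)).
  by apply: eq_bigr => c _; case: (a c).
apply/eqP; rewrite eq_complex; apply/andP; split; apply/eqP => /=.
  rewrite Re_sum; apply: eq_bigr => c _ /=; have [h1 h2] := Fi c.
  by have [_ ->] := ci _ _ (complex.Re (a c)) (- complex.Im (a c)) h1 h2; rewrite -rE -iE mulNr.
rewrite Im_sum; apply: eq_bigr => c _ /=; have [h1 h2] := Fi c.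
by have [_ ->] := ci _ _ (complex.Re (a c)) (complex.Im (a c)) h2 h1; rewrite -rE -iE.
Qed.

Lemma cavg_ae j f g : (j <= N)%N -> sqintC f -> sqintC g ->
  {ae mu N, forall k, f k = g k} -> {ae mu N, forall k, cavg j f k = cavg j g k}.
Proof.
move=> jN [fr fi] [gr gi] fg.
have h1 := ravg_ae jN (Lfun2_integrable fr) (Lfun2_integrable gr).
have h2 := ravg_ae jN (Lfun2_integrable fi) (Lfun2_integrable gi).
apply: filterS2 (h1 _) (h2 _) => [k e1 e2||]; first by rewrite /cavg e1 e2.
  by apply: filterS fg => k ->.
by apply: filterS fg => k ->.
Qed.

Lemma cavg_cavg i j f : (j <= i)%N -> (i <= N)%N -> sqintC f ->
  {ae mu N, forall k, cavg i (cavg j f) k = cavg i f k}.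
Proof.
move=> ji iN [fr fi].
apply: filterS2 (ravg_ravg ji iN (Lfun2_integrable fr))
  (ravg_ravg ji iN (Lfun2_integrable fi)) => k e1 e2.
by rewrite /cavg -e1 -e2.
Qed.

Lemma sqintC_cavg j f : (j <= N)%N -> sqintC f -> sqintC (cavg j f).
Proof.
by move=> jN [fr fi]; split; [have [] := Lfun2_ravg jN fr|have [] := Lfun2_ravg jN fi].
Qed.

Lemma bounded_measurable_ravg j (f : point R N -> R) : (j <= N)%N ->
  bounded_measurable f -> bounded_measurable (ravg j f).
Proof.
move=> jN fb; have [mf [K K0 fK]] := fb; split.
  by have /integrableP[/measurable_EFinP] := integrable_ravg jN (bounded_measurable_integrable fb).
exists K => // k; have fki := bounded_measurable_integrable (bounded_measurable_section j k fb).
rewrite ravgE//; apply: (le_trans (le_normr_Rintegral _ fki)) => //.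
rewrite -[leRHS](_ : \int[mu j]__ K = K); last first.
  by rewrite Rintegral_cst ?[X in fine X]cube_measure_setT ?mulr1.
apply: le_Rintegral => //; first exact: integrable_norm.
by apply/Lfun1_integrable; exact: Lfun_cst.
Qed.

Lemma bounded_measurableC_cavg j f : (j <= N)%N -> bounded_measurableC f ->
  bounded_measurableC (cavg j f).
Proof. by move=> jN [fr fi]; split; exact: bounded_measurable_ravg. Qed.

Lemma cavg_invariant i j f (x : point R j) k : (j <= i)%N ->
  cavg i f (replace_first x k) = cavg i f k.
Proof. by move=> ji; rewrite /cavg !ravg_invariant. Qed.

Lemma cavg_cst j f k c : (forall x : point R j, cube x -> f (replace_first x k) = c) ->
  cavg j f k = c.
Proof.
move=> fc; rewrite /cavg (@ravg_cst _ _ _ _ _ (complex.Re c)).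
  by rewrite (@ravg_cst _ _ _ _ _ (complex.Im c)); [case: (c)|move=> x xc; rewrite fc].
by move=> x xc; rewrite fc.
Qed.
End ComplexFunctions.

(** * Averages and norms of vector valued functions *)

Section VectorFunctions.
Variables (R : realType) (N : nat).
Local Notation mu := (cube_measure R).
Local Notation pt := (point R N).

Definition bounded_measurable_mx m n (A : pt -> 'M[R[i]]_(m, n)) :=
  forall i j, bounded_measurableC (fun k => A k i j).

Lemma bounded_measurable_entry m n (A : pt -> 'M[R[i]]_(m, n)) : bounded_measurable_mx A ->
  forall i j, bounded_measurableC (fun k => A k i j).
Proof. exact. Qed.

Definition avg_mx j m n (A : pt -> 'M[R[i]]_(m, n)) (k : pt) : 'M[R[i]]_(m, n) :=
  \matrix_(r, c) cavg j (fun k => A k r c) k.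

Lemma sqintP m (u : pt -> 'cV[R[i]]_m) :
  (u \in @sqint R N m) <-> forall i, sqintC (fun k => u k i ord0).
Proof.
split=> [/forallP u2 i|u2]; first by have /andP[] := u2 i.
by apply/forallP => i; apply/andP; exact: u2.
Qed.

Lemma averageE j m (u : pt -> 'cV[R[i]]_m) k i :
  average j u k i ord0 = cavg j (fun k => u k i ord0) k.
Proof. by rewrite mxE. Qed.

Lemma sqint_average j m (u : pt -> 'cV[R[i]]_m) : (j <= N)%N ->
  u \in @sqint R N m -> average j u \in @sqint R N m.
Proof.
move=> jN /sqintP u2; apply/sqintP => i; under eq_fun do rewrite averageE.
exact: sqintC_cavg.
Qed.

Lemma sqint_mulmx m p (A : pt -> 'M[R[i]]_(m, p)) u :
  bounded_measurable_mx A -> u \in @sqint R N p -> (fun k => A k *m u k) \in @sqint R N m.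
Proof.
move=> Ab /sqintP u2; apply/sqintP => i; under eq_fun do rewrite mxE.
by apply: sqintC_sum => c; exact: sqintCM.
Qed.

Lemma sqint_bounded m (A : pt -> 'cV[R[i]]_m) : bounded_measurable_mx A -> A \in @sqint R N m.
Proof. by move=> Ab; apply/sqintP => i; apply: bounded_measurableC_sqint. Qed.

Lemma bounded_measurable_mulmx m n p (A : pt -> 'M[R[i]]_(m, n)) (B : pt -> 'M[R[i]]_(n, p)) :
  bounded_measurable_mx A -> bounded_measurable_mx B ->
  bounded_measurable_mx (fun k => A k *m B k).
Proof.
move=> Ab Bb i j; under eq_fun do rewrite mxE.
by apply: bounded_measurableC_sum => c; exact: bounded_measurableCM.
Qed.

Lemma bounded_measurable_cst_mx m n (A : 'M[R[i]]_(m, n)) : bounded_measurable_mx (fun=> A).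
Proof. by move=> i j; exact: bounded_measurableC_cst. Qed.

Lemma bounded_measurable_scalar_mx m (f : pt -> R[i]) : bounded_measurableC f ->
  bounded_measurable_mx (fun k => (f k)%:M : 'M[R[i]]_m).
Proof.
move=> fb i j; rewrite (_ : (fun k => _) = fun k => f k * (i == j)%:R).
  by apply: bounded_measurableCM => //; exact: bounded_measurableC_cst.
by apply/funext => k; rewrite mxE mulr_natr.
Qed.

Lemma bounded_measurable_avg_mx j m n (A : pt -> 'M[R[i]]_(m, n)) : (j <= N)%N ->
  bounded_measurable_mx A -> bounded_measurable_mx (avg_mx j A).
Proof.
move=> jN Ab i c; under eq_fun do rewrite mxE.
by apply: bounded_measurableC_cavg; last exact: Ab.
Qed.

Lemma avg_mx_invariant i j m n (A : pt -> 'M[R[i]]_(m, n)) (x : point R j) k : (j <= i)%N ->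
  avg_mx i A (replace_first x k) = avg_mx i A k.
Proof. by move=> ji; apply/matrixP => r c; rewrite !mxE cavg_invariant. Qed.

Lemma average_invariant i j m (u : pt -> 'cV[R[i]]_m) (x : point R j) k : (j <= i)%N ->
  average i u (replace_first x k) = average i u k.
Proof. by move=> ji; apply/colP => r; rewrite !averageE cavg_invariant. Qed.

Lemma average_cst j m (u : pt -> 'cV[R[i]]_m) k c :
  (forall x : point R j, cube x -> u (replace_first x k) = c) -> average j u k = c.
Proof.
by move=> uc; apply/colP => r; rewrite averageE; apply: cavg_cst => x xc; rewrite uc.
Qed.

Lemma average0 m (u : pt -> 'cV[R[i]]_m) : average 0 u = u.
Proof.
by apply/funext => k; apply: average_cst => x _; rewrite replace_first0.
Qed.

Lemma avg_mx0 m n (A : pt -> 'M[R[i]]_(m, n)) : avg_mx 0 A = A.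
Proof.
apply/funext => k; apply/matrixP => i j; rewrite mxE.
by apply: cavg_cst => x _; rewrite replace_first0.
Qed.

Lemma eq_average j m (u v : pt -> 'cV[R[i]]_m) k :
  (forall x : point R j, cube x -> u (replace_first x k) = v (replace_first x k)) ->
  average j u k = average j v k.
Proof.
move=> uv; apply/colP => r; rewrite !averageE.
by congr Complex; apply: eq_Rintegral => x; rewrite inE => xc; rewrite uv.
Qed.

Lemma ae_all (I : finType) (P : I -> pt -> Prop) :
  (forall i, {ae mu N, forall k, P i k}) -> {ae mu N, forall k, forall i, P i k}.
Proof. by move=> iP; apply: filter_forall. Qed.

Lemma average_ae j m (u v : pt -> 'cV[R[i]]_m) : (j <= N)%N ->
  u \in @sqint R N m -> v \in @sqint R N m ->
  {ae mu N, forall k, u k = v k} -> {ae mu N, forall k, average j u k = average j v k}.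
Proof.
move=> jN /sqintP u2 /sqintP v2 uv.
have h : {ae mu N, forall k, forall r, average j u k r ord0 = average j v k r ord0}.
  apply: ae_all => r.
  apply: filterS (cavg_ae jN (u2 r) (v2 r) _) => [k|]; first by rewrite !averageE.
  by apply: filterS uv => k ->.
by apply: filterS h => k h; apply/colP.
Qed.

Lemma average_average i j m (u : pt -> 'cV[R[i]]_m) : (j <= i)%N -> (i <= N)%N ->
  u \in @sqint R N m -> {ae mu N, forall k, average i (average j u) k = average i u k}.
Proof.
move=> ji iN /sqintP u2.
have h : {ae mu N, forall k, forall r, average i (average j u) k r ord0 = average i u k r ord0}.
  apply: ae_all => r; apply: filterS (cavg_cavg ji iN (u2 r)) => k; rewrite !averageE.
  rewrite (_ : (fun k => average j u k r ord0) = cavg j (fun k => u k r ord0))//.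
  by apply/funext => k'; rewrite averageE.
by apply: filterS h => k h; apply/colP.
Qed.

Lemma average_linear j m p (D : 'M[R[i]]_(p, m)) (u : pt -> 'cV[R[i]]_m)
    (v w : pt -> 'cV[R[i]]_p) k :
  u \in @sqint R N m -> v \in @sqint R N p ->
  (forall i, section_integrable j (fun k => u k i ord0) k) ->
  (forall i, section_integrable j (fun k => v k i ord0) k) ->
  (forall x : point R j, cube x ->
    w (replace_first x k) = D *m u (replace_first x k) + v (replace_first x k)) ->
  average j w k = D *m average j u k + average j v k.
Proof.
move=> /sqintP u2 /sqintP v2 ui vi wE; apply/colP => r.
(* One linear combination for both terms: [Some c] is the c-th column of D, and [None] is v with
   coefficient 1. *)
pose a (c : option 'I_m) : R[i] := if c is Some c then D r c else 1.
pose F (c : option 'I_m) k := if c is Some c then u k c ord0 else v k r ord0.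
have big h : \sum_(c <- None :: map Some (enum 'I_m)) h c =
    h None + \sum_(c < m) h (Some c) :> R[i].
  by rewrite big_cons big_map big_enum.
rewrite averageE (@cavg_sum _ _ _ _ (None :: map Some (enum 'I_m)) a F).
- rewrite big mul1r !mxE addrC; congr (_ + _).
  by apply: eq_bigr => c _; rewrite !mxE.
- by case=> [c|] /=; [exact: u2|exact: v2].
- by case=> [c|] /=; [exact: ui|exact: vi].
- move=> x xc; rewrite big mul1r wE// !mxE addrC; congr (_ + _).
Qed.

Lemma ae_sections j m (u : pt -> 'cV[R[i]]_m) : (j <= N)%N -> u \in @sqint R N m ->
  {ae mu N, forall k, forall i, section_integrable j (fun k => u k i ord0) k}.
Proof. by move=> jN /sqintP u2; apply: ae_all => i; exact: ae_section_integrable. Qed.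

Lemma sqint0 m : (fun=> 0) \in @sqint R N m.
Proof. by apply: sqint_bounded; exact: bounded_measurable_cst_mx. Qed.

(** On the section through k, D acts as a constant matrix. The null set consists of the points whose
    sections of u are not integrable. *)
Lemma average_mull j m p (D : pt -> 'M[R[i]]_(p, m)) (u : pt -> 'cV[R[i]]_m) :
  (j <= N)%N -> u \in @sqint R N m ->
  (forall k, cube k -> forall x : point R j, cube x -> D (replace_first x k) = D k) ->
  {ae mu N, forall k, average j (fun k => D k *m u k) k = D k *m average j u k}.
Proof.
move=> jN u2 DD; apply: filterS2 (ae_sections jN u2) (@ae_cube R N) => k ui kc.
rewrite (@average_linear j _ _ (D k) u (fun=> 0)).
- by rewrite [X in _ + X](@average_cst _ _ _ _ 0) ?addr0.
- exact: u2.
- exact: sqint0.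
- exact: ui.
- by move=> i; apply: bounded_section_integrable; exact: bounded_measurableC_cst.
- by move=> x xc; rewrite addr0 DD.
Qed.

(** Here the vector is the constant factor. All sections of the bounded Q are integrable, which
    gives the identity at every k and not only almost everywhere. *)
Lemma average_mulr j m p (Q : pt -> 'M[R[i]]_(p, m)) (w : pt -> 'cV[R[i]]_m) k :
  bounded_measurable_mx Q ->
  (forall x : point R j, cube x -> w (replace_first x k) = w k) ->
  average j (fun k => Q k *m w k) k = avg_mx j Q k *m w k.
Proof.
move=> Qb wE; apply/colP => r; rewrite averageE.
rewrite (@cavg_sum _ _ _ _ (enum 'I_m) (fun c => w k c ord0) (fun c k => Q k r c)).
- rewrite big_enum mxE; apply: eq_bigr => c _; rewrite mxE mulrC; congr (_ * _).
- by move=> c; apply: bounded_measurableC_sqint.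
- by move=> c; apply: bounded_section_integrable.
- by move=> x xc; rewrite big_enum mxE; apply: eq_bigr => c _; rewrite wE// mulrC.
Qed.

Definition sqnorm m (z : 'cV[R[i]]_m) : R := \sum_(i < m) Normc.normc (z i ord0) ^+ 2.

Lemma sqnorm_ge0 m (z : 'cV[R[i]]_m) : 0 <= sqnorm z.
Proof. by apply: sumr_ge0 => i _; exact: sqr_ge0. Qed.

Lemma sqnorm0 m : sqnorm (0 : 'cV[R[i]]_m) = 0.
Proof. by rewrite /sqnorm big1// => r _; rewrite mxE Normc.normc0 expr0n. Qed.

Lemma sqnorm_eq0 m (z : 'cV[R[i]]_m) : sqnorm z <= 0 -> z = 0.
Proof.
move=> z0; have /eqP : sqnorm z = 0 by apply/eqP; rewrite eq_le z0 sqnorm_ge0.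
rewrite /sqnorm psumr_eq0 => [/allP h|i _]; last exact: sqr_ge0.
apply/colP => r; rewrite mxE; apply: Normc.eq0_normc; apply/eqP; rewrite -sqrf_eq0.
by have := h r; rewrite mem_index_enum => /(_ isT).
Qed.

Lemma sqnorm_scale_indicator m (Q : set pt) k (z : 'cV[R[i]]_m) :
  sqnorm (((\1_Q k)%:C)%C *: z) = \1_Q k * sqnorm z.
Proof.
rewrite /sqnorm mulr_sumr; apply: eq_bigr => r _.
rewrite mxE Normc.normcM exprMn; congr (_ * _).
rewrite normc_sqr /= expr0n addr0 indicE.
by case: (_ \in _); rewrite ?expr1n ?expr0n.
Qed.

Lemma integrable_sqnorm_sqint m (u : pt -> 'cV[R[i]]_m) : u \in @sqint R N m ->
  (mu N).-integrable setT (EFin \o (fun k => sqnorm (u k))).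
Proof. by move=> u2; exact: (integrable_sqnorm (Sqfun u2)). Qed.

Lemma ae_le_Rintegral (f g : pt -> R) :
  (mu N).-integrable setT (EFin \o f) -> (mu N).-integrable setT (EFin \o g) ->
  (forall k, 0 <= f k) -> (forall k, 0 <= g k) -> {ae mu N, forall k, f k <= g k} ->
  \int[mu N]_k f k <= \int[mu N]_k g k.
Proof.
move=> fi gi f0 g0 fg; rewrite /Rintegral fine_le//; try exact: integrable_fin_num.
have /integrableP[mf _] := fi; have /integrableP[mg _] := gi.
apply: ae_ge0_le_integral => //.
- by move=> k _; rewrite lee_fin.
- by move=> k _; rewrite lee_fin.
- by apply: filterS fg => k le _; rewrite lee_fin.
Qed.

Lemma sqr_norm2E m (u : pt -> 'cV[R[i]]_m) : u \in @sqint R N m ->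
  norm2 u ^+ 2 = \sum_(i < m) (\int[mu N]_k complex.Re (u k i ord0) ^+ 2 +
                               \int[mu N]_k complex.Im (u k i ord0) ^+ 2).
Proof.
move=> /sqintP u2; rewrite sqr_norm2 Rintegral_sumr => [|i _].
  apply: eq_bigr => i _; have [ur ui] := u2 i.
  rewrite -RintegralD//; try exact: Lfun2_integrable_sqr.
  by apply: eq_Rintegral => k _; rewrite normc_sqr.
have [ur ui] := u2 i.
under eq_fun do rewrite normc_sqr.
by apply: integrable_addr; exact: Lfun2_integrable_sqr.
Qed.

Lemma sqr_norm2_le m p (u : pt -> 'cV[R[i]]_m) (v : pt -> 'cV[R[i]]_p) K : 0 <= K ->
  u \in @sqint R N m -> v \in @sqint R N p ->
  {ae mu N, forall k, sqnorm (u k) <= K * sqnorm (v k)} ->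
  norm2 u ^+ 2 <= K * norm2 v ^+ 2.
Proof.
move=> K0 u2 v2 uv; rewrite !sqr_norm2 -RintegralZl//; last exact: integrable_sqnorm_sqint.
apply: ae_le_Rintegral => //.
- exact: integrable_sqnorm_sqint.
- exact: (integrable_mulr K (integrable_sqnorm_sqint v2)).
- by move=> k; exact: sqnorm_ge0.
- by move=> k; rewrite mulr_ge0// sqnorm_ge0.
Qed.

Lemma norm2_average j m (u : pt -> 'cV[R[i]]_m) : (j <= N)%N -> u \in @sqint R N m ->
  norm2 (average j u) ^+ 2 <= norm2 u ^+ 2.
Proof.
move=> jN u2; rewrite !sqr_norm2E ?sqint_average//; apply: ler_sum => i _.
have /sqintP/(_ i)[ur ui] := u2.
under eq_Rintegral do rewrite averageE; under [X in _ + X]eq_Rintegral do rewrite averageE.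
by apply: lerD; [have [] := Lfun2_ravg jN ur|have [] := Lfun2_ravg jN ui].
Qed.

Definition slab_set (l : 'I_N) n c : set pt := [set k | @slab R n c (tnth k l)].

Lemma measurable_slab_set l n c : measurable (slab_set l n c).
Proof.
rewrite -[X in measurable X]setTI; apply: (measurable_tnth l) => //.
exact: measurable_slab.
Qed.

Lemma ravg_slab i (l : 'I_N) n c k : (l < i)%N ->
  ravg i (\1_(slab_set l n c)) k <= n.+1%:R^-1.
Proof.
move=> li; have mS := measurable_slab_set l n c.
rewrite ravgE; last exact: measurable_indic.
(* In the first i variables the slab is a box with only one side that is not full. *)
pose E (l' : 'I_i) : set (measurableTypeR R) := if l' == Ordinal li then @slab R n c else setT.
have mE l' : measurable (E l') by rewrite /E; case: ifP => // _; exact: measurable_slab.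
rewrite (@eq_Rintegral _ _ _ _ _ (\1_[set x : point R i | forall l', E l' (tnth x l')])).
  have mB := measurable_box mE.
  rewrite /Rintegral integral_indic// setIT.
  rewrite [X in fine X <= _](@cube_box R i E mE) (bigD1 (Ordinal li))//= [in X in fine (_ * X)%E]big1.
    rewrite mule1 /E eqxx -lee_fin fineK ?lebesgue01_slab//.
    apply/fin_numPlt; rewrite (lt_le_trans _ (measure_ge0 _ _)) ?ltNyr//=.
    by apply: (le_lt_trans (lebesgue01_slab R n c)); rewrite ltry.
  by move=> l' l'l; rewrite /E (negbTE l'l) lebesgue01_setT.
move=> x _; rewrite !indicE; congr (nat_of_bool _)%:R; apply/idP/idP; rewrite !inE /=.
  rewrite /slab_set /= (tnth_replace_lt _ _ li) => h l'; rewrite /E.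
  by case: eqP => [->|].
move=> /(_ (Ordinal li)); rewrite /E eqxx /slab_set /=.
by rewrite (tnth_replace_lt _ _ li).
Qed.

(** Cauchy-Schwarz over the first i variables, with the indicator as one factor: the average of its
    square is at most 1/(n+1), and this is the source of all smallness on slabs. *)
Lemma Rintegral_ravg_slab i (l : 'I_N) n c (f : pt -> R) : (l < i)%N -> (i <= N)%N ->
  f \in Lfun (mu N) 2%:E ->
  \int[mu N]_k ravg i (fun k => \1_(slab_set l n c) k * f k) k ^+ 2 <=
  n.+1%:R^-1 * \int[mu N]_k f k ^+ 2.
Proof.
move=> li iN f2; have hb := @bounded_measurable_indic R N _ (measurable_slab_set l n c).
have h2 := bounded_measurable_Lfun2 hb.
have [rf2 _] := Lfun2_ravg iN (Lfun2M hb f2).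
have f2i := Lfun2_integrable_sqr f2; have rf2i := integrable_ravg iN f2i.
rewrite -(Rintegral_ravg iN f2i) -RintegralZl//.
have ge0 k : 0 <= ravg i (fun k => f k ^+ 2) k by apply: Rintegral_ge0 => x _; exact: sqr_ge0.
apply: ae_le_Rintegral.
- exact: Lfun2_integrable_sqr.
- exact: integrable_mulr.
- by move=> k; exact: sqr_ge0.
- by move=> k; rewrite mulr_ge0.
apply: filterS (ravg_sqr_le iN f2 h2) => k le; apply: (le_trans le).
rewrite ler_wpM2r// (_ : (fun k => _ ^+ 2) = \1_(slab_set l n c)); first exact: ravg_slab.
by apply/funext => k'; rewrite indicE; case: (_ \in _); rewrite ?expr1n ?expr0n.
Qed.

Lemma norm2_average_slab i (l : 'I_N) n c m (u : pt -> 'cV[R[i]]_m) :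
  (l < i)%N -> (i <= N)%N -> u \in @sqint R N m ->
  norm2 (average i (fun k => ((\1_(slab_set l n c) k)%:C)%C *: u k)) ^+ 2 <=
  n.+1%:R^-1 * norm2 u ^+ 2.
Proof.
move=> li iN u2; have hb := @bounded_measurable_indic R N _ (measurable_slab_set l n c).
have hu2 : (fun k => ((\1_(slab_set l n c) k)%:C)%C *: u k) \in @sqint R N m.
  apply/sqintP => r; under eq_fun do rewrite mxE.
  apply: sqintCM; last by have /sqintP := u2.
  by split => //; exact: bounded_measurable_cst.
rewrite !sqr_norm2E ?sqint_average// mulr_sumr; apply: ler_sum => r _.
have /sqintP/(_ r)[ur ui] := u2; rewrite mulrDr.
have Re_h k : complex.Re ((((\1_(slab_set l n c) k)%:C)%C *: u k) r ord0) =
    \1_(slab_set l n c) k * complex.Re (u k r ord0) by rewrite mxE ReM /= mul0r subr0.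
have Im_h k : complex.Im ((((\1_(slab_set l n c) k)%:C)%C *: u k) r ord0) =
    \1_(slab_set l n c) k * complex.Im (u k r ord0) by rewrite mxE ImM /= mul0r addr0.
have Rea k : complex.Re (average i (fun k => ((\1_(slab_set l n c) k)%:C)%C *: u k) k r ord0) =
    ravg i (fun k => \1_(slab_set l n c) k * complex.Re (u k r ord0)) k.
  by rewrite averageE /=; congr (ravg _ _ _); apply/funext => k'; exact: Re_h.
have Ima k : complex.Im (average i (fun k => ((\1_(slab_set l n c) k)%:C)%C *: u k) k r ord0) =
    ravg i (fun k => \1_(slab_set l n c) k * complex.Im (u k r ord0)) k.
  by rewrite averageE /=; congr (ravg _ _ _); apply/funext => k'; exact: Im_h.
under eq_Rintegral do rewrite Rea; under [X in _ + X]eq_Rintegral do rewrite Ima.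
by apply: lerD; exact: Rintegral_ravg_slab.
Qed.

(** The power of 2 comes from iterating |a + b|^2 <= 2 |a|^2 + 2 |b|^2; only the existence of a
    constant matters later. *)
Lemma normc_sum_sqr (I : Type) (s : seq I) (z : I -> R[i]) :
  Normc.normc (\sum_(i <- s) z i) ^+ 2 <=
  2 ^+ size s * \sum_(i <- s) Normc.normc (z i) ^+ 2.
Proof.
elim: s => [|i s IH]; first by rewrite !big_nil mulr0 Normc.normc0 expr0n.
have S0 : 0 <= \sum_(j <- s) Normc.normc (z j) ^+ 2.
  by apply: sumr_ge0 => j _; exact: sqr_ge0.
have z0 := sqr_ge0 (Normc.normc (z i)).
rewrite !big_cons /= [2 ^+ _.+1]exprS mulrDr; set S := \sum_(j <- s) z j in IH *.
have p1 : 1 <= 2 ^+ size s :> R by rewrite exprn_ege1// ler1n.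
have : Normc.normc (z i + S) ^+ 2 <= 2 * Normc.normc (z i) ^+ 2 + 2 * Normc.normc S ^+ 2.
  rewrite !normc_sqr; case: (z i) S {IH} => [a b] [c d] /=.
  rewrite -subr_ge0 (_ : _ - _ = (a - c) ^+ 2 + (b - d) ^+ 2); last by ring.
  by rewrite addr_ge0 ?sqr_ge0.
have h : Normc.normc (z i) ^+ 2 <= 2 ^+ size s * Normc.normc (z i) ^+ 2 by rewrite ler_peMl.
by move: (2 ^+ size s) h IH => P h IH H; lra.
Qed.

Lemma norm2_mulmx m p (A : pt -> 'M[R[i]]_(m, p)) : bounded_measurable_mx A ->
  exists2 K, 0 <= K & forall u, u \in @sqint R N p ->
    norm2 (fun k => A k *m u k) ^+ 2 <= K * norm2 u ^+ 2.
Proof.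
move=> Ab.
have /choice[K KP] : forall rc : 'I_m * 'I_p, exists K : R, 0 <= K /\ forall k, Normc.normc (A k rc.1 rc.2) ^+ 2 <= K.
  move=> [r c]; have [[_ [K K0 KP]] [_ [L L0 LP]]] := Ab r c.
  exists (K ^+ 2 + L ^+ 2); split; first by rewrite addr_ge0 ?sqr_ge0.
  move=> k; rewrite normc_sqr -[X in X ^+ 2 + _]/(complex.Re _) lerD//.
    by rewrite -[leLHS]ger0_norm ?sqr_ge0// normrX lerXn2r// nnegrE.
  by rewrite -[leLHS]ger0_norm ?sqr_ge0// normrX lerXn2r// nnegrE.
pose L := \sum_(rc : 'I_m * 'I_p) K rc.
have KL rc : K rc <= L.
  by rewrite /L (bigD1 rc)//= lerDl sumr_ge0// => rc' _; have [] := KP rc'.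
have L0 : 0 <= L by apply: sumr_ge0 => rc _; have [] := KP rc.
exists (m%:R * (2 ^+ p * L)) => [|u u2]; first by rewrite !mulr_ge0// exprn_ge0.
apply: sqr_norm2_le => //; first by rewrite !mulr_ge0// exprn_ge0.
  exact: sqint_mulmx.
apply: aeW => k; rewrite /sqnorm.
apply: (@le_trans _ _ (\sum_(r < m) (2 ^+ p * (L * sqnorm (u k))))); last first.
  by rewrite sumr_const card_ord -[leLHS]mulr_natl !mulrA.
apply: ler_sum => r _; rewrite mxE.
have := normc_sum_sqr (enum 'I_p) (fun c => A k r c * u k c ord0).
rewrite !big_enum size_enum_ord => /le_trans; apply.
rewrite ler_wpM2l ?exprn_ge0// mulr_sumr; apply: ler_sum => c _.
rewrite Normc.normcM exprMn ler_wpM2r ?sqr_ge0//.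
by have [_ h] := KP (r, c); exact: le_trans (h k) (KL _).
Qed.
End VectorFunctions.

(** * Operators *)

(* Keeps unification from unfolding integrals and filters. *)
#[local] Opaque average cavg continuous_on_cube.

Section Operators.
Variables (R : realType) (N M : nat).
Local Notation mu := (cube_measure R).
Local Notation pt := (point R N).
Local Notation op := (boundedOp R N M).
Local Notation vfun := (pt -> 'cV[R[i]]_M).
Implicit Types (F G : op).

(** The condition for T to descend to classes of functions modulo equality almost everywhere. *)
Definition ae_compatible (T : vfun -> vfun) := forall u v,
  u \in @sqint R N M -> v \in @sqint R N M ->
  {ae mu N, forall k, u k = v k} -> {ae mu N, forall k, T u k = T v k}.

Lemma L2_sqint (x : L2 R N M) : (x : vfun) \in @sqint R N M.
Proof. exact: valP (L2_fun x). Qed.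

Lemma acts_as_inj F G T : acts_as F T -> acts_as G T -> F = G.
Proof.
move=> FT GT; apply: boundedOp_eqP => x; apply/L2_eqP.
by apply: filterS2 (FT x) (GT x) => k -> ->.
Qed.

Lemma L2_linear_ae a (x y : L2 R N M) :
  {ae mu N, forall k, (a *: x + y : L2 R N M) k = a *: x k + y k}.
Proof.
have -> : a *: x + y = \pi_(L2 R N M)%qT (a *: (x : sqfun R N M) + (y : sqfun R N M)).
  by rewrite -[in LHS](reprK x) -[in LHS](reprK y) L2_linear_pi.
exact: L2_pi_ae.
Qed.

Lemma L2_add_ae (x y : L2 R N M) : {ae mu N, forall k, (x + y : L2 R N M) k = x k + y k}.
Proof.
have := L2_linear_ae 1 x y; rewrite scale1r; apply: filterS => k ->.
by rewrite scale1r.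
Qed.

(** The representative of the class 0 is an arbitrary choice; writing 0 as -0 + 0 and applying
    linearity almost everywhere shows that it vanishes almost everywhere. *)
Lemma L2_zero_ae : {ae mu N, forall k, (0 : L2 R N M) k = 0}.
Proof.
have := L2_linear_ae (-1) (0 : L2 R N M) 0; rewrite scaleN1r addNr.
by apply: filterS => k ->; rewrite scaleN1r addNr.
Qed.

Lemma acts_as_comp F G T T' : ae_compatible T -> acts_as F T -> acts_as G T' ->
  (forall x : L2 R N M, T' x \in @sqint R N M) ->
  acts_as (F * G) (fun u => T (T' u)).
Proof.
move=> Tc FT GT' T'2 x; apply: filterS2 (FT (G x)) (Tc _ _ (L2_sqint (G x)) (T'2 x) (GT' x)).
by move=> k <- <-.
Qed.

Lemma acts_as_linear a F G T T' : acts_as F T -> acts_as G T' ->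
  acts_as (a *: F + G) (fun u k => a *: T u k + T' u k).
Proof.
move=> FT GT' x; apply: filterS3 (L2_linear_ae a (F x) (G x)) (FT x) (GT' x).
by move=> k h1 h2 h3; rewrite -h2 -h3 -h1.
Qed.

Lemma acts_as_add F G T T' : acts_as F T -> acts_as G T' ->
  acts_as (F + G) (fun u k => T u k + T' u k).
Proof.
move=> FT GT' x; apply: filterS3 (L2_add_ae (F x) (G x)) (FT x) (GT' x).
by move=> k h1 h2 h3; rewrite -h2 -h3 -h1.
Qed.

Lemma acts_as_zero : acts_as (0 : op) (fun u k => 0).
Proof. by move=> x; apply: filterS L2_zero_ae => k. Qed.

Lemma acts_as_one : acts_as (1 : op) (fun u => u).
Proof. by move=> x; apply: aeW. Qed.

Lemma acts_as_sum (I : Type) (s : seq I) (F : I -> op) (T : I -> vfun -> vfun) :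
  (forall i, acts_as (F i) (T i)) ->
  acts_as (\sum_(i <- s) F i) (fun u k => \sum_(i <- s) T i u k).
Proof.
move=> FT; elim: s => [|i s IH] x.
  rewrite big_nil; apply: filterS (acts_as_zero x) => k ->.
  by rewrite big_nil.
rewrite big_cons; apply: filterS (acts_as_add (FT i) IH x) => k ->.
by rewrite big_cons.
Qed.

(** Turns a map of functions into an operator on classes by applying it to representatives. The
    bound is on squared norms, which are plain integrals, so the operator is bounded with the
    constant sqrt K. *)
Lemma acts_as_exists (T : vfun -> vfun) :
  (forall u, u \in @sqint R N M -> T u \in @sqint R N M) -> ae_compatible T ->
  (forall a u v, u \in @sqint R N M -> v \in @sqint R N M ->
    {ae mu N, forall k, T (fun k => a *: u k + v k) k = a *: T u k + T v k}) ->
  (exists2 K, 0 <= K & forall u, u \in @sqint R N M -> norm2 (T u) ^+ 2 <= K * norm2 u ^+ 2) ->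
  exists F : op, acts_as F T.
Proof.
move=> T2 Tc Tl [K K0 TK].
pose F0 (x : L2 R N M) : L2 R N M := \pi_(L2 R N M)%qT (Sqfun (T2 _ (L2_sqint x))).
have F0E x : {ae mu N, forall k, F0 x k = T x k} by exact: L2_pi_ae.
have F0b : F0 \in @bounded_operator R N M.
  apply/asboolP; split=> [a x y|].
    apply/L2_eqP.
    have axy : (fun k => a *: (x : L2 R N M) k + (y : L2 R N M) k) \in @sqint R N M.
      exact: (valP (a *: ((x : L2 R N M) : sqfun R N M) + ((y : L2 R N M) : sqfun R N M))).
    have h1 := Tc _ _ (L2_sqint (a *: x + y)) axy (L2_linear_ae a x y).
    have h2 := Tl a _ _ (L2_sqint x) (L2_sqint y).
    have h3 := F0E (a *: x + y).
    apply: filterS3 (filterI (filterI h1 h2) h3) (L2_linear_ae a (F0 x) (F0 y))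
      (filterI (F0E x) (F0E y)).
    by move=> k [[e1 e2] e3] e4 [e5 e6]; rewrite e3 e1 e2 e4 e5 e6.
  exists (Num.sqrt K) => x; rewrite /F0 (norm2_ae (L2_pi_ae _)) /=.
  rewrite -ler_sqr ?nnegrE ?norm2_ge0 ?mulr_ge0 ?sqrtr_ge0 ?norm2_ge0//.
  by rewrite exprMn (sqr_sqrtr K0); exact: (TK _ (L2_sqint x)).
by exists (BoundedOp F0b).
Qed.

Section MulAvg.
Variables (j m : nat) (A : pt -> 'M[R[i]]_(M, m)) (B : pt -> 'M[R[i]]_(m, M)).
Hypotheses (jN : (j <= N)%N) (Ab : bounded_measurable_mx A) (Bb : bounded_measurable_mx B).

Lemma sqint_mul_avg u : u \in @sqint R N M -> mul_avg_op j A B u \in @sqint R N M.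
Proof. by move=> u2; apply: sqint_mulmx => //; apply: sqint_average => //; exact: sqint_mulmx. Qed.

Lemma ae_compatible_mul_avg : ae_compatible (mul_avg_op j A B).
Proof.
move=> u v u2 v2 uv.
have := average_ae jN (sqint_mulmx Bb u2) (sqint_mulmx Bb v2).
move=> /(_ _)/filterS; apply; last by apply: filterS uv => k ->.
by move=> k; rewrite /mul_avg_op => ->.
Qed.

Lemma mul_avg_exists : exists F : op, acts_as F (mul_avg_op j A B).
Proof.
apply: acts_as_exists.
- exact: sqint_mul_avg.
- exact: ae_compatible_mul_avg.
- move=> a u v u2 v2.
  have Bu := sqint_mulmx Bb u2; have Bv := sqint_mulmx Bb v2.
  apply: filterS2 (ae_sections jN Bu) (ae_sections jN Bv) => k ui vi.
  rewrite /mul_avg_op (@average_linear _ _ _ _ _ a%:M _ _ _ k Bu Bv ui vi).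
    by rewrite mulmxDr mul_scalar_mx -scalemxAr.
  by move=> x xc; rewrite mul_scalar_mx mulmxDr -scalemxAr.
have [K K0 KP] := norm2_mulmx Ab; have [L L0 LP] := norm2_mulmx Bb.
exists (K * L); first exact: mulr_ge0.
move=> u u2; have Bu := sqint_mulmx Bb u2.
apply: (le_trans (KP _ (sqint_average jN Bu))).
rewrite -mulrA ler_wpM2l//; apply: (le_trans (norm2_average jN Bu)).
exact: LP.
Qed.
End MulAvg.
Arguments sqint_mul_avg {j m A B}.
Arguments ae_compatible_mul_avg {j m A B}.

(** For j <= i, an inner average <.>_j is inserted under <.>_i (e1). Then <B' u>_j leaves it, which
    averages B A' to <B A'>_j (e2); this factor is moved inside the average of B' u (e3), and the
    inner average is dropped (e4). *)
Lemma acts_as_mul_avg_ge i j m p (A : pt -> 'M[R[i]]_(M, m)) (B : pt -> 'M[R[i]]_(m, M))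
    (A' : pt -> 'M[R[i]]_(M, p)) (B' : pt -> 'M[R[i]]_(p, M)) F G :
  bounded_measurable_mx A -> bounded_measurable_mx B ->
  bounded_measurable_mx A' -> bounded_measurable_mx B' ->
  (j <= i)%N -> (i <= N)%N ->
  acts_as F (mul_avg_op i A B) -> acts_as G (mul_avg_op j A' B') ->
  acts_as (F * G) (mul_avg_op i A (fun k => avg_mx j (fun k => B k *m A' k) k *m B' k)).
Proof.
move=> Ab Bb Ab' Bb' ji iN FT GT x.
have jN := leq_trans ji iN.
have x2 := L2_sqint x; have B'x := sqint_mulmx Bb' x2.
have BA'b := bounded_measurable_mulmx Bb Ab'.
have Qb := bounded_measurable_avg_mx jN BA'b.
have w2 := sqint_average jN B'x.
have fg := acts_as_comp (ae_compatible_mul_avg iN Bb) FT GT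
  (fun x => sqint_mul_avg jN Ab' Bb' _ (L2_sqint x)).
have e1 := average_average ji iN (sqint_mulmx BA'b w2).
have e2 : {ae mu N, forall k, average i (average j (fun k => (B k *m A' k) *m average j (fun k => B' k *m x k) k)) k
    = average i (fun k => avg_mx j (fun k => B k *m A' k) k *m average j (fun k => B' k *m x k) k) k}.
  apply: average_ae => //; [exact: sqint_average (sqint_mulmx _ _)|exact: sqint_mulmx|].
  by apply: aeW => k; apply: (average_mulr BA'b) => y _; exact: average_invariant.
have e3 : {ae mu N, forall k, average i (fun k => avg_mx j (fun k => B k *m A' k) k *m average j (fun k => B' k *m x k) k) k
    = average i (average j (fun k => avg_mx j (fun k => B k *m A' k) k *m (B' k *m x k))) k}.
  apply: average_ae => //; [exact: sqint_mulmx|by apply: sqint_average => //; exact: sqint_mulmx|].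
  have := @average_mull R N j _ _ (avg_mx j (fun k => B k *m A' k)) _ jN B'x.
  move=> /(_ _)/filterS; apply=> [k ->//|k _ y _]; exact: avg_mx_invariant.
have e4 := average_average ji iN (sqint_mulmx Qb B'x).
apply: filterS3 (filterI (fg x) e1) (filterI e2 e3) e4 => k [e0 {}e1] [{}e2 {}e3] {}e4.
rewrite e0 /mul_avg_op; congr (_ *m _).
under eq_fun do rewrite mulmxA.
rewrite -e1 e2 e3 e4; apply: eq_average => y _.
by rewrite mulmxA.
Qed.

(** For i <= j, the vector <B' u>_j does not depend on the first i variables and leaves the average
    <.>_i at every point. *)
Lemma acts_as_mul_avg_le i j m p (A : pt -> 'M[R[i]]_(M, m)) (B : pt -> 'M[R[i]]_(m, M))
    (A' : pt -> 'M[R[i]]_(M, p)) (B' : pt -> 'M[R[i]]_(p, M)) F G :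
  bounded_measurable_mx A -> bounded_measurable_mx B ->
  bounded_measurable_mx A' -> bounded_measurable_mx B' ->
  (i <= j)%N -> (j <= N)%N ->
  acts_as F (mul_avg_op i A B) -> acts_as G (mul_avg_op j A' B') ->
  acts_as (F * G) (mul_avg_op j (fun k => A k *m avg_mx i (fun k => B k *m A' k) k) B').
Proof.
move=> Ab Bb Ab' Bb' ij jN FT GT x.
have iN := leq_trans ij jN.
have fg := acts_as_comp (ae_compatible_mul_avg iN Bb) FT GT
  (fun x => sqint_mul_avg jN Ab' Bb' _ (L2_sqint x)).
apply: filterS (fg x) => k ->; rewrite /mul_avg_op -mulmxA; congr (_ *m _).
under eq_fun do rewrite mulmxA.
apply: (average_mulr (bounded_measurable_mulmx Bb Ab')) => y _.
exact: average_invariant.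
Qed.
End Operators.

(** * Continuous matrix coefficients *)

Section ContinuousMatrices.
Variables (R : realType) (N : nat).
Local Notation mu := (cube_measure R).
Local Notation pt := (point R N).

(** A coefficient that is continuous on the cube may fail to be measurable outside. Its extension by
    zero is bounded and measurable on the whole space and, by [acts_as_crestrict], gives the same
    operators. *)
Definition crestrict m n (A : pt -> 'M[R[i]]_(m, n)) (k : pt) : 'M[R[i]]_(m, n) :=
  if k \in @cube R N then A k else 0.

Lemma crestrictE m n (A : pt -> 'M[R[i]]_(m, n)) k : cube k -> crestrict A k = A k.
Proof. by move=> kc; rewrite /crestrict mem_set. Qed.

Lemma bounded_measurable_crestrict m n (A : pt -> 'M[R[i]]_(m, n)) :
  continuous_on_cube A -> bounded_measurable_mx (crestrict A).
Proof.
move=> /continuous_on_cubeP Ac i j.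
have /continuous_cube_complexP[Ar Ai] := Ac i j.
split.
  rewrite (_ : (fun k => _) = (fun k => complex.Re (A k i j)) \_ (@cube R N)).
    exact: continuous_cube_restrict.
  by apply/funext => k; rewrite patchE /crestrict; case: ifP => //; rewrite mxE.
rewrite (_ : (fun k => _) = (fun k => complex.Im (A k i j)) \_ (@cube R N)).
  exact: continuous_cube_restrict.
by apply/funext => k; rewrite patchE /crestrict; case: ifP => //; rewrite mxE.
Qed.

Lemma continuous_mulmx m n p (A : pt -> 'M[R[i]]_(m, n)) (B : pt -> 'M[R[i]]_(n, p)) :
  continuous_on_cube A -> continuous_on_cube B -> continuous_on_cube (fun k => A k *m B k).
Proof.
move=> /continuous_on_cubeP Ac /continuous_on_cubeP Bc; apply/continuous_on_cubeP => i j.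
apply: (@continuous_cube_eq _ _ _ (fun k => \sum_c A k i c * B k c j : R[i]^o)).
  by move=> k _; rewrite mxE.
by apply: continuous_cube_sum => c _; exact: (@continuous_cubeM _ _ R[i]).
Qed.

Lemma continuous_addmx m n (A B : pt -> 'M[R[i]]_(m, n)) :
  continuous_on_cube A -> continuous_on_cube B -> continuous_on_cube (fun k => A k + B k).
Proof.
move=> /continuous_on_cubeP Ac /continuous_on_cubeP Bc; apply/continuous_on_cubeP => i j.
apply: (@continuous_cube_eq _ _ _ (fun k => A k i j + B k i j : R[i]^o)).
  by move=> k _; rewrite mxE.
exact: (@continuous_cubeD _ _ R[i]).
Qed.

Lemma continuous_cst_mx m n (A : 'M[R[i]]_(m, n)) : continuous_on_cube (fun _ : pt => A).
Proof. by apply/continuous_on_cubeP => i j; exact: (@continuous_cube_cst _ _ R[i]). Qed.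

Lemma continuous_scalemx m n (a : R[i]) (A : pt -> 'M[R[i]]_(m, n)) :
  continuous_on_cube A -> continuous_on_cube (fun k => a *: A k).
Proof.
move=> /continuous_on_cubeP Ac; apply/continuous_on_cubeP => i j.
apply: (@continuous_cube_eq _ _ _ (fun k => a * A k i j : R[i]^o)).
  by move=> k _; rewrite mxE.
by apply: (@continuous_cubeM _ _ R[i]); first exact: (@continuous_cube_cst _ _ R[i]).
Qed.

Lemma continuous_row_mx m n p (A : pt -> 'M[R[i]]_(m, n)) (B : pt -> 'M[R[i]]_(m, p)) :
  continuous_on_cube A -> continuous_on_cube B ->
  continuous_on_cube (fun k => row_mx (A k) (B k)).
Proof.
move=> /continuous_on_cubeP Ac /continuous_on_cubeP Bc; apply/continuous_on_cubeP => i j.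
case: (split_ordP j) => l ->.
  by apply: continuous_cube_eq (Ac i l) => k _; rewrite row_mxEl.
by apply: continuous_cube_eq (Bc i l) => k _; rewrite row_mxEr.
Qed.

Lemma continuous_col_mx m n p (A : pt -> 'M[R[i]]_(m, p)) (B : pt -> 'M[R[i]]_(n, p)) :
  continuous_on_cube A -> continuous_on_cube B ->
  continuous_on_cube (fun k => col_mx (A k) (B k)).
Proof.
move=> /continuous_on_cubeP Ac /continuous_on_cubeP Bc; apply/continuous_on_cubeP => i j.
case: (split_ordP i) => l ->.
  by apply: continuous_cube_eq (Ac l j) => k _; rewrite col_mxEu.
by apply: continuous_cube_eq (Bc l j) => k _; rewrite col_mxEd.
Qed.

Lemma continuous_avg_mx j m n (A : pt -> 'M[R[i]]_(m, n)) :
  continuous_on_cube A -> continuous_on_cube (avg_mx j A).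
Proof.
move=> /continuous_on_cubeP Ac; apply/continuous_on_cubeP => r c.
have /continuous_cube_complexP[Ar Ai] := Ac r c.
apply/continuous_cube_complexP; split.
  apply: (@continuous_cube_eq _ _ _ (ravg j (fun k => complex.Re (A k r c)))).
    by move=> k _; rewrite mxE.
  exact: continuous_cube_ravg.
apply: (@continuous_cube_eq _ _ _ (ravg j (fun k => complex.Im (A k r c)))).
  by move=> k _; rewrite mxE.
exact: continuous_cube_ravg.
Qed.

Lemma continuous_det n (A : pt -> 'M[R[i]]_n) : continuous_on_cube A ->
  continuous_cube (fun k => \det (A k) : R[i]^o).
Proof.
move=> /continuous_on_cubeP Ac; rewrite /determinant.
apply: continuous_cube_sum => s _; apply: (@continuous_cubeM _ _ R[i]).
  exact: (@continuous_cube_cst _ _ R[i]).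
by apply: (@continuous_cube_prod _ _ R[i]) => i _; exact: Ac.
Qed.

(** Cramer's formula: cofactors are polynomials in the entries, and the determinant has no zero on
    the cube. *)
Lemma continuous_invmx n (A : pt -> 'M[R[i]]_n) : continuous_on_cube A ->
  (forall k, cube k -> A k \in unitmx) -> continuous_on_cube (fun k => invmx (A k)).
Proof.
move=> Ac Au; apply/continuous_on_cubeP => i j.
apply: (@continuous_cube_eq _ _ _
   (fun k => (\det (A k))^-1 * ((-1) ^+ (j + i) * \det (row' j (col' i (A k)))) : R[i]^o)).
  by move=> k kc; rewrite /invmx Au// !mxE.
apply: (@continuous_cubeM _ _ R[i]).
  apply: (@continuous_cubeV _ _ R[i]); first exact: continuous_det.
  by move=> k kc; have := Au k kc; rewrite unitmxE unitfE.
apply: (@continuous_cubeM _ _ R[i]); first exact: (@continuous_cube_cst _ _ R[i]).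
apply: continuous_det; apply/continuous_on_cubeP => r c.
have /continuous_on_cubeP := Ac => /(_ (lift j r) (lift i c)).
by apply: continuous_cube_eq => k _; rewrite !mxE.
Qed.

Lemma eq_avg_mx j m n (A B : pt -> 'M[R[i]]_(m, n)) k :
  (forall x : point R j, cube x -> A (replace_first x k) = B (replace_first x k)) ->
  avg_mx j A k = avg_mx j B k.
Proof.
move=> AB; apply/matrixP => r c; rewrite !mxE.
by congr Complex; apply: eq_Rintegral => x; rewrite inE => xc; rewrite AB.
Qed.

Lemma col_avg_mx j m n (A : pt -> 'M[R[i]]_(m, n)) k c :
  col c (avg_mx j A k) = average j (fun k => col c (A k)) k.
Proof.
apply/colP => r; rewrite averageE !mxE.
by rewrite (_ : (fun k0 => col c (A k0) r ord0) = (fun k0 => A k0 r c))//; apply/funext => l; rewrite mxE.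
Qed.

(** Column by column this is [average_mulr], with Q extended by zero. *)
Lemma avg_mx_mulr j m n p (Q : pt -> 'M[R[i]]_(m, n)) (D : pt -> 'M[R[i]]_(n, p)) k :
  continuous_on_cube Q -> cube k ->
  (forall x : point R j, cube x -> D (replace_first x k) = D k) ->
  avg_mx j (fun k => Q k *m D k) k = avg_mx j Q k *m D k.
Proof.
move=> Qc kc DE.
rewrite (@eq_avg_mx j _ _ _ (fun k => crestrict Q k *m D k)); last first.
  by move=> x xc; rewrite crestrictE//; exact: cube_replace.
rewrite (@eq_avg_mx j _ _ Q (crestrict Q)); last first.
  by move=> x xc; rewrite crestrictE//; exact: cube_replace.
apply/matrixP => r c.
have -> : forall A : 'M[R[i]]_(m, p), A r c = (col c A) r ord0 by move=> A; rewrite mxE.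
rewrite col_avg_mx; rewrite -[X in _ = X]/((fun B : 'M[R[i]]_(m, p) => B r c) _).
rewrite (_ : (fun k => col c (crestrict Q k *m D k)) = (fun k => crestrict Q k *m col c (D k))).
  rewrite average_mulr; last 2 first.
  - exact: bounded_measurable_crestrict.
  - by move=> x xc; rewrite DE.
  rewrite [LHS]mxE [RHS]mxE; apply: eq_bigr => d _.
  by rewrite [col c _ d _]mxE.
by apply/funext => l; rewrite !colE mulmxA.
Qed.
End ContinuousMatrices.

#[local] Opaque bounded_measurable_mx avg_mx.

(** * The operators A<B.>_j *)

Section Separable.
Variables (R : realType) (N M : nat).
Local Notation mu := (cube_measure R).
Local Notation pt := (point R N).
Local Notation op := (boundedOp R N M).
Local Notation vfun := (pt -> 'cV[R[i]]_M).
Implicit Types (F G : op).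

Lemma eq_mul_avg j m (A A' : pt -> 'M[R[i]]_(M, m)) (B B' : pt -> 'M[R[i]]_(m, M)) (u : vfun) k :
  (forall k, cube k -> A k = A' k) -> (forall k, cube k -> B k = B' k) -> cube k ->
  mul_avg_op j A B u k = mul_avg_op j A' B' u k.
Proof.
move=> AA BB kc; rewrite /mul_avg_op (AA _ kc).
rewrite (@eq_average _ _ j _ _ (fun k => B' k *m u k))// => x xc.
by rewrite (BB _ (cube_replace xc kc)).
Qed.

Lemma acts_as_eq F (T T' : vfun -> vfun) :
  (forall u k, cube k -> T u k = T' u k) -> acts_as F T -> acts_as F T'.
Proof.
by move=> TT' FT x; apply: filterS2 (FT x) (@ae_cube R N) => k -> /TT' ->.
Qed.

Lemma acts_as_crestrict F j m (A : pt -> 'M[R[i]]_(M, m)) (B : pt -> 'M[R[i]]_(m, M)) :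
  acts_as F (mul_avg_op j A B) <-> acts_as F (mul_avg_op j (crestrict A) (crestrict B)).
Proof.
by split; apply: acts_as_eq => u k kc; apply: eq_mul_avg => // l lc; rewrite crestrictE.
Qed.

Lemma separable_exists j m (A : pt -> 'M[R[i]]_(M, m)) (B : pt -> 'M[R[i]]_(m, M)) :
  (j <= N)%N -> continuous_on_cube A -> continuous_on_cube B ->
  exists F : op, acts_as F (mul_avg_op j A B).
Proof.
move=> jN Ac Bc.
have [F FT] := mul_avg_exists jN (bounded_measurable_crestrict Ac) (bounded_measurable_crestrict Bc).
by exists F; apply/acts_as_crestrict.
Qed.

Lemma separable_mul_ge i j m p (A : pt -> 'M[R[i]]_(M, m)) (B : pt -> 'M[R[i]]_(m, M))
    (A' : pt -> 'M[R[i]]_(M, p)) (B' : pt -> 'M[R[i]]_(p, M)) F G :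
  continuous_on_cube A -> continuous_on_cube B ->
  continuous_on_cube A' -> continuous_on_cube B' ->
  (j <= i)%N -> (i <= N)%N ->
  acts_as F (mul_avg_op i A B) -> acts_as G (mul_avg_op j A' B') ->
  acts_as (F * G) (mul_avg_op i A (fun k => avg_mx j (fun k => B k *m A' k) k *m B' k)).
Proof.
move=> Ac Bc Ac' Bc' ji iN /acts_as_crestrict FT /acts_as_crestrict GT.
have := acts_as_mul_avg_ge (bounded_measurable_crestrict Ac) (bounded_measurable_crestrict Bc)
  (bounded_measurable_crestrict Ac') (bounded_measurable_crestrict Bc') ji iN FT GT.
apply: acts_as_eq => u k kc; apply: eq_mul_avg => // l lc; rewrite crestrictE//.
congr (_ *m _); apply: eq_avg_mx => x xc; have h := cube_replace xc lc.
by rewrite !crestrictE.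
Qed.

Lemma separable_mul_le i j m p (A : pt -> 'M[R[i]]_(M, m)) (B : pt -> 'M[R[i]]_(m, M))
    (A' : pt -> 'M[R[i]]_(M, p)) (B' : pt -> 'M[R[i]]_(p, M)) F G :
  continuous_on_cube A -> continuous_on_cube B ->
  continuous_on_cube A' -> continuous_on_cube B' ->
  (i <= j)%N -> (j <= N)%N ->
  acts_as F (mul_avg_op i A B) -> acts_as G (mul_avg_op j A' B') ->
  acts_as (F * G) (mul_avg_op j (fun k => A k *m avg_mx i (fun k => B k *m A' k) k) B').
Proof.
move=> Ac Bc Ac' Bc' ij jN /acts_as_crestrict FT /acts_as_crestrict GT.
have := acts_as_mul_avg_le (bounded_measurable_crestrict Ac) (bounded_measurable_crestrict Bc)
  (bounded_measurable_crestrict Ac') (bounded_measurable_crestrict Bc') ij jN FT GT.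
apply: acts_as_eq => u k kc; apply: eq_mul_avg => // l lc; rewrite crestrictE//.
congr (_ *m _); apply: eq_avg_mx => x xc; have h := cube_replace xc lc.
by rewrite !crestrictE.
Qed.

(* For j = 0 the average is the identity, so that [separable 0] is H_0. *)
Definition separable j : set op :=
  [set F | exists m (A : pt -> 'M[R[i]]_(M, m)) (B : pt -> 'M[R[i]]_(m, M)),
    [/\ (0 < m)%N, continuous_on_cube A, continuous_on_cube B
      & acts_as F (mul_avg_op j A B)]].

Lemma calHjE j : (0 < M)%N -> calHj R N M j = separable j.
Proof.
move=> M0; case: j => [|j] //; apply/seteqP; split=> F.
  move=> [A Ac FA]; exists M, A, (fun=> 1%:M).
  split; [exact: M0|exact: Ac|exact: continuous_cst_mx|].
  apply: acts_as_eq FA => u k _; rewrite /mul_op /mul_avg_op average0 mul1mx//.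
move=> [m [A [B [m0 Ac Bc FT]]]]; exists (fun k => A k *m B k).
  exact: continuous_mulmx.
by apply: acts_as_eq FT => u k _; rewrite /mul_op /mul_avg_op average0 mulmxA.
Qed.

Lemma separable_mul i j F G : (i <= N)%N -> (j <= N)%N ->
  separable i F -> separable j G -> separable (maxn i j) (F * G).
Proof.
move=> iN jN [m [A [B [m0 Ac Bc FT]]]] [p [A' [B' [p0 Ac' Bc' GT]]]].
have BA := continuous_mulmx Bc Ac'.
have [ji|/ltnW ij] := leqP j i.
  exists m, A, (fun k => avg_mx j (fun k => B k *m A' k) k *m B' k).
  split; [exact: m0|exact: Ac| |exact: separable_mul_ge Ac Bc Ac' Bc' ji iN FT GT].
  by apply: continuous_mulmx; [exact: continuous_avg_mx|exact: Bc'].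
exists p, (fun k => A k *m avg_mx i (fun k => B k *m A' k) k), B'.
split; [exact: p0| |exact: Bc'|exact: separable_mul_le Ac Bc Ac' Bc' ij jN FT GT].
by apply: continuous_mulmx; [exact: Ac|exact: continuous_avg_mx].
Qed.

(** Block matrices: the row (a A, A') and the column (B, B') turn the sum into one operator with
    inner size m + p. This is why H_j allows every inner size. *)
Lemma separable_linear j (a : R[i]) F G :
  separable j F -> separable j G -> separable j (a *: F + G).
Proof.
move=> [m [A [B [m0 Ac Bc FT]]]] [p [A' [B' [p0 Ac' Bc' GT]]]].
exists (m + p)%N, (fun k => row_mx (a *: A k) (A' k)), (fun k => col_mx (B k) (B' k)).
split.
- by rewrite addn_gt0 m0.
- apply: (@continuous_row_mx R N M m p (fun k => a *: A k) A') Ac'.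
  exact: continuous_scalemx.
- exact: continuous_col_mx Bc Bc'.
apply: acts_as_eq (acts_as_linear a FT GT) => u k _; rewrite /mul_avg_op.
rewrite (_ : average j _ k = col_mx (average j (fun k => B k *m u k) k)
  (average j (fun k => B' k *m u k) k)).
  by rewrite mul_row_col -scalemxAl.
have cE (f : pt -> R[i]) (g : pt -> R[i]) : f =1 g -> cavg j f k = cavg j g k.
  by move=> /funext ->.
apply/colP => r; rewrite averageE; case: (split_ordP r) => l ->.
  by rewrite col_mxEu averageE; apply: cE => k'; rewrite mul_col_mx col_mxEu.
by rewrite col_mxEd averageE; apply: cE => k'; rewrite mul_col_mx col_mxEd.
Qed.

Lemma separable0 j : separable j 0.
Proof.
exists 1%N, (fun=> 0), (fun=> 0).
split; [by []|exact: continuous_cst_mx|exact: continuous_cst_mx|].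
by apply: acts_as_eq (@acts_as_zero R N M) => u k _; rewrite /mul_avg_op mul0mx.
Qed.

Lemma separableD j F G : separable j F -> separable j G -> separable j (F + G).
Proof. by move=> FH GH; rewrite -(scale1r F); exact: separable_linear. Qed.

Lemma separableN j F : separable j F -> separable j (- F).
Proof.
by move=> FH; rewrite -(addr0 (- F)) -scaleN1r; apply: separable_linear => //; exact: separable0.
Qed.

Lemma separable_cst (a : R[i]) : (0 < M)%N -> separable 0 (a *: (1 : op)).
Proof.
move=> M0; exists M, (fun=> a%:M), (fun=> 1%:M).
split; [exact: M0|exact: continuous_cst_mx|exact: continuous_cst_mx|].
have := acts_as_linear a (@acts_as_one R N M) (@acts_as_zero R N M); rewrite addr0.
apply: acts_as_eq => u k _; rewrite /mul_avg_op average0 mul1mx mul_scalar_mx addr0//.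
Qed.

(** The generator <.>_j averages vectors of size M, whereas the inner size m is arbitrary. Inserting
    1 = sum of e_c e_c^T between A and the average splits A<B.>_j into m products X_c E Y_c: E is
    the average, and X_c and Y_c are multiplications by M x M matrices that route the c-th component
    through the coordinate i0. *)
Lemma separable_calH j : (0 < M)%N -> (j <= N)%N -> separable j `<=` calH R N M.
Proof.
move=> M0 jN F FH S [[S0 Slin Smul] gS].
have [j0|j0] := posnP j.
  by apply: gS; left; move: FH; rewrite j0 -calHjE.
have [m [A [B [m0 Ac Bc FT]]]] := FH.
pose i0 := Ordinal M0.
have Ab := bounded_measurable_crestrict Ac; have Bb := bounded_measurable_crestrict Bc.
pose Ac_ (c : 'I_m) k := crestrict A k *m delta_mx c i0.
pose Bc_ (c : 'I_m) k := delta_mx i0 c *m crestrict B k.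
have one_b : bounded_measurable_mx (fun _ : pt => 1%:M : 'M[R[i]]_M).
  exact: bounded_measurable_cst_mx.
have Acb c : bounded_measurable_mx (Ac_ c).
  by apply: bounded_measurable_mulmx => //; exact: bounded_measurable_cst_mx.
have Bcb c : bounded_measurable_mx (Bc_ c).
  by apply: bounded_measurable_mulmx => //; exact: bounded_measurable_cst_mx.
have [E ET] := mul_avg_exists jN one_b one_b.
have /choice[X XT] : forall c, exists X : op, acts_as X (mul_avg_op 0 (Ac_ c) (fun=> 1%:M)).
  by move=> c; exact: mul_avg_exists.
have /choice[Y YT] : forall c, exists Y : op, acts_as Y (mul_avg_op 0 (Bc_ c) (fun=> 1%:M)).
  by move=> c; exact: mul_avg_exists.
have XEY c : acts_as (X c * (E * Y c)) (mul_avg_op j (Ac_ c) (Bc_ c)).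
  have EY := acts_as_mul_avg_ge one_b one_b (Bcb c) one_b (leq0n j) jN ET (YT c).
  rewrite (_ : (fun k => _ *m _) = Bc_ c) in EY; last first.
    by apply/funext => k; rewrite avg_mx0 mul1mx mulmx1.
  have := acts_as_mul_avg_le (Acb c) one_b one_b (Bcb c) (leq0n j) jN (XT c) EY.
  rewrite (_ : (fun k => _ *m avg_mx _ _ _) = Ac_ c)//.
  by apply/funext => k; rewrite avg_mx0 mul1mx mulmx1.
have -> : F = \sum_(c < m) X c * (E * Y c).
  have /acts_as_crestrict FT' := FT.
  apply: (acts_as_inj FT') => x.
  have := acts_as_sum (index_enum _) XEY x.
  have x2 := L2_sqint x; have Bx := sqint_mulmx Bb x2.
  have h : {ae mu N, forall k, forall c : 'I_m, average j (fun k => Bc_ c k *m x k) k =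
       (delta_mx i0 c : 'M[R[i]]_(M, m)) *m average j (fun k => crestrict B k *m x k) k}.
    apply: ae_all => c.
    have := @average_mull R N j _ _ (fun=> (delta_mx i0 c : 'M[R[i]]_(M, m))) _ jN Bx.
    move=> /(_ _)/filterS; apply => // k <-.
    by congr (average _ _ _); apply/funext => l; rewrite /Bc_ mulmxA.
  apply: filterS2 h => k hk ->; rewrite /mul_avg_op.
  rewrite -[in RHS](mul1mx (average j (fun k => crestrict B k *m x k) k)) mx1_sum_delta.
  rewrite mulmx_suml mulmx_sumr; apply: eq_bigr => c _.
  by rewrite hk /Ac_ !mulmxA -[in LHS](mulmxA (crestrict A k)) mul_delta_mx.
have S1 : S 1.
  apply: gS; left; exists (fun=> 1%:M); first exact: continuous_cst_mx.
  by apply: acts_as_eq (@acts_as_one R N M) => u k _; rewrite /mul_op mul1mx.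
apply: big_ind => // [F1 F2 h1 h2|c _]; first by rewrite -(scale1r F1); exact: Slin.
apply: (Smul).
  apply: gS; left; exists (fun k => A k *m delta_mx c i0).
    by apply: continuous_mulmx; [exact: Ac|exact: continuous_cst_mx].
  apply: acts_as_eq (XT c) => u k kc.
  by rewrite /mul_avg_op /mul_op average0 mul1mx /Ac_ crestrictE.
apply: (Smul).
  apply: gS; right; exists j; first by rewrite j0.
  apply: acts_as_eq ET => u k _; rewrite /mul_avg_op mul1mx.
  by congr (average _ _ _); apply/funext => l; rewrite mul1mx.
apply: gS; left; exists (fun k => delta_mx i0 c *m B k).
  by apply: continuous_mulmx; [exact: continuous_cst_mx|exact: Bc].
apply: acts_as_eq (YT c) => u k kc.
by rewrite /mul_avg_op /mul_op average0 mul1mx /Bc_ crestrictE.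
Qed.
End Separable.

(** * Localization in slabs *)

Section Slabs.
Variables (R : realType) (N M : nat).
Local Notation mu := (cube_measure R).
Local Notation pt := (point R N).
Local Notation op := (boundedOp R N M).
Implicit Types (F G S T : op) (x y : L2 R N M).

Definition slab_indicator (l : 'I_N) n c (k : pt) : R[i] := ((\1_(slab_set l n c) k)%:C)%C.

Lemma bounded_measurable_slab m l n c :
  bounded_measurable_mx (fun k => (slab_indicator l n c k)%:M : 'M[R[i]]_m).
Proof.
have hb := @bounded_measurable_indic R N _ (measurable_slab_set l n c).
apply: bounded_measurable_scalar_mx.
by split => //; exact: bounded_measurable_cst.
Qed.

Lemma slab_op_exists l n c : exists P : op,
  acts_as P (mul_avg_op 0 (fun k => (slab_indicator l n c k)%:M) (fun=> 1%:M)).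
Proof.
apply: mul_avg_exists => //; first exact: bounded_measurable_slab.
exact: bounded_measurable_cst_mx.
Qed.

Definition slab_op l n c : op := projT1 (cid (slab_op_exists l n c)).

Lemma slab_opP l n c :
  acts_as (slab_op l n c) (mul_avg_op 0 (fun k => (slab_indicator l n c k)%:M) (fun=> 1%:M)).
Proof. exact: projT2 (cid (slab_op_exists l n c)). Qed.

Lemma slab_opE l n c :
  acts_as (slab_op l n c) (fun u k => slab_indicator l n c k *: u k).
Proof.
apply: acts_as_eq (slab_opP l n c) => u k _.
by rewrite /mul_avg_op average0 mul1mx mul_scalar_mx.
Qed.

Lemma slab_op_idem l n c : slab_op l n c * slab_op l n c = slab_op l n c.
Proof.
apply: boundedOp_eqP => x; apply/L2_eqP.
apply: filterS2 (slab_opE l n c (slab_op l n c x)) (slab_opE l n c x) => k e1 e2.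
rewrite [LHS]e1 e2 scalerA; congr (_ *: _).
by rewrite /slab_indicator indicE; case: (_ \in _); rewrite ?mulr1 ?mulr0.
Qed.

(** Indices start at 0: coordinate l is the variable k_(l+1), and <.>_i integrates it exactly when l
    < i. For i <= l the indicator is constant along the sections and leaves the average. *)
Lemma separable_slab_comm i F (l : 'I_N) n c : (i <= l)%N -> separable i F ->
  F * slab_op l n c = slab_op l n c * F.
Proof.
move=> il [m [A [B [_ Ac Bc /acts_as_crestrict FT]]]].
have iN : (i <= N)%N by rewrite (leq_trans il)// ltnW.
have Ab := bounded_measurable_crestrict Ac; have Bb := bounded_measurable_crestrict Bc.
have hb := @bounded_measurable_slab M l n c.
apply: boundedOp_eqP => x; apply/L2_eqP.
have Bx := sqint_mulmx Bb (L2_sqint x).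
have Px2 := sqint_mulmx hb (L2_sqint x).
have e1 := ae_compatible_mul_avg (crestrict A) iN Bb (L2_sqint (slab_op l n c x)) Px2 _.
have {}e1 := e1 _; apply: filterS3 (filterI (FT (slab_op l n c x)) (e1 _))
  (filterI (slab_opE l n c (F x)) (FT x))
  (@average_mull R N i _ _ (fun k => (slab_indicator l n c k)%:M) _ iN Bx _).
- move=> k [h1 h2] [h3 h4] h5; rewrite [LHS]h1 h2 [RHS]h3 h4 /mul_avg_op.
  rewrite -mul_scalar_mx mulmxA -scalar_mxC -mulmxA -h5; congr (_ *m _).
  congr (average _ _ _); apply/funext => k'.
  by rewrite !mulmxA scalar_mxC.
- apply: filterS (slab_opE l n c x) => k ->; by rewrite mul_scalar_mx.
- move=> k _ y _; rewrite /slab_indicator !indicE; congr ((_%:R)%:C%C)%:M.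
  congr nat_of_bool; apply/idP/idP; rewrite !inE /slab_set /=; by rewrite tnth_replace_ge.
Qed.

Lemma norm2_eq_ae m (u v : pt -> 'cV[R[i]]_m) : u \in @sqint R N m -> v \in @sqint R N m ->
  {ae mu N, forall k, u k = v k} -> norm2 u = norm2 v.
Proof. by move=> u2 v2; exact: (@norm2_ae _ _ _ (Sqfun u2) (Sqfun v2)). Qed.

Lemma acts_as_norm2 F (U : (pt -> 'cV[R[i]]_M) -> pt -> 'cV[R[i]]_M) x :
  acts_as F U -> U x \in @sqint R N M -> norm2 (F x) = norm2 (U x).
Proof. by move=> FU U2; apply: norm2_eq_ae U2 (FU x); exact: L2_sqint. Qed.

Lemma sqint_slab l n c m (u : pt -> 'cV[R[i]]_m) : u \in @sqint R N m ->
  (fun k => slab_indicator l n c k *: u k) \in @sqint R N m.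
Proof.
have hb := @bounded_measurable_indic R N _ (measurable_slab_set l n c).
move=> /sqintP u2; apply/sqintP => r; under eq_fun do rewrite mxE.
by apply: sqintCM => //; split => //; exact: bounded_measurable_cst.
Qed.

Lemma separable_slab_small i T (l : 'I_N) : (l < i)%N -> (i <= N)%N -> separable i T ->
  exists2 K, 0 <= K & forall n c x,
    norm2 (T (slab_op l n c x)) ^+ 2 <= K / n.+1%:R * norm2 x ^+ 2.
Proof.
move=> li iN [m [A [B [_ Ac Bc /acts_as_crestrict TT]]]].
have Ab := bounded_measurable_crestrict Ac; have Bb := bounded_measurable_crestrict Bc.
have [K K0 KP] := norm2_mulmx Ab; have [L L0 LP] := norm2_mulmx Bb.
exists (K * L); first exact: mulr_ge0.
move=> n c x; have x2 := L2_sqint x; have Bx := sqint_mulmx Bb x2.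
have hBx := sqint_slab l n c Bx.
have Tx2 := sqint_mulmx Ab (sqint_average iN hBx).
rewrite (@norm2_eq_ae _ _ _ (L2_sqint _) Tx2); last first.
  apply: filterS2 (TT (slab_op l n c x)) (average_ae iN
    (sqint_mulmx Bb (L2_sqint (slab_op l n c x))) hBx _) => [k -> e|].
    by rewrite /mul_avg_op e.
  by apply: filterS (slab_opE l n c x) => k ->; rewrite scalemxAr.
apply: (le_trans (KP _ (sqint_average iN hBx))).
rewrite -!mulrA ler_wpM2l//; apply: (le_trans (norm2_average_slab n c li iN Bx)).
by rewrite [leRHS]mulrCA ler_wpM2l ?invr_ge0//; exact: LP.
Qed.

(** Pythagoras: on the cube exactly one of the n.+2 indicators is 1 at each point. *)
Lemma norm2_slab_split l n x :
  \sum_(c < n.+2) norm2 (slab_op l n c x) ^+ 2 = norm2 x ^+ 2.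
Proof.
have x2 := L2_sqint x; have xi := integrable_sqnorm_sqint x2.
pose f (c : 'I_n.+2) k := \1_(slab_set l n c) k * sqnorm (x k) : R.
have nE (c : 'I_n.+2) : norm2 (slab_op l n c x) ^+ 2 = \int[mu N]_k f c k.
  rewrite (acts_as_norm2 (slab_opE l n c) (sqint_slab l n c x2)) sqr_norm2.
  by apply: eq_Rintegral => k _; rewrite /f -sqnorm_scale_indicator.
have fi c : (mu N).-integrable setT (EFin \o f c).
  have := integrable_sqnorm_sqint (sqint_slab l n c x2).
  by congr (integrable _ _ _); apply/funext => k /=; rewrite /f -sqnorm_scale_indicator.
rewrite (eq_bigr (fun c => \int[mu N]_k f c k)) => [|c _]; last exact: nE.
rewrite -Rintegral_sumr// sqr_norm2.
have fE : {ae mu N, forall k, \sum_(c < n.+2) f c k = sqnorm (x k)}.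
  apply: filterS (@ae_cube R N) => k kc; rewrite /f -mulr_suml.
  have /andP[k0 k1] := kc l.
  rewrite (bigD1 (Ordinal (truncn_lt n (kc l))))//= indicE mem_set; last first.
    by apply/slab_truncn.
  rewrite big1 ?addr0 ?mul1r// => c /eqP cl; rewrite indicE memNset// => kl.
  apply: cl; apply: val_inj => /=; by have /slab_truncn -> := kl.
have f0 k : 0 <= \sum_(c < n.+2) f c k.
  by apply: sumr_ge0 => c _; rewrite mulr_ge0// ?sqnorm_ge0// indicE; case: (_ \in _).
apply/eqP; rewrite eq_le; apply/andP; split; apply: ae_le_Rintegral => //;
  try by [exact: integrable_sumr|move=> k; exact: sqnorm_ge0|apply: filterS fE => k ->].
Qed.

Definition slab_commuting l F := forall n c, F * slab_op l n c = slab_op l n c * F.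

(** K is uniform in the slabs and their widths. Since slab operators are idempotent, x may be
    replaced by its piece on the slab, and the right-hand sides then add up to a multiple of the
    squared norm of x. *)
Definition slab_negligible l T := exists2 K, 0 <= K & forall n c x,
  norm2 (T (slab_op l n c x)) ^+ 2 <= K / n.+1%:R * norm2 x ^+ 2.

Definition bounded_below F := exists2 c, 0 < c & forall x, c * norm2 x <= norm2 (F x).

Lemma slab_commuting_sum l (I : Type) (s : seq I) (P : pred I) (F : I -> op) :
  (forall i, P i -> slab_commuting l (F i)) -> slab_commuting l (\sum_(i <- s | P i) F i).
Proof.
by move=> FC n c; rewrite mulr_suml mulr_sumr; apply: eq_bigr => i Pi; exact: FC.
Qed.

Lemma norm2_addL x y : norm2 (x + y : L2 R N M) <= 2 * norm2 x + 2 * norm2 y.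
Proof.
have := L2_norm2_linear 1 x y; rewrite scale1r.
by rewrite (_ : Normc.normc 1 = 1) ?mulr1// /= expr1n expr0n addr0 sqrtr1.
Qed.

Lemma norm2_subL x y : norm2 (x - y : L2 R N M) <= 2 * norm2 x + 2 * norm2 y.
Proof.
have := L2_norm2_linear (-1) y x; rewrite scaleN1r addrC.
rewrite (_ : Normc.normc (-1) = 1) ?mulr1 1?[in leRHS]addrC//.
by rewrite /= sqrrN expr1n oppr0 expr0n addr0 sqrtr1.
Qed.

Lemma norm2_eq0 x : norm2 x = 0 -> x = 0.
Proof.
move=> x0; have : norm2 x ^+ 2 = 0 by rewrite x0 expr0n.
rewrite sqr_norm2 => h.
have := Rintegral_eq0_ae (integrable_sqnorm_sqint (L2_sqint x)) (fun k => sqnorm_ge0 _) h.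
move=> h'; apply/L2_eqP; apply: filterS2 h' (L2_zero_ae R N M) => k xk ->.
by apply: sqnorm_eq0; rewrite xk.
Qed.

Lemma slab_commute_norm l S n x : slab_commuting l S ->
  \sum_(c < n.+2) norm2 (S (slab_op l n c x)) ^+ 2 = norm2 (S x) ^+ 2.
Proof.
move=> SC; rewrite -(norm2_slab_split l n (S x)); apply: eq_bigr => c _.
by rewrite -[S (slab_op l n c x)]/((S * slab_op l n c) x) SC.
Qed.

Lemma slab_op_idemE l n c x : slab_op l n c (slab_op l n c x) = slab_op l n c x.
Proof. by rewrite -[LHS]/((slab_op l n c * slab_op l n c) x) slab_op_idem. Qed.

Lemma slab_decomposition0 l S T : slab_commuting l S -> slab_negligible l T ->
  S + T = 0 -> S = 0.
Proof.
move=> SC [K K0 KP] ST; apply: boundedOp_eqP => x; apply: norm2_eq0.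
(* On every piece of x the operators S and -T agree; 4 is the square of the factor 2 in
   [norm2_subL]. *)
have bnd n : norm2 (S x) ^+ 2 <= 4 * K * norm2 x ^+ 2 / n.+1%:R.
  rewrite -(slab_commute_norm n x SC).
  apply: (@le_trans _ _ (\sum_(c < n.+2) 4 * K / n.+1%:R * norm2 (slab_op l n c x) ^+ 2)); last first.
    by rewrite -mulr_sumr norm2_slab_split mulrAC.
  apply: ler_sum => c _; set y := slab_op l n c x.
  have -> : S y = 0 - T y.
    have : (S + T) y = 0 by rewrite ST.
    by rewrite -[(S + T) y]/(S y + T y) => /eqP; rewrite addr_eq0 => /eqP ->; rewrite sub0r.
  have h := norm2_subL 0 (T y); have := KP n c y; rewrite slab_op_idemE -/y => h'.
  have h'' : norm2 (0 - T y : L2 R N M) <= 2 * norm2 (T y) by rewrite (le_trans h)// norm2_0 mulr0 add0r.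
  apply: (@le_trans _ _ ((2 * norm2 (T y)) ^+ 2)).
    by rewrite lerXn2r// nnegrE ?norm2_ge0// mulr_ge0// norm2_ge0.
  rewrite (_ : (2 * norm2 (T y)) ^+ 2 = 4 * norm2 (T y) ^+ 2); last by ring.
  rewrite (_ : 4 * K / n.+1%:R * norm2 y ^+ 2 = 4 * (K / n.+1%:R * norm2 y ^+ 2)); last by ring.
  by rewrite ler_pM2l.
have : norm2 (S x) ^+ 2 <= 0.
  rewrite leNgt; apply/negP => h.
  set C := 4 * K * norm2 x ^+ 2 in bnd.
  have C0 : 0 <= C by apply: mulr_ge0; [exact: mulr_ge0|exact: sqr_ge0].
  (* For this n, the number n + 1 exceeds the quotient, which contradicts [bnd]. *)
  pose n := Num.truncn (C / norm2 (S x) ^+ 2).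
  have /andP[_ h2] := truncn_itv (divr_ge0 C0 (ltW h)).
  have := bnd n; rewrite ler_pdivlMr ?ltr0n// mulrC -ler_pdivlMr//.
  by rewrite leNgt h2.
move=> h; apply/eqP; rewrite -sqrf_eq0 eq_le h sqr_ge0//.
Qed.

Lemma slab_decomposition_below l S T : slab_commuting l S -> slab_negligible l T ->
  bounded_below (S + T) -> bounded_below S.
Proof.
(* On a piece y of x, c |y| <= 2 |S y| + 2 |T y|. Once |T y| <= (c / 4) |y|, half of the left-hand
   side is absorbed and |S y| >= (c / 4) |y|. *)
move=> SC [K K0 KP] [c c0 cP]; exists (c / 4); first by rewrite divr_gt0.
have c4 : 0 <= c / 4 by rewrite divr_ge0// ltW.
have nn z : 0 <= c / 4 * norm2 (z : L2 R N M) by rewrite mulr_ge0 ?norm2_ge0.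
(* The width, chosen independently of x, that makes T at most c / 4 on every slab. *)
move=> x; pose n := Num.truncn (K / (c / 4) ^+ 2).
have c40 : 0 < (c / 4) ^+ 2 by rewrite exprn_gt0// divr_gt0.
have nK : K / n.+1%:R <= (c / 4) ^+ 2.
  have /andP[_ h2] := truncn_itv (divr_ge0 K0 (ltW c40)).
  by rewrite ler_pdivrMr ?ltr0n// mulrC -ler_pdivrMr// ltW.
rewrite -ler_sqr ?nnegrE ?nn ?norm2_ge0//.
rewrite exprMn -(slab_commute_norm n x SC) -(norm2_slab_split l n x) mulr_sumr.
apply: ler_sum => d _; set y := slab_op l n d x.
rewrite -exprMn ler_sqr ?nnegrE ?nn ?norm2_ge0//.
have hT : norm2 (T y) <= c / 4 * norm2 y.
  rewrite -ler_sqr ?nnegrE ?nn ?norm2_ge0//.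
  have := KP n d y; rewrite slab_op_idemE -/y => /le_trans; apply.
  by rewrite exprMn ler_wpM2r// sqr_ge0.
have h1 := cP y; have h2 := norm2_addL (S y) (T y).
rewrite -[(S + T) y]/(S y + T y) in h1.
have y0 : 0 <= norm2 y by exact: norm2_ge0.
lra.
Qed.

Lemma bounded_below_mulr F G : bounded_below (F * G) -> bounded_below G.
Proof.
have [_ [K KP]] := boundedOpP F => -[c c0 cP].
have K1 : 0 < `|K| + 1 by rewrite ltr_pwDr.
exists (c / (`|K| + 1)) => [|x]; first by rewrite divr_gt0.
rewrite mulrAC ler_pdivrMr// (le_trans (cP x))// (le_trans (KP (G x)))//.
rewrite mulrC ler_wpM2l ?norm2_ge0// (le_trans (ler_norm K))// lerDl//.
Qed.

Lemma bounded_below_mul F G : bounded_below F -> bounded_below G -> bounded_below (F * G).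
Proof.
move=> [c c0 cP] [d d0 dP]; exists (c * d) => [|x]; first exact: mulr_gt0.
by rewrite -mulrA (le_trans _ (cP (G x)))// ler_pM2l.
Qed.

Lemma bounded_below_inv F G : F * G = 1 -> bounded_below G.
Proof.
move=> FG; apply: (@bounded_below_mulr F); rewrite FG.
by exists 1 => // x; rewrite mul1r.
Qed.
End Slabs.

(** * Invertibility *)

#[local] Opaque norm2.

(** * From lower bounds of operators to lower bounds at points *)

Section Localization.
Variables (R : realType) (N M : nat).
Local Notation mu := (cube_measure R).
Local Notation pt := (point R N).
Local Notation op := (boundedOp R N M).

Lemma ravg_subZ j (f g : pt -> R) (c : R) k : continuous_cube f -> continuous_cube g -> cube k ->
  ravg j (fun k => f k - c * g k) k = ravg j f k - c * ravg j g k.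
Proof.
move=> fc gc kc.
have fb := continuous_cube_restrict fc; have gb := continuous_cube_restrict gc.
have fi := bounded_measurable_integrable (bounded_measurable_section j k fb).
have gi := bounded_measurable_integrable (bounded_measurable_section j k gb).
have [mf _] := fb; have [mg _] := gb.
rewrite -(ravg_restrict j f kc) -(ravg_restrict j g kc).
rewrite -(ravg_restrict j (fun k => f k - c * g k) kc).
rewrite (_ : _ \_ _ = fun k => (f \_ (@cube R N)) k - c * (g \_ (@cube R N)) k); last first.
  by apply/funext => l; rewrite !patchE; case: ifP => _; rewrite ?mulr0 ?subr0.
rewrite !ravgE//; last by apply: measurable_funB => //; exact: measurable_funM.
by rewrite -RintegralZl// -RintegralB//; exact: integrable_mulr.
Qed.

(** Measurable sets of points (k_(j+1), ..., k_N), regarded as cylinders; their indicators can be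
    taken out of <.>_j. *)
Definition first_invariant j (Q : set pt) :=
  measurable Q /\ forall (x : point R j) k, (replace_first x k \in Q) = (k \in Q).

(* Testing against indicators of sets of points (k_(j+1), ..., k_N) recovers the
   average over the first j variables pointwise. *)
Lemma ravg_ge0_localize j (w : pt -> R) : (j <= N)%N -> continuous_cube w ->
  (forall Q, first_invariant j Q -> 0 <= \int[mu N]_k (\1_Q k * (w \_ (@cube R N)) k)) ->
  forall k, cube k -> 0 <= ravg j w k.
Proof.
move=> jN wc wQ; apply: continuous_cube_ae_ge0; first exact: continuous_cube_ravg.
have wb := continuous_cube_restrict wc; have [mw _] := wb.
set w' := w \_ (@cube R N) in wQ wb mw.
have [mr _] := bounded_measurable_ravg jN wb.
(* The integral of the average over this Q is at most 0 by the choice of Q and at least 0 by [wQ].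
   Hence Q is a null set. *)
pose Q : set pt := [set k | ravg j w' k < 0].
have mQ : measurable Q.
  rewrite (_ : Q = ravg j w' @^-1` [set` `]-oo, 0[%R]); last first.
    by apply/seteqP; split => k; rewrite /Q /= in_itv.
  by rewrite -[X in measurable X]setTI; apply: mr => //; exact: measurable_itv.
have Qinv : first_invariant j Q.
  by split => // x k; apply/idP/idP; rewrite !inE /Q /= ravg_invariant.
have Qb := @bounded_measurable_indic R N _ mQ.
have Qwb := bounded_measurableM Qb wb.
have avgE k : ravg j (fun k => \1_Q k * w' k) k = \1_Q k * ravg j w' k.
  apply: ravg_scale => //.
    exact: bounded_measurable_integrable (bounded_measurable_section j k wb).
  by move=> x _; rewrite !indicE; have [_ ->] := Qinv.
have gb := bounded_measurableN (bounded_measurableM Qb (bounded_measurable_ravg jN wb)).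
have g0 k : 0 <= - (\1_Q k * ravg j w' k).
  rewrite oppr_ge0 indicE; case: (boolP (k \in Q)); rewrite ?mul0r// inE mul1r => kQ.
  exact: ltW.
have gi := bounded_measurable_integrable gb.
have I0 : \int[mu N]_k - (\1_Q k * ravg j w' k) = 0.
  apply/eqP; rewrite eq_le; apply/andP; split; last by apply: Rintegral_ge0 => k _.
  rewrite (@eq_Rintegral _ _ _ _ _ (fun k => -1 * ravg j (fun k => \1_Q k * w' k) k)); last first.
    by move=> k _; rewrite avgE mulN1r.
  rewrite RintegralZl//; last first.
    exact: (bounded_measurable_integrable (bounded_measurable_ravg jN Qwb)).
  rewrite (Rintegral_ravg jN (bounded_measurable_integrable Qwb)) mulN1r oppr_le0.
  exact: wQ.
apply: filterS2 (Rintegral_eq0_ae gi g0 I0) (@ae_cube R N) => k gk kc.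
rewrite -(ravg_restrict j w kc) -/w' leNgt; apply/negP => h.
move: gk; rewrite indicE mem_set// mul1r => /eqP; rewrite oppr_eq0 => /eqP e.
by rewrite e ltxx in h.
Qed.

Lemma continuous_sqnorm m (V : pt -> 'cV[R[i]]_m) : continuous_on_cube V ->
  continuous_cube (fun k => sqnorm (V k)).
Proof.
move=> /continuous_on_cubeP Vc.
apply: (@continuous_cube_sum _ _ R) => r _.
have /continuous_cube_complexP[Vr Vi] := Vc r ord0.
apply: (@continuous_cube_eq _ _ _ (fun k => complex.Re (V k r ord0) * complex.Re (V k r ord0) +
   complex.Im (V k r ord0) * complex.Im (V k r ord0))).
  by move=> k _; rewrite normc_sqr.
by apply: (@continuous_cubeD _ _ R); exact: (@continuous_cubeM _ _ R).
Qed.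

Lemma sqint_indicator m (Q : set pt) (u : pt -> 'cV[R[i]]_m) : measurable Q ->
  u \in @sqint R N m -> (fun k => ((\1_Q k)%:C)%C *: u k) \in @sqint R N m.
Proof.
move=> mQ /sqintP u2; apply/sqintP => r; under eq_fun do rewrite mxE.
apply: sqintCM => //; split => //=; last exact: bounded_measurable_cst.
exact: bounded_measurable_indic.
Qed.

(** The lower bound of F is tested on the functions 1_Q V, which F sends to 1_Q W. As Q is arbitrary
    among the invariant sets, the resulting inequality of integrals localizes to every point. *)
Lemma bounded_below_localize (F : op) c j (V W : pt -> 'cV[R[i]]_M) : (j <= N)%N ->
  0 < c -> (forall x : L2 R N M, c * norm2 x <= norm2 (F x)) ->
  continuous_on_cube V -> continuous_on_cube W ->
  (forall Q, first_invariant j Q -> forall x : L2 R N M,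
    {ae mu N, forall k, x k = ((\1_Q k)%:C)%C *: V k} ->
    {ae mu N, forall k, F x k = ((\1_Q k)%:C)%C *: W k}) ->
  forall k, cube k ->
    c ^+ 2 * ravg j (fun k => sqnorm (V k)) k <= ravg j (fun k => sqnorm (W k)) k.
Proof.
move=> jN c0 cF Vc Wc FVW k kc.
have sVc := continuous_sqnorm Vc; have sWc := continuous_sqnorm Wc.
rewrite -subr_ge0 -ravg_subZ//; apply: ravg_ge0_localize => //.
  apply: (@continuous_cubeD _ _ R) => //; apply: (@continuous_cubeN _ _ R).
  by apply: (@continuous_cubeM _ _ R) => //; exact: (@continuous_cube_cst _ _ R).
move=> Q Qinv; have [mQ _] := Qinv.
have V2 : crestrict V \in @sqint R N M by exact: sqint_bounded (bounded_measurable_crestrict Vc).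
have W2 : crestrict W \in @sqint R N M by exact: sqint_bounded (bounded_measurable_crestrict Wc).
have QV2 := sqint_indicator mQ V2; have QW2 := sqint_indicator mQ W2.
have [x xQ] : exists x : L2 R N M, {ae mu N, forall k, x k = ((\1_Q k)%:C)%C *: crestrict V k}.
  by exists (\pi_(L2 R N M)%qT (Sqfun QV2)); exact: L2_pi_ae.
have xE : {ae mu N, forall k, x k = ((\1_Q k)%:C)%C *: V k}.
  by apply: filterS2 xQ (@ae_cube R N) => l e lc; rewrite [LHS]e crestrictE.
have nx : norm2 x = norm2 (fun k => ((\1_Q k)%:C)%C *: crestrict V k).
  exact: (norm2_eq_ae (L2_sqint x) QV2 xQ).
have nFx : norm2 (F x) = norm2 (fun k => ((\1_Q k)%:C)%C *: crestrict W k).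
  apply: (norm2_eq_ae (L2_sqint (F x)) QW2).
  by apply: filterS2 (FVW Q Qinv x xE) (@ae_cube R N) => l -> lc; rewrite crestrictE.
have sqE (U : pt -> 'cV[R[i]]_M) : crestrict U \in @sqint R N M ->
    norm2 (fun k => ((\1_Q k)%:C)%C *: crestrict U k) ^+ 2 =
    \int[mu N]_k (\1_Q k * sqnorm (crestrict U k)).
  by move=> U2; rewrite sqr_norm2; apply: eq_Rintegral => l _; rewrite -sqnorm_scale_indicator.
have sqi (U : pt -> 'cV[R[i]]_M) : crestrict U \in @sqint R N M ->
    (mu N).-integrable setT (EFin \o (fun k => \1_Q k * sqnorm (crestrict U k))).
  move=> U2; have := integrable_sqnorm_sqint (sqint_indicator mQ U2).
  by congr (integrable _ _ _); apply/funext => l /=; rewrite sqnorm_scale_indicator.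
have : c ^+ 2 * norm2 x ^+ 2 <= norm2 (F x) ^+ 2.
  by rewrite -exprMn lerXn2r// nnegrE ?norm2_ge0// mulr_ge0 ?norm2_ge0// ltW.
have eV : norm2 x ^+ 2 = \int[mu N]_k (\1_Q k * sqnorm (crestrict V k)).
  by rewrite nx; exact: sqE.
have eW : norm2 (F x) ^+ 2 = \int[mu N]_k (\1_Q k * sqnorm (crestrict W k)).
  by rewrite nFx; exact: sqE.
rewrite eV eW; rewrite -RintegralZl; [|exact: measurableT|exact: (sqi V V2)].
rewrite -subr_ge0 -RintegralB; [|exact: measurableT|exact: (sqi W W2)|exact: (integrable_mulr _ (sqi V V2))].
rewrite (@eq_Rintegral _ _ _ _ _ (fun k => \1_Q k * ((fun k => sqnorm (W k) - c ^+ 2 * sqnorm (V k)) \_ (@cube R N)) k))//.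
move=> l _; rewrite patchE /crestrict; case: ifP => _; first by ring.
by rewrite sqnorm0 !mulr0 subrr.
Qed.

(** A nonnegative function with average 0 vanishes almost everywhere on the section, so V does, and
    with it C V. *)
Lemma average_eq0 j m p (C : pt -> 'M[R[i]]_(m, p)) (V : pt -> 'cV[R[i]]_p) k :
  continuous_on_cube C -> continuous_on_cube V -> cube k ->
  ravg j (fun k => sqnorm (V k)) k <= 0 -> average j (fun k => C k *m V k) k = 0.
Proof.
move=> Cc Vc kc V0.
have sb := continuous_cube_restrict (continuous_sqnorm Vc).
have CVb := bounded_measurable_mulmx (bounded_measurable_crestrict Cc) (bounded_measurable_crestrict Vc).
have fb := bounded_measurable_section j k sb.
have fi := bounded_measurable_integrable fb.
have f0 (x : point R j) : 0 <= ((fun k => sqnorm (V k)) \_ (@cube R N)) (replace_first x k).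
  by rewrite patchE; case: ifP => // _; exact: sqnorm_ge0.
have I0 : \int[mu j]_x ((fun k => sqnorm (V k)) \_ (@cube R N)) (replace_first x k) = 0.
  apply/eqP; rewrite eq_le Rintegral_ge0// andbT -ravgE; last by have [] := sb.
  by rewrite ravg_restrict.
have fz := Rintegral_eq0_ae fi f0 I0.
have Vz : {ae mu j, forall x, crestrict V (replace_first x k) = 0}.
  apply: filterS fz => x; rewrite patchE /crestrict; case: ifP => // _ s0.
  by apply: sqnorm_eq0; rewrite s0.
rewrite (@eq_average _ _ _ _ _ (fun k => crestrict C k *m crestrict V k)); last first.
  by move=> x xc; have h := cube_replace xc kc; rewrite !crestrictE.
have z (f : pt -> R) : measurable_fun setT f ->
    {ae mu j, forall x, f (replace_first x k) = 0} -> ravg j f k = 0.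
  move=> mf fe; rewrite ravgE// /Rintegral (ae_eq_integral (fun=> 0%E))//.
  - by rewrite integral0.
  - by apply/measurable_EFinP; exact: measurable_section.
  - by apply: filterS fe => x -> _.
apply/colP => r; rewrite averageE mxE; have [[mr _] [mi _]] := bounded_measurable_entry CVb r ord0.
congr Complex; apply: z => //; apply: filterS Vz => x Vx; by rewrite Vx mulmx0 mxE.
Qed.
End Localization.

(** * Inverses of multiplications and of 1 + A<B.>_j *)

Section Invertibility.
Variables (R : realType) (N M : nat).
Local Notation mu := (cube_measure R).
Local Notation pt := (point R N).
Local Notation op := (boundedOp R N M).
Implicit Types (F G : op).

Lemma not_unitmx_ker m (D : 'M[R[i]]_m) : D \notin unitmx ->
  exists2 v : 'cV[R[i]]_m, v != 0 & D *m v = 0.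
Proof.
rewrite unitmxE unitfE negbK -det_tr => /det0P[v v0 vD].
exists v^T; first by rewrite trmx_eq0.
by apply: trmx_inj; rewrite trmx_mul trmxK vD trmx0.
Qed.

(** Localization with j = 0, where averages are evaluations: a kernel vector v of A at k, taken as a
    constant function, violates the lower bound at k. *)
Lemma multiplication_unit F (A : pt -> 'M[R[i]]_M) : continuous_on_cube A ->
  acts_as F (mul_op A) -> bounded_below F -> forall k, cube k -> A k \in unitmx.
Proof.
move=> Ac FA [c c0 cF] k kc; apply: contraT => /not_unitmx_ker[v v0 Av].
have Avc : continuous_on_cube (fun k => A k *m v).
  by apply: continuous_mulmx; [exact: Ac|exact: continuous_cst_mx].
have := @bounded_below_localize _ _ _ F c 0 (fun=> v) (fun k => A k *m v) (leq0n N) c0 cF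
  (@continuous_cst_mx R N _ _ v) Avc _ k kc.
rewrite (@ravg_cst R N 0 (fun=> sqnorm v) k (sqnorm v)); last by [].
rewrite (@ravg_cst R N 0 (fun k => sqnorm (A k *m v)) k 0); last by move=> x _; rewrite replace_first0 Av sqnorm0.
move=> h; have : c ^+ 2 * sqnorm v <= 0.
  apply: h => Q _ x xE; apply: filterS2 (FA x) xE => l -> xl.
  by rewrite /mul_op xl -scalemxAr.
rewrite pmulr_rle0 ?exprn_gt0// => /sqnorm_eq0 vz.
by rewrite vz eqxx in v0.
Qed.

Lemma separable_unit j m F (A : pt -> 'M[R[i]]_(M, m)) (B : pt -> 'M[R[i]]_(m, M)) :
  (j <= N)%N -> continuous_on_cube A -> continuous_on_cube B ->
  acts_as F (mul_avg_op j A B) -> bounded_below (1 + F) ->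
  forall k, cube k -> 1%:M + avg_mx j (fun k => B k *m A k) k \in unitmx.
Proof.
move=> jN Ac Bc FT [c c0 cF] k0 k0c; apply: contraT => /not_unitmx_ker[v v0 Dv].
have BAc := continuous_mulmx Bc Ac.
pose D k := 1%:M + avg_mx j (fun k => B k *m A k) k.
have Dc : continuous_on_cube D.
  by apply: continuous_addmx; [exact: continuous_cst_mx|exact: continuous_avg_mx].
have vc := @continuous_cst_mx R N _ _ v.
have Avc := continuous_mulmx Ac vc.
have ADvc := continuous_mulmx Ac (continuous_mulmx Dc vc).
have Ab := bounded_measurable_crestrict Ac; have Bb := bounded_measurable_crestrict Bc.
have loc := @bounded_below_localize _ _ _ (1 + F) c j _ _ jN c0 cF Avc ADvc _ k0 k0c.
(* 1 + F sends 1_Q A v to 1_Q A D v, because 1_Q and v leave the average and only <BA>_j remains. *)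
have : c ^+ 2 * ravg j (fun k => sqnorm (A k *m v)) k0 <=
    ravg j (fun k => sqnorm (A k *m (D k *m v))) k0.
  apply: loc => Q [mQ Qinv] x xE.
  have /acts_as_crestrict FT' := FT.
  have v2 : (fun _ : pt => v) \in @sqint R N m.
    exact: sqint_bounded (@bounded_measurable_cst_mx _ _ _ _ v).
  have Qv2 := sqint_indicator mQ v2.
  have e := average_ae jN (sqint_mulmx Bb (L2_sqint x))
    (sqint_mulmx (bounded_measurable_mulmx Bb Ab) Qv2).
  apply: filterS3 (filterI (L2_add_ae x (F x)) (FT' x)) (e _) (filterI xE (@ae_cube R N)).
    move=> k [h1 h2] h3 [h4 kc]; rewrite -[(1 + F) x]/(x + F x) h1 h2 /mul_avg_op h3 h4.
    rewrite (average_mulr (bounded_measurable_mulmx Bb Ab)); last first.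
      by move=> y _; rewrite !indicE Qinv.
    rewrite (@eq_avg_mx _ _ j _ _ _ (fun k => B k *m A k)); last first.
      by move=> y yc; have h := cube_replace yc kc; rewrite !crestrictE.
    rewrite crestrictE// -!scalemxAr -scalerDr; congr (_ *: _).
    by rewrite /D mulmxDl mul1mx mulmxDr.
  apply: filterS2 xE (@ae_cube R N) => k -> kc.
  by rewrite crestrictE// -!scalemxAr crestrictE// mulmxA.
(* D is constant on the section through k0, so D v vanishes on all of it. *)
rewrite (@ravg_cst R N j (fun k => sqnorm (A k *m (D k *m v))) k0 0); last first.
  by move=> y _; rewrite /D avg_mx_invariant// Dv mulmx0 sqnorm0.
rewrite pmulr_rle0 ?exprn_gt0// => h.
(* Thus A v vanishes almost everywhere on this section. Then <BA>_j v = 0 at k0, so that D v = v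
   there, and v = 0. *)
have := average_eq0 Bc Avc k0c h.
rewrite (@eq_average _ _ j _ _ (fun k => crestrict (fun k => B k *m A k) k *m v)); last first.
  by move=> y yc; rewrite crestrictE ?mulmxA//; exact: cube_replace.
rewrite (average_mulr (bounded_measurable_crestrict BAc))//.
rewrite (@eq_avg_mx _ _ j _ _ _ (fun k => B k *m A k)); last first.
  by move=> y yc; rewrite crestrictE//; exact: cube_replace.
move=> z; move: Dv; rewrite mulmxDl z mul1mx addr0 => vz.
by rewrite vz eqxx in v0.
Qed.

Lemma multiplication_inverse F : calHj R N M 0 F -> bounded_below F ->
  exists G, [/\ calHj R N M 0 G, F * G = 1 & G * F = 1].
Proof.
move=> [A Ac FA] Fb; have Au := multiplication_unit Ac FA Fb.
have Ivc := continuous_invmx Ac Au.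
have [G GT] := separable_exists (leq0n N) Ivc (@continuous_cst_mx R N _ _ 1%:M).
have GA : acts_as G (mul_op (fun k => invmx (A k))).
  by apply: acts_as_eq GT => u k _; rewrite /mul_avg_op average0 mul1mx.
exists G; split.
- by exists (fun k => invmx (A k)).
- apply: boundedOp_eqP => x; apply/L2_eqP.
  apply: filterS3 (FA (G x)) (GA x) (@ae_cube R N) => k h1 h2 kc.
  by rewrite [LHS]h1 /mul_op h2 /mul_op mulmxA mulmxV ?mul1mx//; exact: Au.
- apply: boundedOp_eqP => x; apply/L2_eqP.
  apply: filterS3 (GA (F x)) (FA x) (@ae_cube R N) => k h1 h2 kc.
  by rewrite [LHS]h1 /mul_op h2 /mul_op mulmxA mulVmx ?mul1mx//; exact: Au.
Qed.

(* Sylvester: 1 + A<B.> has inverse 1 - A D^-1 <B.> with D = 1 + <BA>. *)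
Lemma separable_inverse j F : (j <= N)%N -> separable j F -> bounded_below (1 + F) ->
  exists G, [/\ separable j G, (1 + F) * (1 + G) = 1 & (1 + G) * (1 + F) = 1].
Proof.
move=> jN [m [A [B [m0 Ac Bc FT]]]] Fb; have Du := separable_unit jN Ac Bc FT Fb.
have BAc := continuous_mulmx Bc Ac.
pose Q k := avg_mx j (fun k => B k *m A k) k.
pose D k := 1%:M + Q k.
have Dc : continuous_on_cube D.
  by apply: continuous_addmx; [exact: continuous_cst_mx|exact: continuous_avg_mx].
have Ec := continuous_invmx Dc Du.
have A'c := @continuous_scalemx R N _ _ (-1) _ (continuous_mulmx Ac Ec).
have [G GT] := separable_exists jN A'c Bc.
have FG := separable_mul_le Ac Bc A'c Bc (leqnn j) jN FT GT.
have GF := separable_mul_le A'c Bc Ac Bc (leqnn j) jN GT FT.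
(* F, G and their product share the right coefficient B, so only the left coefficients have to add
   up to zero. *)
have key T (C : pt -> 'M[R[i]]_(M, m)) : acts_as T (mul_avg_op j C B) ->
    (forall k, cube k -> A k + -1 *: (A k *m invmx (D k)) + C k = 0) -> F + G + T = 0.
  move=> TC C0; have := acts_as_add (acts_as_add FT GT) TC => h.
  apply: (acts_as_inj (T := fun u k => 0)); last exact: acts_as_zero.
  apply: acts_as_eq h => u k kc.
  by rewrite /mul_avg_op -!mulmxDl C0// mul0mx.
exists G; split.
- by exists m, (fun k => -1 *: (A k *m invmx (D k))), B.
- rewrite mulrDl mul1r mulrDr mulr1 addrA -[1 + G + F]addrA [G + F]addrC -addrA.
  rewrite (key (F * G) _ FG) ?addr0// => k kc.
  rewrite (@eq_avg_mx _ _ j _ _ _ (fun k => (B k *m A k) *m (-1 *: invmx (D k)))); last first.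
    by move=> x _; rewrite -!scalemxAr mulmxA.
  rewrite (@avg_mx_mulr _ _ j _ _ _ _ (fun k => -1 *: invmx (D k)) k BAc kc); last by move=> x _; rewrite /D /Q avg_mx_invariant.
  (* Q D^-1 = 1 - D^-1, so the left coefficient -A Q D^-1 of F G cancels A - A D^-1. *)
  rewrite -/(Q k) (_ : Q k = D k - 1%:M); last by rewrite /D addrC addKr.
  rewrite mulmxBl mul1mx -!scalemxAr mulmxV; last exact: Du.
  by rewrite mulmxBr -!scalemxAr mulmx1 !scaleN1r opprK addrACA addrN add0r addNr.
- rewrite mulrDl mul1r mulrDr mulr1 addrA -[1 + F + G]addrA -addrA.
  rewrite (key (G * F) _ GF) ?addr0// => k kc.
  rewrite -/(Q k) (_ : Q k = D k - 1%:M); last by rewrite /D addrC addKr.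
  rewrite -scalemxAl mulmxBr mulmx1 -mulmxA mulVmx; last exact: Du.
  by rewrite mulmx1 scalerBr !scaleN1r opprK addrACA addrN add0r addNr.
Qed.
End Invertibility.

(** * Sums and factorizations *)

Section Factorization.
Variables (R : realType) (N M : nat).
Hypothesis hM : (0 < M)%N.
Local Notation op := (boundedOp R N M).
Local Notation H := (@separable R N M).
Implicit Types (X Y F G S A : op).

Lemma separable_sum j (I : Type) (s : seq I) (P : pred I) (F : I -> op) :
  (forall i, P i -> H j (F i)) -> H j (\sum_(i <- s | P i) F i).
Proof.
move=> FH; apply: (big_ind (H j)) => //; first exact: separable0.
by move=> F1 F2; exact: separableD.
Qed.

(** The partial sum H_0 + ... + H_j. Families on [nat] spare the inductions on j the casts between
    ordinal types. *)
Definition sum_separable j X := exists A : nat -> op,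
  (forall i, (i <= j)%N -> H i (A i)) /\ X = \sum_(i < j.+1) A i.

Lemma separable_sub_sum i j F : (i <= j)%N -> H i F -> sum_separable j F.
Proof.
move=> ij FH; exists (fun l => if l == i then F else 0); split.
  by move=> l _; case: eqP => [->//|_]; exact: separable0.
rewrite (bigD1 (Ordinal (ij : (i < j.+1)%N)))//= eqxx big1 ?addr0// => l.
by rewrite -val_eqE /= => /negbTE ->.
Qed.

Lemma sum_separable_linear j (a : R[i]) X Y : sum_separable j X -> sum_separable j Y -> sum_separable j (a *: X + Y).
Proof.
move=> [A [AH ->]] [B [BH ->]]; exists (fun i => a *: A i + B i); split.
  by move=> i ij; apply: separable_linear; [exact: AH|exact: BH].
by rewrite scaler_sumr -big_split.
Qed.

Lemma sum_separableD j X Y : sum_separable j X -> sum_separable j Y -> sum_separable j (X + Y).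
Proof. by move=> XH YH; rewrite -(scale1r X); exact: sum_separable_linear. Qed.

Lemma sum_separable0 j : sum_separable j 0.
Proof. by apply: (@separable_sub_sum 0) => //; exact: separable0. Qed.

Lemma sum_separable1 j : sum_separable j 1.
Proof. apply: (@separable_sub_sum 0) => //.
by have := @separable_cst R N M 1 hM; rewrite scale1r. Qed.

Lemma sum_separable_sum j (I : Type) (s : seq I) (P : pred I) (F : I -> op) :
  (forall i, P i -> sum_separable j (F i)) -> sum_separable j (\sum_(i <- s | P i) F i).
Proof.
move=> FH; apply: (big_ind (sum_separable j)) => //; first exact: sum_separable0.
by move=> F1 F2; exact: sum_separableD.
Qed.

Lemma sum_separableM j X Y : (j <= N)%N -> sum_separable j X -> sum_separable j Y -> sum_separable j (X * Y).
Proof.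
move=> jN [A [AH ->]] [B [BH ->]]; rewrite mulr_suml; apply: sum_separable_sum => i _.
rewrite mulr_sumr; apply: sum_separable_sum => l _.
have ij : (i <= j)%N by rewrite -ltnS.
have lj : (l <= j)%N by rewrite -ltnS.
apply: (@separable_sub_sum (maxn i l)); first by rewrite geq_max ij.
by apply: separable_mul; [exact: leq_trans jN|exact: leq_trans jN|exact: AH|exact: BH].
Qed.

Lemma sum_separable_mono i j X : (i <= j)%N -> sum_separable i X -> sum_separable j X.
Proof.
move=> ij [A [AH ->]]; apply: sum_separable_sum => l _.
have li : (l <= i)%N by rewrite -ltnS.
by apply: (@separable_sub_sum l); [exact: leq_trans ij|exact: AH].
Qed.

Lemma sum_separableS j X : sum_separable j.+1 X -> exists S A, [/\ sum_separable j S, H j.+1 A & X = S + A].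
Proof.
move=> [A [AH ->]]; exists (\sum_(i < j.+1) A i), (A j.+1); split.
- by exists A; split => // i ij; apply: AH; rewrite leqW.
- exact: AH.
- by rewrite big_ord_recr.
Qed.

(** The ordinal j is the variable k_(j+1): the first one that H_0, ..., H_j leave alone, and one
    that H_(j+1) integrates. *)
Lemma sum_separable_slab_commuting j (jN : (j < N)%N) S : sum_separable j S -> slab_commuting (Ordinal jN) S.
Proof.
move=> [A [AH ->]]; apply: slab_commuting_sum => i _ n c.
have ij : (i <= j)%N by rewrite -ltnS.
by apply: separable_slab_comm (AH i ij).
Qed.

Lemma separable_slab_negligible j (jN : (j < N)%N) A :
  H j.+1 A -> slab_negligible (Ordinal jN) A.
Proof. by move=> AH; apply: (separable_slab_small _ _ AH). Qed.

Lemma sum_separable_decomposition j S S' A A' : (j < N)%N -> sum_separable j S -> sum_separable j S' ->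
  H j.+1 A -> H j.+1 A' -> S + A = S' + A' -> S = S' /\ A = A'.
Proof.
move=> jN SH SH' AH AH' e.
have SS : S - S' = 0.
  apply: (slab_decomposition0 (l := Ordinal jN) (T := A - A')).
  - apply: sum_separable_slab_commuting; rewrite addrC -scaleN1r; exact: sum_separable_linear.
  - by apply: separable_slab_negligible; apply: separableD => //; exact: separableN.
  by rewrite addrACA e -opprD subrr.
have {}SS : S = S' by apply/eqP; rewrite -subr_eq0 SS.
by split => //; move: e; rewrite SS => /addrI.
Qed.

Lemma sum_separable_bounded_below j S A : (j < N)%N -> sum_separable j S -> H j.+1 A ->
  bounded_below (S + A) -> bounded_below S.
Proof.
move=> jN SH AH; apply: (slab_decomposition_below (l := Ordinal jN)).
  exact: sum_separable_slab_commuting.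
exact: separable_slab_negligible.
Qed.

Lemma separable_mull_sum j S A : (j < N)%N -> sum_separable j S -> H j.+1 A -> H j.+1 (S * A).
Proof.
move=> jN [B [BH ->]] AH; rewrite mulr_suml; apply: separable_sum => i _.
have ij : (i <= j)%N by rewrite -ltnS.
have iN : (i <= N)%N by rewrite (leq_trans ij)// ltnW.
by have := separable_mul iN jN (BH i ij) AH; rewrite (maxn_idPr (leqW ij)).
Qed.

Lemma separable_mulr_sum j S A : (j < N)%N -> sum_separable j S -> H j.+1 A -> H j.+1 (A * S).
Proof.
move=> jN [B [BH ->]] AH; rewrite mulr_sumr; apply: separable_sum => i _.
have ij : (i <= j)%N by rewrite -ltnS.
have iN : (i <= N)%N by rewrite (leq_trans ij)// ltnW.
by have := separable_mul jN iN AH (BH i ij); rewrite (maxn_idPl (leqW ij)).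
Qed.

Lemma sum_separable_inj j (A A' : nat -> op) : (j <= N)%N ->
  (forall i, (i <= j)%N -> H i (A i)) -> (forall i, (i <= j)%N -> H i (A' i)) ->
  \sum_(i < j.+1) A i = \sum_(i < j.+1) A' i -> forall i, (i <= j)%N -> A i = A' i.
Proof.
elim: j => [|j IH] jN AH AH'.
  by rewrite !big_ord1 => e i; rewrite leqn0 => /eqP ->.
rewrite !(big_ord_recr j.+1) /= => e.
have [e1 e2] := sum_separable_decomposition jN
  (ex_intro _ A (conj (fun i ij => AH i (leqW ij)) erefl))
  (ex_intro _ A' (conj (fun i ij => AH' i (leqW ij)) erefl))
  (AH j.+1 (leqnn _)) (AH' j.+1 (leqnn _)) e.
move=> i; rewrite leq_eqVlt => /predU1P[->//|ij].
apply: IH => //; first exact: ltnW.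
- by move=> l lj; apply: AH; exact: leqW.
- by move=> l lj; apply: AH'; exact: leqW.
Qed.

(** The inverse has to lie in the same partial sum, so that factors can be cancelled without leaving
    it. *)
Definition sum_separable_unit j X := [/\ sum_separable j X & exists Y, [/\ sum_separable j Y, X * Y = 1 & Y * X = 1]].

Lemma sum_separable_unitM j X Y : (j <= N)%N -> sum_separable_unit j X -> sum_separable_unit j Y -> sum_separable_unit j (X * Y).
Proof.
move=> jN [XH [X' [XH' XX XX']]] [YH [Y' [YH' YY YY']]]; split; first exact: sum_separableM.
exists (Y' * X'); split; first exact: sum_separableM.
  by rewrite mulrA -(mulrA X) YY mulr1.
by rewrite mulrA -(mulrA Y') XX' mulr1.
Qed.

(** F_j asks only for a bounded inverse. A left inverse gives boundedness from below, and from that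
    the explicit inverse of the right form is obtained. *)
Lemma calF_unit j B : (j <= N)%N -> calF R N M j B -> sum_separable_unit j B.
Proof.
case: j => [|j] jN.
  move=> [BH [G [BG GB]]]; split; first by apply: (@separable_sub_sum 0) => //; rewrite -calHjE.
  have [Y [YH BY YB]] := multiplication_inverse BH (bounded_below_inv GB).
  by exists Y; split => //; apply: (@separable_sub_sum 0) => //; rewrite -calHjE.
move=> [[C]]; rewrite calHjE// => CH <- [G [BG GB]].
split; first by apply: sum_separableD; [exact: sum_separable1|exact: separable_sub_sum CH].
have [Y [YH BY YB]] := separable_inverse jN CH (bounded_below_inv GB).
exists (1 + Y); split => //.
by apply: sum_separableD; [exact: sum_separable1|exact: separable_sub_sum YH].
Qed.

Lemma calF0_bounded_below X : H 0 X -> bounded_below X -> calF R N M 0 X.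
Proof.
rewrite -calHjE// => XH Xb; split => //.
by have [Y [_ XY YX]] := multiplication_inverse XH Xb; exists Y.
Qed.

Lemma calFS_bounded_below j C : (j < N)%N -> H j.+1 C -> bounded_below (1 + C) ->
  calF R N M j.+1 (1 + C).
Proof.
move=> jN CH Cb; split; first by exists C => //; rewrite calHjE.
by have [Y [_ XY YX]] := separable_inverse jN CH Cb; exists (1 + Y).
Qed.

Lemma prod_calF_unit j (l : seq nat) (b : nat -> op) : (j <= N)%N ->
  (forall i, i \in l -> (i <= j)%N) -> (forall i, i \in l -> calF R N M i (b i)) ->
  sum_separable_unit j (\prod_(i <- l) b i).
Proof.
move=> jN; elim: l => [|i l IH] lj bF.
  rewrite big_nil; split; first exact: sum_separable1.
  by exists 1; split; rewrite ?mulr1//; exact: sum_separable1.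
have ij : (i <= j)%N by apply: lj; rewrite mem_head.
rewrite big_cons; apply: sum_separable_unitM => //.
  have [BH [Y [YH BY YB]]] := calF_unit (leq_trans ij jN) (bF i (mem_head _ _)).
  by split; [exact: sum_separable_mono BH|exists Y; split => //; exact: sum_separable_mono YH].
by apply: IH => l' l'l; [apply: lj|apply: bF]; rewrite inE l'l orbT.
Qed.

(** The list l holds the order of the factors, while b is indexed by the level j and not by the
    position. The same b can thus be used after an entry of l is removed or inserted. *)
Definition factors (l : seq nat) X (b : nat -> op) :=
  (forall i, i \in l -> calF R N M i (b i)) /\ X = \prod_(i <- l) b i.

(** Expanding L (1 + C) R = L R + L C R puts the last term in H_(j+1); by uniqueness of the
    decomposition, S = L R. *)
Lemma factors_remove j l1 l2 S A b : (j < N)%N ->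
  (forall i, i \in l1 ++ l2 -> (i <= j)%N) -> sum_separable j S -> H j.+1 A ->
  factors (l1 ++ j.+1 :: l2) (S + A) b -> factors (l1 ++ l2) S b.
Proof.
move=> jN lj SH AH [bF Xb].
have bF1 i : i \in l1 -> calF R N M i (b i) by move=> h; apply: bF; rewrite mem_cat h.
have bF2 i : i \in l2 -> calF R N M i (b i).
  by move=> h; apply: bF; rewrite mem_cat inE h !orbT.
have lj1 i : i \in l1 -> (i <= j)%N by move=> h; apply: lj; rewrite mem_cat h.
have lj2 i : i \in l2 -> (i <= j)%N by move=> h; apply: lj; rewrite mem_cat h orbT.
have [LH _] := prod_calF_unit (ltnW jN) lj1 bF1.
have [RH _] := prod_calF_unit (ltnW jN) lj2 bF2.
split; first by move=> i; rewrite mem_cat => /orP[/bF1|/bF2].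
have [[C CH bC] _] : calF R N M j.+1 (b j.+1).
  by apply: bF; rewrite mem_cat mem_head orbT.
rewrite calHjE// in CH.
move: Xb; rewrite !big_cat big_cons /= -bC mulrDl mul1r mulrDr => Xb.
have ACH := separable_mull_sum jN LH (separable_mulr_sum jN RH CH).
by have [] := sum_separable_decomposition jN SH (sum_separableM (ltnW jN) LH RH) AH ACH Xb.
Qed.

Lemma factors_unique_exists j X l : (j <= N)%N -> sum_separable j X -> bounded_below X ->
  perm_eq l (iota 0 j.+1) ->
  (exists b, factors l X b) /\
  (forall b b', factors l X b -> factors l X b' -> forall i, i \in l -> b i = b' i).
Proof.
elim: j X l => [|j IH] X l jN XH Xb lperm.
  have -> : l = [:: 0%N] by apply: perm_small_eq.
  have X0 : H 0 X by have [A [AH ->]] := XH; rewrite big_ord1; exact: AH.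
  split.
    exists (fun=> X); split; last by rewrite big_seq1.
    by move=> i; rewrite inE => /eqP ->; exact: calF0_bounded_below.
  move=> b b' [_ e] [_]; rewrite e !big_seq1 => e' i.
  by rewrite inE => /eqP ->.
have jl : j.+1 \in l by rewrite (perm_mem lperm) mem_iota add0n ltnSn.
have ul : uniq l by rewrite (perm_uniq lperm) iota_uniq.
(* The prescribed order is cut at the place of the highest level j.+1. *)
case/splitPr: jl lperm ul => l1 l2 lperm ul.
have lperm' : perm_eq (l1 ++ l2) (iota 0 j.+1).
  rewrite -(perm_cons j.+1).
  apply: (@perm_trans _ (l1 ++ j.+1 :: l2)); first by rewrite perm_sym -cat1s perm_catCA.
  apply: (perm_trans lperm).
  have -> : iota 0 j.+2 = iota 0 j.+1 ++ [:: j.+1] by rewrite -[j.+2]addn1 iotaD.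
  by rewrite perm_catC.
have lj i : i \in l1 ++ l2 -> (i <= j)%N.
  by rewrite (perm_mem lperm') mem_iota add0n /= ltnS.
have jl' i : i \in l1 ++ l2 -> (i == j.+1) = false.
  by move=> /lj ij; apply/negbTE; rewrite neq_ltn ltnS ij.
have [S [A [SH AH XE]]] := sum_separableS XH.
have Sb : bounded_below S by apply: sum_separable_bounded_below jN SH AH _; rewrite -XE.
have [[b bS] uS] := IH S (l1 ++ l2) (ltnW jN) SH Sb lperm'.
have inv b0 : (forall i, i \in l1 ++ l2 -> calF R N M i (b0 i)) ->
    sum_separable_unit j (\prod_(i <- l1) b0 i) /\ sum_separable_unit j (\prod_(i <- l2) b0 i).
  move=> bF; split; apply: prod_calF_unit; try exact: ltnW.
  - by move=> i h; apply: lj; rewrite mem_cat h.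
  - by move=> i h; apply: bF; rewrite mem_cat h.
  - by move=> i h; apply: lj; rewrite mem_cat h orbT.
  - by move=> i h; apply: bF; rewrite mem_cat h orbT.
split.
  have [bF SE] := bS; have [[LH [L' [LH' LL LL']]] [RH [R' [RH' RR RR']]]] := inv b bF.
  move: SE LL LL' RR RR'; rewrite big_cat /=.
  set L := \prod_(i <- l1) b i; set R0 := \prod_(i <- l2) b i => SE LL LL' RR RR'.
  (* L' and R' are the inverses of L and R, so L (1 + C) R = S + A = X. *)
  pose C := L' * (A * R').
  have CH : H j.+1 C by apply: separable_mull_sum => //; exact: separable_mulr_sum.
  have CE : 1 + C = L' * (X * R').
    by rewrite XE SE /C mulrDl mulrDr -(mulrA L R0) RR mulr1 LL'.
  (* L^-1 X R^-1 is a product of operators that are bounded below. *)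
  have Cb : bounded_below (1 + C).
    rewrite CE; apply: bounded_below_mul; first exact: bounded_below_inv LL.
    by apply: bounded_below_mul => //; exact: bounded_below_inv RR.
  exists (fun i => if i == j.+1 then 1 + C else b i); split.
    move=> i; rewrite mem_cat inE orbCA -mem_cat => /orP[/eqP ->|h].
      by rewrite eqxx; exact: calFS_bounded_below.
    by rewrite jl'//; exact: bF.
  rewrite big_cat big_cons /= eqxx.
  rewrite (@eq_big_seq _ _ _ _ l1 _ b) => [|i h]; last by rewrite jl'// mem_cat h.
  rewrite (@eq_big_seq _ _ _ _ l2 _ b) => [|i h]; last by rewrite jl'// mem_cat h orbT.
  rewrite -/L -/R0 CE XE -!mulrA RR' mulr1 !mulrA LL mul1r//.
move=> b1 b2; rewrite XE => f1 f2.
have g1 := factors_remove jN lj SH AH f1; have g2 := factors_remove jN lj SH AH f2.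
have e12 := uS _ _ g1 g2.
move=> i; rewrite mem_cat inE orbCA -mem_cat => /orP[/eqP ->|]; last exact: e12.
have [bF1 _] := g1; have [[LH [L' [LH' LL LL']]] [RH [R' [RH' RR RR']]]] := inv b1 bF1.
have [_ h1] := f1; have [_ h2] := f2; move: h2; rewrite h1 !big_cat !big_cons /=.
rewrite -(@eq_big_seq _ _ _ _ l1 b1 b2) => [|l' h]; last by apply: e12; rewrite mem_cat h.
rewrite -(@eq_big_seq _ _ _ _ l2 b1 b2) => [|l' h]; last by apply: e12; rewrite mem_cat h orbT.
(* The factors below level j.+1 agree, so both products have the same L and R, and cancelling them
   leaves the factors of level j.+1. *)
move=> /(congr1 (fun Z => L' * (Z * R'))).
by rewrite -!mulrA RR !mulr1 !mulrA LL' !mul1r.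
Qed.

Lemma sum_setsE : sum_sets (fun j : 'I_N.+1 => calHj R N M j) = sum_separable N.
Proof.
apply/seteqP; split=> X.
  move=> [A [AH ->]]; apply: sum_separable_sum => j _.
  by apply: (@separable_sub_sum j); [rewrite -ltnS|rewrite -calHjE].
move=> [A [AH ->]]; exists (fun j : 'I_N.+1 => A j); split => // j.
by rewrite calHjE//; apply: AH; rewrite -ltnS.
Qed.

Lemma calHE : calH R N M = sum_separable N.
Proof.
apply/seteqP; split=> X.
  apply; split; [split|].
  - exact: sum_separable0.
  - by move=> a F G; exact: sum_separable_linear.
  - by move=> F G; exact: sum_separableM.
  move=> F [FA|[j /andP[j0 jN] FA]].
    by apply: (@separable_sub_sum 0) => //; rewrite -calHjE.
  (* The generator <.>_j is A<B.>_j with A = B = 1. *)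
  apply: (@separable_sub_sum j) => //; exists M, (fun=> 1%:M), (fun=> 1%:M).
  split; [exact: hM|exact: continuous_cst_mx|exact: continuous_cst_mx|].
  apply: acts_as_eq FA => u k _; rewrite /mul_avg_op mul1mx.
  by congr (average _ _ _); apply/funext => l; rewrite mul1mx.
move=> [A [AH ->]] S [[S0 Slin Smul] gS].
apply: (big_ind S) => // [F G FS GS|i _]; first by rewrite -(scale1r F); exact: Slin.
have iN : (i <= N)%N by rewrite -ltnS.
by apply: (separable_calH hM iN (AH i iN)).
Qed.

Lemma perm_enum_iota (s : 'S_N.+1) :
  perm_eq [seq (s i : nat) | i <- enum 'I_N.+1] (iota 0 N.+1).
Proof.
apply: uniq_perm.
- by rewrite map_inj_uniq ?enum_uniq// => i l /val_inj/perm_inj.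
- exact: iota_uniq.
move=> n; rewrite mem_iota add0n /=; apply/mapP/idP => [[i _ ->]|nN] //.
by exists (s^-1%g (Ordinal nN)); rewrite ?mem_enum// permKV.
Qed.

(** Translates between operators indexed by level, as in [factors], and by position, as in
    [prod_repr]. *)
Lemma prod_repr_factors (s : 'S_N.+1) X (b : nat -> op) :
  factors [seq (s i : nat) | i <- enum 'I_N.+1] X b <->
  prod_repr (fun i : 'I_N.+1 => calF R N M (s i)) X (fun i => b (s i)).
Proof.
have bigE : \prod_(i <- enum 'I_N.+1) b (s i) = \prod_(i < N.+1) b (s i).
  by rewrite [index_enum _]unlock -enumT.
rewrite /factors /prod_repr big_map bigE; split=> -[bF ->]; split => //.
  by move=> i; apply: bF; apply/mapP; exists i; rewrite ?mem_enum.
by move=> n /mapP[i _ ->]; exact: bF.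
Qed.

Lemma factors_prod_repr (s : 'S_N.+1) X (B : 'I_N.+1 -> op) :
  prod_repr (fun i : 'I_N.+1 => calF R N M (s i)) X B ->
  factors [seq (s i : nat) | i <- enum 'I_N.+1] X (fun n => B (s^-1%g (inord n))).
Proof.
move=> XB; apply/prod_repr_factors; rewrite (_ : (fun i => _) = B)//.
by apply/funext => i; rewrite inord_val permK.
Qed.

End Factorization.

Theorem theorem1p7 (R : realType) (N M : nat) (hN : (1 <= N)%N) (hM : (1 <= M)%N) :
  [/\ calH R N M = sum_sets (fun j : 'I_N.+1 => calHj R N M j),
      forall s : 'S_N.+1,
        invertibles (calH R N M) = prod_sets (fun i : 'I_N.+1 => calF R N M (s i)),
      forall A, calH R N M A ->
        exists! A_ : 'I_N.+1 -> boundedOp R N M,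
          sum_repr (fun j : 'I_N.+1 => calHj R N M j) A A_
    & forall (s : 'S_N.+1) B, invertibles (calH R N M) B ->
        exists! B_ : 'I_N.+1 -> boundedOp R N M,
          prod_repr (fun i : 'I_N.+1 => calF R N M (s i)) B B_].
Proof.
have inv_below B : invertibles (calH R N M) B -> sum_separable N B /\ bounded_below B.
  by rewrite (calHE R N hM) => -[BH [G [_ GB]]]; split => //; exact: bounded_below_inv GB.
split.
- by rewrite (sum_setsE R N hM) (calHE R N hM).
- move=> s; apply/seteqP; split=> B.
    move=> /inv_below[BH Bb].
    have [[b /prod_repr_factors bB] _] :=
      factors_unique_exists hM (leqnn N) BH Bb (perm_enum_iota s).
    by exists (fun i => b (s i)).
  move=> [B_ /factors_prod_repr[bF ->]].
  have [|BH [Y [YH BY YB]]] := prod_calF_unit hM (leqnn N) _ bF.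
    by move=> n /mapP[i _ ->]; rewrite -ltnS.
  by split; [rewrite (calHE R N hM)|exists Y].
- move=> A; rewrite (calHE R N hM) => -[A_ [AH AE]].
  exists (fun i : 'I_N.+1 => A_ i); split.
    by split => // i; rewrite calHjE//; apply: AH; rewrite -ltnS.
  move=> A' [AH' AE'].
  (* The competing family, extended from ordinals to [nat], gets the form that [sum_separable_inj]
     compares. *)
  have A'E : A' = (fun i => (fun n => A' (inord n)) i) by apply/funext => i; rewrite inord_val.
  apply/funext => i; rewrite A'E.
  apply: (@sum_separable_inj R N M N A_ (fun n => A' (inord n))) => //.
  + by move=> l lN; have := AH' (inord l); rewrite calHjE// inordK.
  + by rewrite -AE AE'; apply: eq_bigr => l _; rewrite inord_val.
  + by rewrite -ltnS.
- move=> s B /inv_below[BH Bb].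
  have [[b bB] bu] := factors_unique_exists hM (leqnn N) BH Bb (perm_enum_iota s).
  exists (fun i => b (s i)); split; first exact/prod_repr_factors.
  move=> B' B'B; apply/funext => i.
  have -> := bu _ _ bB (factors_prod_repr B'B) (s i).
    by rewrite inord_val permK.
  by apply/mapP; exists i; rewrite ?mem_enum.
Qed.
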